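(* Let $\Gamma$ and $\Gamma_0$ be finite connected metric graphs, and let $q:\Gamma\to\mathbb{R}$ and $q_0:\Gamma_0\to\mathbb{R}$ be measurable and bounded, with $q\ge0$ almost everywhere on $\Gamma$ and $q_0\ge0$ almost everywhere on $\Gamma_0$. Let $\widetilde\Gamma$ be the graph formed by attaching $\Gamma_0$ to $\Gamma$ by $m$ vertices, with potential $\widetilde q$ equal to $q$ on the edges of $\Gamma$ and to $q_0$ on the edges of $\Gamma_0$. Write $\lambda_j,\lambda_j^+$ for the eigenvalues and positive eigenvalues of $-\Delta_{{\rm K},\Gamma,q}$, and $\widetilde\lambda_j,\widetilde\lambda_j^+$ for those of $-\Delta_{{\rm K},\widetilde\Gamma,\widetilde q}$. Then: (a) the positive eigenvalues satisfy $\widetilde\lambda_j^+\le\lambda_j^+$ for all $j\in\mathbb{N}$; (b) the eigenvalues (counting ground states) satisfy $\widetilde\lambda_{j+V_0-m}\le\lambda_j$ for all $j\in\mathbb{N}$, where $V_0$ is the number of vertices of $\Gamma_0$.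
   Context: A finite metric graph $\Gamma$ consists of a finite vertex set $\mathcal{V}$, a finite nonempty edge set $\mathcal{E}$ (loops and multiple edges allowed) and a length function $\ell:\mathcal{E}\to(0,\infty)$. Each edge $e$ is identified with $[0,\ell(e)]$, its two endpoints corresponding to the (possibly equal) vertices incident with $e$. A function $f$ on $\Gamma$ is a collection $(f_e)_{e\in\mathcal{E}}$ of functions $f_e:(0,\ell(e))\to\mathbb{C}$; $f\in L^2(\Gamma)$ means $f_e\in L^2(0,\ell(e))$ for all $e$. $\widetilde H^k(\Gamma)$ is the set of $f\in L^2(\Gamma)$ with $f_e\in H^k(0,\ell(e))$ for all $e$; $H^1(\Gamma)$ is the set of $f\in\widetilde H^1(\Gamma)$ that are continuous at each vertex (all traces at endpoints corresponding to the same vertex $v$ coincide; the common value is $f(v)$). For $f\in\widetilde H^2(\Gamma)$ and $v\in\mathcal{V}$, $\partial_\nu f(v)$ is the sum, over all edge endpoints located at $v$ (both endpoints of a loop at $v$ are counted), of the derivative of $f_e$ at that endpoint taken in the direction pointing towards $v$ (i.e. $f_e'(\ell(e))$ for the endpoint $\ell(e)$ and $-f_e'(0)$ for the endpoint $0$). Let $S$ be the operator in $L^2(\Gamma)$ with $(Sf)_e=-f_e''+q_ef_e$ on each edge and $\operatorname{dom}S=\{f\in\widetilde H^2(\Gamma)\cap H^1(\Gamma): f(v)=\partial_\nu f(v)=0\text{ for each }v\in\mathcal{V}\}$. It is closed, symmetric, densely defined with a positive lower bound; its adjoint $S^*$ acts in the same way on $\operatorname{dom}S^*=\widetilde H^2(\Gamma)\cap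 H^1(\Gamma)$. The perturbed Krein Laplacian $-\Delta_{{\rm K},\Gamma,q}$ is the Krein–von Neumann extension of $S$: the self-adjoint restriction of $S^*$ to $\operatorname{dom}S\dotplus\ker S^*$. Its spectrum is purely discrete and nonnegative; eigenvalues (resp. positive eigenvalues) are listed in nondecreasing order as $\lambda_1\le\lambda_2\le\dots$ (resp. $\lambda_1^+\le\lambda_2^+\le\dots$), counted with multiplicities. Attaching $\Gamma_0$ to $\Gamma$ by $m$ vertices ($m\ge1$): $\widetilde\Gamma$ is obtained from the disjoint union of $\Gamma$ and $\Gamma_0$ by choosing $m$ distinct vertices of $\Gamma_0$ and $m$ distinct vertices of $\Gamma$ and identifying them pairwise. *)

(* Defs.v *)
From HB Require Import structures.
From mathcomp Require Import all_boot all_order all_algebra.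
From mathcomp Require Import all_classical all_reals all_analysis.
From mathcomp Require Import complex.

Set Implicit Arguments.
Unset Strict Implicit.
Unset Printing Implicit Defensive.

Import Order.TTheory GRing.Theory Num.Theory.
Import numFieldNormedType.Exports.

Local Open Scope classical_set_scope.
Local Open Scope ring_scope.

(* The edge e is the interval [0, len e]; its endpoint 0 sits at src e and its
   endpoint len e at tgt e. Loops and multiple edges are allowed. *)
Record mgraph (R : realType) := MGraph {
  vert : finType;
  edge : finType;
  src : edge -> vert;
  tgt : edge -> vert;
  len : edge -> R;
  len_gt0 : forall e, 0 < len e;
  edge_nonempty : (0 < #|edge|)%N
}.

Definition adjacent (R : realType) (G : mgraph R) : rel (vert G) :=
  fun u v => [exists e : edge G, ((src e == u) && (tgt e == v))
                              || ((src e == v) && (tgt e == u))].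

Definition graph_connected (R : realType) (G : mgraph R) : Prop :=
  forall u v : vert G, connect (@adjacent R G) u v.

(* Attaching G0 to G: the vertex b i of G0 is identified with the vertex a i
   of G. The quotient of the disjoint union is represented by all vertices of G
   together with those vertices of G0 that are not one of the b i. *)
Section attach.
Variables (R : realType) (G G0 : mgraph R) (m : nat).
Variables (a : 'I_m -> vert G) (b : 'I_m -> vert G0).

Definition attach_vert : finType :=
  (vert G + {w : vert G0 | w \notin codom b})%type.

Definition attach_glue (w : vert G0) : attach_vert :=
  match boolP (w \in codom b) with
  | AltTrue wb => inl (a (iinv wb))
  | AltFalse wb => inr (exist _ w wb)
  end.

Definition attach_edge : finType := (edge G + edge G0)%type.

Definition attach_src (e : attach_edge) : attach_vert :=
  match e with inl e1 => inl (src e1) | inr e0 => attach_glue (src e0) end.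

Definition attach_tgt (e : attach_edge) : attach_vert :=
  match e with inl e1 => inl (tgt e1) | inr e0 => attach_glue (tgt e0) end.

Definition attach_len (e : attach_edge) : R :=
  match e with inl e1 => len e1 | inr e0 => len e0 end.

Lemma attach_len_gt0 e : 0 < attach_len e.
Proof. by case: e => e; exact: len_gt0. Qed.

Lemma attach_edge_nonempty : (0 < #|attach_edge|)%N.
Proof. by rewrite card_sum addn_gt0 edge_nonempty. Qed.

Definition attach : mgraph R :=
  MGraph attach_src attach_tgt attach_len_gt0 attach_edge_nonempty.

Definition attach_potential (q : edge G -> R -> R) (q0 : edge G0 -> R -> R) :
    edge attach -> R -> R :=
  fun e => match e with inl e1 => q e1 | inr e0 => q0 e0 end.

End attach.

Section interval.
Variable R : realType.
Implicit Types (l x : R) (f g : R -> R[i]).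

Definition ae_on l (P : R -> Prop) : Prop :=
  {ae @lebesgue_measure R, forall x, x \in `]0, l[ -> P x}.

(* Membership in L^2(0, l) of a Borel representative; elements of L^2 are
   always compared through ae_on. *)
Definition L2 l f : Prop :=
  [/\ measurable_fun `]0, l[ (fun x => complex.Re (f x)),
      measurable_fun `]0, l[ (fun x => complex.Im (f x)) &
      (@lebesgue_measure R).-integrable `]0, l[
        (fun x => (complex.Re (f x) ^+ 2 + complex.Im (f x) ^+ 2)%:E)].

Definition cintegral l f : R[i] :=
  Complex (\int[@lebesgue_measure R]_(x in `]0, l[) complex.Re (f x))
          (\int[@lebesgue_measure R]_(x in `]0, l[) complex.Im (f x)).

(* f belongs to H^1(0, l), with derivative f' and traces f0 at 0 and fl at l:
   f has the absolutely continuous representative x |-> f0 + int_0^x f', where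
   f' is square integrable. *)
Definition H1 l f f' (f0 fl : R[i]) : Prop :=
  [/\ L2 l f, L2 l f',
      ae_on l (fun x => f x = f0 + cintegral x f') &
      fl = f0 + cintegral l f'].

(* A real function is Lebesgue measurable iff it is a.e. equal to a Borel
   measurable one; measurable_fun is Borel measurability. *)
Definition lebesgue_measurable_on l (q : R -> R) : Prop :=
  exists2 q' : R -> R, measurable_fun `]0, l[ q'
                     & ae_on l (fun x => q x = q' x).

End interval.

Definition gfun (R : realType) (G : mgraph R) := edge G -> R -> R[i].

Section graph.
Variables (R : realType) (G : mgraph R).
Implicit Types (f g h : gfun G).

Definition gL2 f : Prop := forall e, L2 (len e) (f e).

Definition gae_eq f g : Prop :=
  forall e, ae_on (len e) (fun x => f e x = g e x).

Definition ginner f g : R[i] :=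
  \sum_(e : edge G) cintegral (len e) (fun x => f e x * conjc (g e x)).

Definition potential_ok (q : edge G -> R -> R) : Prop :=
  [/\ forall e, lebesgue_measurable_on (len e) (q e),
      exists M : R, forall e x, 0 < x < len e -> `|q e x| <= M &
      forall e, ae_on (len e) (fun x => 0 <= q e x)].

Definition continuous_with_values (fv : vert G -> R[i])
    (f0 fl : edge G -> R[i]) : Prop :=
  forall e, f0 e = fv (src e) /\ fl e = fv (tgt e).

(* Sum at v of the derivatives pointing towards v; d0 e and dl e are the
   traces of f_e' at 0 and len e. A loop at v contributes to both sums. *)
Definition normal_derivative (d0 dl : edge G -> R[i]) (v : vert G) : R[i] :=
  \sum_(e | tgt e == v) dl e - \sum_(e | src e == v) d0 e.

(* An operator in L^2(G) is given by its graph: T f h means that f lies in the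
   domain of T and T f = h. *)
Definition operator := gfun G -> gfun G -> Prop.

Definition opS (q : edge G -> R -> R) : operator := fun f h =>
  exists (f' f'' : gfun G) (f0 fl d0 dl : edge G -> R[i])
         (fv : vert G -> R[i]),
    [/\ forall e, H1 (len e) (f e) (f' e) (f0 e) (fl e),
        forall e, H1 (len e) (f' e) (f'' e) (d0 e) (dl e),
        continuous_with_values fv f0 fl,
        forall v, fv v = 0 /\ normal_derivative d0 dl v = 0 &
        gL2 h /\
        forall e, ae_on (len e)
          (fun x => h e x = - f'' e x + Complex (q e x) 0 * f e x)].

Definition adjoint (T : operator) : operator := fun f h =>
  [/\ gL2 f, gL2 h & forall u w, T u w -> ginner w f = ginner u h].

(* The restriction of the adjoint of T to dom T + ker T^*. *)
Definition krein_von_neumann (T : operator) : operator := fun f h =>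
  adjoint T f h /\
  exists u w k : gfun G,
    [/\ T u w, adjoint T k (fun _ _ => 0) &
        gae_eq f (fun e x => u e x + k e x)].

Definition krein_laplacian (q : edge G -> R -> R) : operator :=
  krein_von_neumann (opS q).

Definition eigenfunction (T : operator) (mu : R) f : Prop :=
  T f (fun e x => Complex mu 0 * f e x).

Definition lincomb n (c : 'I_n -> R[i]) (phi : 'I_n -> gfun G) : gfun G :=
  fun e x => \sum_(i < n) c i * phi i e x.

(* The eigenspace for mu has dimension n, as a subspace of L^2(G) (functions
   modulo a.e. equality): phi is a basis of it. n = 0 means that mu is not an
   eigenvalue. *)
Definition multiplicity (T : operator) (mu : R) (n : nat) : Prop :=
  exists phi : 'I_n -> gfun G,
    [/\ forall i, eigenfunction T mu (phi i),
        forall c : 'I_n -> R[i],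
          gae_eq (lincomb c phi) (fun _ _ => 0) -> forall i, c i = 0 &
        forall f, eigenfunction T mu f ->
          exists c : 'I_n -> R[i], gae_eq f (lincomb c phi)].

(* lam 0 <= lam 1 <= ... lists the eigenvalues of T that lie in P, each one
   repeated according to its multiplicity; the numbering starts at 0. *)
Definition eigenvalue_listing (T : operator) (P : set R) (lam : nat -> R) :
    Prop :=
  [/\ {homo lam : i j / (i <= j)%N >-> i <= j},
      forall j, P (lam j) &
      forall mu, P mu -> exists2 n : nat, multiplicity T mu n
                       & ([set j | lam j = mu] #= `I_n)%card].

End graph.

(* Main.v *)
From HB Require Import structures.
Require Import Defs.
From mathcomp Require Import all_boot all_order all_algebra.
From mathcomp Require Import all_classical all_reals all_analysis.
From mathcomp Require Import measurable_realfun.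
From mathcomp Require Import complex ring lra zify.

Set Implicit Arguments.
Unset Strict Implicit.
Unset Printing Implicit Defensive.

Import Order.TTheory GRing.Theory Num.Theory.
Import numFieldNormedType.Exports.

Local Open Scope classical_set_scope.
Local Open Scope ring_scope.

(** Let [A] send [h] to the solution of [- u'' + q u = h] on each edge with
    [u = 0] at all vertices, and let [kappa_v] solve [- k'' + q k = 0] on each
    edge with value 1 at the vertex [v] and 0 at the other vertices. By Green's
    formula [<h, kappa_v>] is minus the normal derivative of [A h] at [v], so
    [S] consists of the pairs [(A h, h)] with [h] orthogonal to all [kappa_v]
    ([opSP]), and its adjoint of the pairs [(f, h)] with [f - A h] in the span
    of the [kappa_v] ([adjointP]). Hence the eigenfunctions of the Krein
    extension for [mu <> 0] are the [f] orthogonal to the [kappa_v] with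
    [f - mu A f] in their span, those for [0] are that span, of dimension the
    number of vertices, and negative eigenvalues do not exist
    ([krein_eigen_pos], [krein_eigen_zero], [krein_eigen_neg]).

    The positive eigenvalues are therefore the inverses of the eigenvalues of
    the compression of the compact positive operator [A] to the complement of
    the [kappa_v], and they obey a minimax principle. Extension by zero embeds
    the functions on [G] isometrically into those on the attached graph; it
    commutes with [A], which acts edge by edge, and preserves orthogonality to
    the vertex kernels, because a kernel of the attached graph restricts to one
    of [G] or to zero ([iota_orth]). So the span of the first [j + 1]
    eigenfunctions of [G] supplies test functions for the attached graph, which
    gives (a). In the proof ([krein_comparison]) one picks in this span a vector
    orthogonal to the eigenfunctions of the attached graph below its [j]-th
    eigenvalue, and maximizes [<A h, h> / <h, h>] on the complement of these
    eigenfunctions ([maximizer_exists]): a violation of (a) would make the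
    maximizer an eigenfunction orthogonal to its own eigenspace.

    For (b), the eigenvalue 0 occupies the first places of the two listings, as
    many as there are vertices ([krein_listing_shift]), and the attached graph
    has [#|vert G| + #|vert G0| - m] of them ([card_attach]); behind these
    places the listings are those of (a).

    The analysis consists of three facts. The Dirichlet problem is solvable,
    by switching on the potential in small steps ([potential_solvable]). [A] is
    small up to finitely many point evaluations, since the energy bounds the
    modulus of continuity ([dirichlet_sample]), and it turns Cauchy sequences of
    L^2 into uniformly convergent ones ([dirichlet_cvg]); together this makes
    maximizing sequences converge. Finally a primitive determines its integrand
    ([prim_inj]), so [A g] determines [g]. *)

(** * Semi-inner product spaces *)

Lemma quadratic_ge0 (R : realFieldType) (a b c : R) :
  (forall t, 0 <= a + 2 * t * b + t ^+ 2 * c) -> b ^+ 2 <= a * c.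
Proof.
move=> H; have a0 : 0 <= a by have := H 0; lra.
have [c0|c0] := leP c 0.
  have [bz|b0] := eqVneq b 0; last first.
    have := H (- (a + 1) / (2 * b)); set t := - _ / _.
    have -> : 2 * t * b = - (a + 1) by rewrite /t; field.
    have := sqr_ge0 t; nra.
  rewrite bz expr0n /= mulr_ge0// leNgt; apply/negP => cn.
  have := H (1 - a / c); rewrite bz mulr0 addr0.
  have -> : a + (1 - a / c) ^+ 2 * c = c - a + a ^+ 2 / c.
    by field; rewrite lt_eqF.
  have : a ^+ 2 / c <= 0 by rewrite mulr_ge0_le0 ?sqr_ge0// invr_le0 ltW.
  lra.
have := H (- b / c).
have -> : a + 2 * (- b / c) * b + (- b / c) ^+ 2 * c = (a * c - b ^+ 2) / c.
  by field; rewrite gt_eqF.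
by rewrite pmulr_lge0 ?invr_gt0// subr_ge0.
Qed.

(** Functions that agree almost everywhere are not identified: the form is
    only semidefinite, and equality in L^2 is [eqnull] below. *)
Record sip (R : realType) (V : lmodType R[i]) := Sip {
  ip :> V -> V -> R[i];
  ipDl : forall f g h, ip (f + g) h = ip f h + ip g h;
  ipZl : forall c f h, ip (c *: f) h = c * ip f h;
  ipC : forall f g, ip g f = conjc (ip f g);
  ip_ge0 : forall f, 0 <= complex.Re (ip f f)
}.

Section sip_theory.
Variables (R : realType) (V : lmodType R[i]) (B : sip V).
Implicit Types (f g h : V) (a : R).

Lemma conjcD (x y : R[i]) : conjc (x + y) = conjc x + conjc y.
Proof. by case: x y => [? ?] [? ?] /=; congr Complex; ring. Qed.

Lemma conjcM (x y : R[i]) : conjc (x * y) = conjc x * conjc y.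
Proof. by case: x y => [? ?] [? ?] /=; congr Complex; ring. Qed.

Lemma conjcN (x : R[i]) : conjc (- x) = - conjc x.
Proof. by case: x => a b. Qed.

Definition rip f g : R := complex.Re (B f g).
Definition nsq f : R := rip f f.
Definition eqnull f g : Prop := nsq (f - g) = 0.

Definition sqn (c : R[i]) : R := complex.Re c ^+ 2 + complex.Im c ^+ 2.

Lemma ipDr f g h : B h (f + g) = B h f + B h g.
Proof. by rewrite ipC ipDl conjcD -!ipC. Qed.

Lemma ipZr c f h : B h (c *: f) = conjc c * B h f.
Proof. by rewrite ipC ipZl conjcM -!ipC. Qed.

Lemma ip0l h : B 0 h = 0.
Proof. by rewrite -(scale0r h) ipZl mul0r. Qed.

Lemma ip0r h : B h 0 = 0.
Proof. by rewrite ipC ip0l conjc0. Qed.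

Lemma ipNl f h : B (- f) h = - B f h.
Proof. by rewrite -scaleN1r ipZl mulN1r. Qed.

Lemma ipNr f h : B h (- f) = - B h f.
Proof. by rewrite ipC ipNl conjcN -ipC. Qed.

Lemma ipBl f g h : B (f - g) h = B f h - B g h.
Proof. by rewrite ipDl ipNl. Qed.

Lemma ipBr f g h : B h (f - g) = B h f - B h g.
Proof. by rewrite ipDr ipNr. Qed.

Lemma ip_suml (I : finType) (F : I -> V) h :
  B (\sum_i F i) h = \sum_i B (F i) h.
Proof.
by apply: (big_morph (fun f => B f h)) => [f g|]; rewrite ?ipDl ?ip0l.
Qed.

Lemma ip_sumr (I : finType) (F : I -> V) h :
  B h (\sum_i F i) = \sum_i B h (F i).
Proof. by apply: (big_morph (B h)) => [f g|]; rewrite ?ipDr ?ip0r. Qed.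

Lemma ripC f g : rip f g = rip g f.
Proof. by rewrite /rip ipC; case: (B g f). Qed.

Lemma ripDl f g h : rip (f + g) h = rip f h + rip g h.
Proof. by rewrite /rip ipDl raddfD. Qed.

Lemma ripBl f g h : rip (f - g) h = rip f h - rip g h.
Proof. by rewrite /rip ipBl raddfB. Qed.

Lemma ripZl a f h : rip (Complex a 0 *: f) h = a * rip f h.
Proof. by rewrite /rip ipZl; case: (B f h) => x y /=; ring. Qed.

Lemma ripDr f g h : rip h (f + g) = rip h f + rip h g.
Proof. by rewrite ripC ripDl !(ripC h). Qed.

Lemma ripBr f g h : rip h (f - g) = rip h f - rip h g.
Proof. by rewrite ripC ripBl !(ripC h). Qed.

Lemma ripZr a f h : rip h (Complex a 0 *: f) = a * rip h f.
Proof. by rewrite ripC ripZl !(ripC h). Qed.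

Lemma nsq_ge0 f : 0 <= nsq f.
Proof. exact: ip_ge0. Qed.

Lemma ip_self f : B f f = Complex (nsq f) 0.
Proof.
have := ipC B f f; rewrite /nsq /rip; case: (B f f) => x y /= [] Hy.
by congr Complex; lra.
Qed.

Lemma sqn_ge0 c : 0 <= sqn c.
Proof. by rewrite addr_ge0 ?sqr_ge0. Qed.

Lemma sqn_eq0 c : (sqn c == 0) = (c == 0).
Proof.
case: c => x y; rewrite /sqn /= paddr_eq0 ?sqr_ge0// !sqrf_eq0.
by apply/andP/eqP => [[/eqP-> /eqP->]//|[-> ->]].
Qed.

Lemma nsqZ c f : nsq (c *: f) = sqn c * nsq f.
Proof.
rewrite {1}/nsq /rip ipZl ipZr ip_self; case: c => x y; rewrite /sqn /=; ring.
Qed.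

Lemma nsqN f : nsq (- f) = nsq f.
Proof. by rewrite /nsq /rip ipNl ipNr opprK. Qed.

Lemma nsqB_sym f g : nsq (f - g) = nsq (g - f).
Proof. by rewrite -nsqN opprB. Qed.

Lemma nsqD f g : nsq (f + g) = nsq f + 2 * rip f g + nsq g.
Proof. rewrite /nsq ripDl !ripDr (ripC g f); ring. Qed.

Lemma nsqB f g : nsq (f - g) = nsq f - 2 * rip f g + nsq g.
Proof. rewrite /nsq ripBl !ripBr (ripC g f); ring. Qed.

(** Expand the square norm of [t *: f - g]. *)
Lemma rip_young t f g : 0 < t -> 2 * rip f g <= t * nsq f + t^-1 * nsq g.
Proof.
move=> t0; have := nsq_ge0 (Complex t 0 *: f - g).
rewrite nsqB nsqZ ripZl /sqn /= => H.
rewrite -(ler_pM2l t0) mulrDr !mulrA divff ?gt_eqF// mul1r; nra.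
Qed.

Lemma rip_CS f g : rip f g ^+ 2 <= nsq f * nsq g.
Proof.
apply: quadratic_ge0 => t; have := nsq_ge0 (f + Complex t 0 *: g).
by rewrite nsqD nsqZ ripC ripZl (ripC g) /sqn /= expr0n addr0 mulrA.
Qed.

(** Multiplying [f] by the conjugate of [B f g] makes the product real. *)
Lemma ip_CS f g : sqn (B f g) <= nsq f * nsq g.
Proof.
have [z0|z0] := eqVneq (sqn (B f g)) 0.
  by rewrite z0 mulr_ge0 ?nsq_ge0.
have zp : 0 < sqn (B f g) by rewrite lt_neqAle eq_sym z0 sqn_ge0.
have := rip_CS (conjc (B f g) *: f) g.
rewrite nsqZ {1}/rip ipZl.
have -> : complex.Re (conjc (B f g) * B f g) = sqn (B f g).
  by rewrite /sqn; case: (B f g) => x y /=; ring.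
have -> : sqn (conjc (B f g)) = sqn (B f g).
  by rewrite /sqn; case: (B f g) => x y /=; ring.
by rewrite expr2 -mulrA ler_pM2l.
Qed.

Lemma nsqD_le f g : nsq (f + g) <= 2 * nsq f + 2 * nsq g.
Proof. have := nsq_ge0 (f - g); rewrite nsqB nsqD; lra. Qed.

Lemma null_ip f g : nsq f = 0 -> B f g = 0.
Proof.
move=> f0; apply/eqP; rewrite -sqn_eq0; apply/eqP/le_anti.
by rewrite sqn_ge0 andbT (le_trans (ip_CS f g))// f0 mul0r.
Qed.

Lemma eqnull_refl f : eqnull f f.
Proof. by rewrite /eqnull subrr /nsq /rip ip0l. Qed.

Lemma eqnull_sym f g : eqnull f g -> eqnull g f.
Proof. by rewrite /eqnull nsqB_sym. Qed.

Lemma nullD f g : nsq f = 0 -> nsq g = 0 -> nsq (f + g) = 0.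
Proof.
move=> f0 g0; apply/le_anti; rewrite nsq_ge0 andbT.
by rewrite (le_trans (nsqD_le _ _))// f0 g0 !mulr0 addr0.
Qed.

Lemma nullZ c f : nsq f = 0 -> nsq (c *: f) = 0.
Proof. by rewrite nsqZ => ->; rewrite mulr0. Qed.

Lemma eqnull_trans g f h : eqnull f g -> eqnull g h -> eqnull f h.
Proof. by move=> fg gh; rewrite /eqnull -(subrKA g); exact: nullD. Qed.

Lemma eqnullD f g f' g' : eqnull f g -> eqnull f' g' -> eqnull (f + f') (g + g').
Proof. by move=> fg fg'; rewrite /eqnull opprD addrACA; exact: nullD. Qed.

Lemma eqnullZ c f g : eqnull f g -> eqnull (c *: f) (c *: g).
Proof. by move=> fg; rewrite /eqnull -scalerBr; exact: nullZ. Qed.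

Lemma eqnullB f g f' g' : eqnull f g -> eqnull f' g' -> eqnull (f - f') (g - g').
Proof. by move=> ? ?; apply: eqnullD => //; rewrite /eqnull -opprD nsqN. Qed.

Lemma eqnull_sum (I : finType) (F G : I -> V) :
  (forall i, eqnull (F i) (G i)) -> eqnull (\sum_i F i) (\sum_i G i).
Proof.
move=> FG; apply: (big_ind2 eqnull) => // [|f g f' g'];
  [exact: eqnull_refl|exact: eqnullD].
Qed.

Lemma eqnull_ipl f g h : eqnull f g -> B f h = B g h.
Proof. by move=> /(null_ip h); rewrite ipBl => /eqP; rewrite subr_eq0 => /eqP. Qed.

Lemma eqnull_ipr f g h : eqnull f g -> B h f = B h g.
Proof. by move=> fg; rewrite ipC (eqnull_ipl _ fg) -ipC. Qed.

Lemma orth_eqnull f g : (forall h, B f h = B g h) -> eqnull f g.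
Proof. by move=> H; rewrite /eqnull /nsq /rip ipBl H subrr. Qed.

Lemma eqnull_nsq f g : eqnull f g -> nsq f = nsq g.
Proof. by move=> fg; rewrite /nsq /rip (eqnull_ipl _ fg) (eqnull_ipr _ fg). Qed.

Definition lc (I : finType) (c : I -> R[i]) (L : I -> V) : V :=
  \sum_i c i *: L i.

Definition orth (I : finType) (L : I -> V) f := forall i, B f (L i) = 0.

Definition inspan (I : finType) (L : I -> V) f :=
  exists c : I -> R[i], eqnull f (lc c L).

Definition free_fam (I : finType) (L : I -> V) :=
  forall c : I -> R[i], eqnull (lc c L) 0 -> forall i, c i = 0.

Lemma lc_ip (I : finType) (c : I -> R[i]) (L : I -> V) f :
  B (lc c L) f = \sum_i c i * B (L i) f.
Proof. by rewrite ip_suml; apply: eq_bigr => i _; rewrite ipZl. Qed.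

Lemma orth_lc (I : finType) (c : I -> R[i]) (L : I -> V) f : orth L f -> B f (lc c L) = 0.
Proof.
by move=> Lf; rewrite ip_sumr big1// => i _; rewrite ipZr Lf mulr0.
Qed.

Lemma orth_inspan (I : finType) (L : I -> V) f g : orth L f -> inspan L g -> B f g = 0.
Proof. by move=> Lf [c gc]; rewrite (eqnull_ipr _ gc) orth_lc. Qed.

Lemma orthB (I : finType) (L : I -> V) f g : orth L f -> orth L g -> orth L (f - g).
Proof. by move=> Lf Lg i; rewrite ipBl Lf Lg subrr. Qed.

Lemma orthZ (I : finType) (L : I -> V) c f : orth L f -> orth L (c *: f).
Proof. by move=> Lf i; rewrite ipZl Lf mulr0. Qed.

Lemma orth_eqnull_trans (I : finType) (L : I -> V) f g :
  eqnull f g -> orth L f -> orth L g.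
Proof. by move=> fg Lf i; rewrite -(eqnull_ipl _ fg). Qed.

Lemma lcB (I : finType) (c d : I -> R[i]) (L : I -> V) :
  lc c L - lc d L = lc (fun i => c i - d i) L.
Proof. by rewrite -sumrB; apply: eq_bigr => i _; rewrite scalerBl. Qed.

Lemma lcD (I : finType) (c d : I -> R[i]) (L : I -> V) :
  lc c L + lc d L = lc (fun i => c i + d i) L.
Proof. by rewrite -big_split; apply: eq_bigr => i _; rewrite scalerDl. Qed.

Lemma lcZ (I : finType) (a : R[i]) (c : I -> R[i]) (L : I -> V) :
  a *: lc c L = lc (fun i => a * c i) L.
Proof. by rewrite scaler_sumr; apply: eq_bigr => i _; rewrite scalerA. Qed.

Lemma inspan_eqnull (I : finType) (L : I -> V) f g :
  eqnull f g -> inspan L f -> inspan L g.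
Proof.
by move=> fg [c fc]; exists c; apply: eqnull_trans fc; exact: eqnull_sym.
Qed.

Lemma inspanB (I : finType) (L : I -> V) f g :
  inspan L f -> inspan L g -> inspan L (f - g).
Proof.
by move=> [c fc] [d gd]; exists (fun i => c i - d i); rewrite -lcB; exact: eqnullB.
Qed.

Lemma inspanD (I : finType) (L : I -> V) f g :
  inspan L f -> inspan L g -> inspan L (f + g).
Proof.
by move=> [c fc] [d gd]; exists (fun i => c i + d i); rewrite -lcD; exact: eqnullD.
Qed.

Lemma inspanZ (I : finType) (L : I -> V) (a : R[i]) f : inspan L f -> inspan L (a *: f).
Proof.
by move=> [c fc]; exists (fun i => a * c i); rewrite -lcZ; exact: eqnullZ.
Qed.

Lemma inspan_lc (I J : finType) (L : I -> V) (F : J -> V) (c : J -> R[i]) :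
  (forall j, inspan L (F j)) -> inspan L (lc c F).
Proof.
move=> LF; rewrite /lc; elim/big_ind: _ => [|f g|j _].
- exists (fun=> 0); rewrite /lc big1 => [|i _]; rewrite ?scale0r//.
  exact: eqnull_refl.
- exact: inspanD.
- exact: inspanZ.
Qed.

(** The Gram matrix of [L] represents all right-hand sides [<f, L_k>], because
    a vector of its kernel is the coefficient vector of a null combination. *)
Lemma gram_projection n (L : 'I_n -> V) f : exists c, orth L (f - lc c L).
Proof.
pose Gm : 'M[R[i]]_n := \matrix_(i, k) B (L i) (L k).
pose b : 'rV[R[i]]_n := \row_k B f (L k).
suff /submxP[D bD] : (b <= Gm)%MS.
  exists (fun i => D 0 i) => k; rewrite ipBl lc_ip.
  have := congr1 (fun X : 'rV_n => X 0 k) bD; rewrite !mxE => ->.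
  apply/eqP; rewrite subr_eq0; apply/eqP.
  by apply: eq_bigr => i _; rewrite mxE.
rewrite submxE; apply/eqP.
move: (mulmx_coker Gm); set N := cokermx Gm => GN; clearbody N.
apply/rowP => j; rewrite !mxE.
pose x := lc (fun k => conjc (N k j)) L.
have Lx : forall i, B (L i) x = 0.
  move=> i; rewrite ip_sumr.
  have := congr1 (fun X : 'M[R[i]]_n => X i j) GN.
  rewrite !mxE => E; rewrite -[RHS]E; apply: eq_bigr => k _.
  by rewrite ipZr mxE conjcK mulrC.
have x0 : nsq x = 0.
  by rewrite /nsq /rip {1}/x lc_ip big1// => i _; rewrite Lx mulr0.
have : B f x = 0 by rewrite ipC (null_ip _ x0) conjc0.
rewrite ip_sumr => E; rewrite -[RHS]E; apply: eq_bigr => k _.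
by rewrite ipZr mxE conjcK mulrC.
Qed.

Lemma projection (I : finType) (L : I -> V) f : exists c, orth L (f - lc c L).
Proof.
pose L' (k : 'I_#|I|) := L (enum_val k).
have [c Lc] := gram_projection L' f.
pose c' i := c (enum_rank i).
have E : lc c' L = lc c L'.
  rewrite /lc (reindex (fun k : 'I_#|I| => enum_val k)) /=.
    by apply: eq_bigr => k _; rewrite /c' enum_valK.
  by exists enum_rank => k _; rewrite ?enum_valK ?enum_rankK.
exists c'; rewrite E => i.
by have := Lc (enum_rank i); rewrite /L' enum_rankK.
Qed.

Lemma orth_orth (I : finType) (L : I -> V) f :
  (forall g, orth L g -> B g f = 0) -> inspan L f.
Proof.
move=> H; have [c Lc] := projection L f; exists c.
by rewrite /eqnull {1}/nsq /rip ipBr (H _ Lc) (orth_lc _ Lc) subr0.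
Qed.

(** More vectors than [#|I|] have a coefficient matrix with nontrivial kernel. *)
Lemma free_le n (I : finType) (F : 'I_n -> V) (L : I -> V) :
  free_fam F -> (forall i, inspan L (F i)) -> (n <= #|I|)%N.
Proof.
move=> Ff FL; rewrite leqNgt; apply/negP => ltn.
have /choice[M FM] : forall i, exists c : I -> R[i], eqnull (F i) (lc c L) by [].
pose A : 'M[R[i]]_(n, #|I|) := \matrix_(i, k) M i (enum_val k).
have : kermx A != 0.
  rewrite -mxrank_eq0 mxrank_ker subn_eq0 -ltnNge.
  exact: leq_ltn_trans (rank_leq_col A) ltn.
move=> /rowV0Pn[v vA v0].
move/eqP: v0; apply; apply/rowP => i; rewrite mxE.
apply: (Ff (fun i => v 0 i)).
apply: (@eqnull_trans (\sum_i v 0 i *: lc (M i) L)).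
  by apply: eqnull_sum => k; apply: eqnullZ; exact: FM.
have -> : \sum_i v 0 i *: lc (M i) L = 0; last exact: eqnull_refl.
under eq_bigr do rewrite lcZ /lc.
rewrite exchange_big big1//= => k _; rewrite -scaler_suml.
have /sub_kermxP/(congr1 (fun N : 'rV_#|I| => N 0 (enum_rank k))) := vA.
rewrite !mxE.
under eq_bigr do rewrite mxE enum_rankK.
by move=> E; rewrite E scale0r.
Qed.

End sip_theory.

(** * Maximizers of compact quadratic forms *)

(** The sets [P eta] shrink with [eta] and generate a filter; a cluster point in
    [R^n] of its image under the functionals [l i] is approximated along [h]. *)
Lemma bolzano_weierstrass (R : realType) (T : Type) n (l : 'I_n -> T -> R)
    (P : R -> T -> Prop) (b : R) :
  (forall eta, 0 < eta -> exists h, P eta h) ->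
  (forall eta eta' h, eta <= eta' -> P eta h -> P eta' h) ->
  (forall h i, P 1 h -> `|l i h| <= b) ->
  exists h : nat -> T, forall k, P k.+1%:R^-1 (h k) /\
    forall i m, (k <= m)%N -> `|l i (h m) - l i (h k)| <= 2 / k.+1%:R.
Proof.
move=> Pex Pmon Pb.
pose z (h : T) : 'rV[R]_n := \row_i l i h.
pose F : set_system 'rV[R]_n :=
  fun U => exists2 eta, 0 < eta & forall h, P eta h -> U (z h).
have FF : ProperFilter F.
  split; first by move=> [eta eta0 H]; have [h /H] := Pex _ eta0.
  split; first by exists 1.
  - move=> U W [e1 e10 H1] [e2 e20 H2]; exists (Num.min e1 e2).
      by rewrite lt_min e10 e20.
    move=> h Ph; split.
      by apply: H1; apply: Pmon Ph; rewrite ge_min lexx.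
    by apply: H2; apply: Pmon Ph; rewrite ge_min lexx orbT.
  - by move=> U W UW [e e0 H]; exists e => // h /H /UW.
have := @rV_compact R n (fun=> `[- b, b]%classic) (fun=> @segment_compact _ _ _).
move=> /(_ F FF) [].
  exists 1; rewrite ?ltr01// => h Ph i; rewrite mxE /= in_itv /=.
  by rewrite -ler_norml; exact: Pb.
move=> L [_ clL].
have step k : exists h, P k.+1%:R^-1 h /\
    forall i, `|L ord0 i - l i h| < k.+1%:R^-1.
  have k0 : 0 < k.+1%:R^-1 :> R by rewrite invr_gt0.
  have FA : F (z @` P k.+1%:R^-1) by exists k.+1%:R^-1 => // h Ph; exists h.
  have [_ [[h Ph <-] Lh]] := clL _ _ FA (nbhsx_ballx L _ k0).
  exists h; split => // i.
  by have [_ /(_ ord0 i)] := Lh; rewrite /ball /= mxE.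
have [h Hh] := choice step.
exists h => k; have [Pk Lk] := Hh k; split => // i m km.
have [_ /(_ i) Lm] := Hh m; have {Lk} := Lk i => Lk.
rewrite -(subrKA (L ord0 i)) (le_trans (ler_normD _ _))// mulr_natl mulr2n.
rewrite lerD ?(ltW Lk)// distrC (le_trans (ltW Lm))//.
by rewrite lef_pV2 ?posrE// ler_nat.
Qed.

Lemma le_inv_nat_eq0 (R : realType) (x c : R) :
  0 <= x -> (forall n : nat, x <= c / n.+1%:R) -> x = 0.
Proof.
move=> x0 H; apply/eqP; rewrite eq_le x0 andbT leNgt; apply/negP => xp.
have := H (Num.truncn (c / x)); rewrite leNgt => /negP; apply.
rewrite ltr_pdivrMr// mulrC -ltr_pdivrMr//.
by rewrite truncnS_gt.
Qed.

(** The properties of the inverse of the Dirichlet operator on which the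
    spectral theory rests. [compact_cpt] says that, up to finitely many
    bounded functionals, [A] is as small as desired; [compact_cvg] is what is
    needed of completeness: [A] turns Cauchy sequences into convergent ones. *)
Record compact_op (R : realType) (V : lmodType R[i]) (B : sip V)
    (A : V -> V) : Prop := CompactOp {
  compact_sym : forall f g, B (A f) g = B f (A g);
  compact_bd : exists2 C : R, 0 < C &
    forall f, nsq B (A f) <= C * rip B (A f) f;
  compact_cpt : forall eps : R, 0 < eps ->
    exists (n : nat) (l : 'I_n -> V -> R) (K b : R),
    [/\ 0 < K /\ 0 < b,
        forall i f g, l i (f - g) = l i f - l i g,
        forall i f, l i f ^+ 2 <= b * nsq B f &
        forall f, nsq B (A f) <=
          eps * rip B (A f) f + K * \sum_i (l i f) ^+ 2];
  compact_cvg : forall (f : nat -> V) (c : R),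
    (forall n m, (n <= m)%N -> nsq B (f m - f n) <= c / n.+1%:R) ->
    exists (g : V) (c' : R), forall n, nsq B (A (f n) - g) <= c' / n.+1%:R
}.

Section compact_theory.
Variables (R : realType) (V : lmodType R[i]) (B : sip V) (A : V -> V).
Hypothesis Aop : compact_op B A.
Implicit Types (f g h : V).

Let Asym := compact_sym Aop.

Lemma rip_sym f g : rip B (A f) g = rip B f (A g).
Proof. by rewrite /rip Asym. Qed.

Lemma compact_ge0 f : 0 <= rip B (A f) f.
Proof.
have [C C0 /(_ f) H] := compact_bd Aop.
by rewrite -(pmulr_rge0 _ C0) (le_trans _ H)// nsq_ge0.
Qed.

Lemma compactB f g : eqnull B (A (f - g)) (A f - A g).
Proof. by apply: orth_eqnull => h; rewrite Asym !ipBl !Asym. Qed.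

Lemma compactZ c f : eqnull B (A (c *: f)) (c *: A f).
Proof. by apply: orth_eqnull => h; rewrite Asym !ipZl !Asym. Qed.

Lemma compact_lc (I : finType) c (L : I -> V) :
  eqnull B (A (lc c L)) (lc c (A \o L)).
Proof.
apply: orth_eqnull => h; rewrite Asym !lc_ip.
by apply: eq_bigr => i _; rewrite /= Asym.
Qed.

Lemma compact_bounded :
  exists2 C, 0 < C & forall f, nsq B (A f) <= C * nsq B f.
Proof.
have [C C0 CA] := compact_bd Aop.
exists (C ^+ 2); first by rewrite exprn_gt0.
move=> f; have := rip_young B (A f) f (t := C^-1).
rewrite invr_gt0 => /(_ C0); rewrite invrK => Y.
have := CA f.
have : C * (2 * rip B (A f) f) <= nsq B (A f) + C ^+ 2 * nsq B f.
  rewrite (le_trans (ler_wpM2l (ltW C0) Y))// mulrDr !mulrA divff ?gt_eqF//.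
  by rewrite mul1r expr2.
lra.
Qed.

Section maximizer.
Variables (I : finType) (L : I -> V).

Let Y := orth B L.

(** Let [M] be the supremum of the quotient [<A h, h> / <h, h>] over [Y]. The
    form [M <d, d> - <A d, d>] is nonnegative on [Y], and by compactness it
    dominates [M <d, d> / 2] up to finitely many functionals. Hence a
    maximizing sequence along which these functionals converge is Cauchy. *)
Lemma maximizing_cauchy M :
  0 < M -> (forall h, Y h -> rip B (A h) h <= M * nsq B h) ->
  (forall eta, 0 < eta -> exists h, [/\ Y h, nsq B h = 1 &
      M - eta < rip B (A h) h]) ->
  exists (h : nat -> V) (c : R), forall k : nat,
    [/\ Y (h k), nsq B (h k) = 1, M - k.+1%:R^-1 <= rip B (A (h k)) (h k) &
      forall m, (k <= m)%N -> nsq B (h m - h k) <= c / k.+1%:R].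
Proof.
move=> M0 Mub Msup.
have M20 : 0 < M / 2 by rewrite divr_gt0.
have [N [l [K [b [[K0 b0] lB lb Acpt]]]]] := compact_cpt Aop M20.
pose P eta h := [/\ Y h, nsq B h = 1 & M - eta < rip B (A h) h].
have [||h i [_ h1 _]|h Hh] := @bolzano_weierstrass _ _ N l P (b + 1).
- exact: Msup.
- by move=> e e' h ee [? ? ?]; split => //; lra.
- have := lb i h; rewrite h1 mulr1 => H.
  have : `|l i h| ^+ 2 <= b by rewrite real_normK// num_real.
  have := normr_ge0 (l i h); move: (`|l i h|) => x; nra.
have Q d : Y d -> nsq B d <= (2 / M) *
    (M * nsq B d - rip B (A d) d + (2 / M) * K * \sum_i (l i d) ^+ 2).
  move=> Yd; have Y1 := rip_young B (A d) d (t := 2 / M).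
  rewrite divr_gt0// in Y1; have {Y1} := Y1 isT.
  rewrite invf_div => Y1; have {}Acpt := Acpt d.
  set s := \sum_i _ in Acpt *; set r := rip B (A d) d in Y1 Acpt *.
  have E : 2 / M * nsq B (A d) <= 2 / M * (M / 2 * r + K * s).
    by rewrite ler_wpM2l// divr_ge0// ltW.
  have E2 : 2 / M * (M / 2 * r + K * s) = r + 2 / M * K * s.
    by field; rewrite gt_eqF.
  have -> : 2 / M * (M * nsq B d - r + 2 / M * K * s) =
    nsq B d + 2 / M * ((M / 2) * nsq B d - r + 2 / M * K * s).
    by field; rewrite gt_eqF.
  rewrite lerDl mulr_ge0 ?divr_ge0 ?(ltW M0)//; lra.
pose c := 2 / M * (4 + 2 / M * K * (\sum_(i < N) 4)).
exists h, c => k; have [[Yk k1 Qk] lk] := Hh k; split=> //; first exact: ltW.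
move=> m km; have [[Ym m1 Qm] _] := Hh m.
have Yd : Y (h m - h k) by exact: orthB.
apply: (le_trans (Q _ Yd)); rewrite /c -[leRHS]mulrA ler_wpM2l ?divr_ge0 ?(ltW M0)//.
rewrite [leRHS]mulrDl lerD//.
  have Ys : Y (h m + h k).
    by move=> i; rewrite ipDl Ym Yk addr0.
  have := Mub _ Ys.
  rewrite nsqB nsqD m1 k1.
  have ED d d' : rip B (A (d + d')) (d + d') =
      rip B (A d) d + 2 * rip B (A d) d' + rip B (A d') d'.
    rewrite rip_sym ripDl -!rip_sym !ripDr (rip_sym d' d) (ripC B d' _); ring.
  have EB d d' : rip B (A (d - d')) (d - d') =
      rip B (A d) d - 2 * rip B (A d) d' + rip B (A d') d'.
    rewrite rip_sym ripBl -!rip_sym !ripBr (rip_sym d' d) (ripC B d' _); ring.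
  rewrite ED EB => H.
  have : m.+1%:R^-1 <= k.+1%:R^-1 :> R by rewrite lef_pV2 ?posrE// ler_nat.
  move: Qm Qk H; move: (k.+1%:R^-1) (m.+1%:R^-1) (rip B (A (h k)) (h k)).
  move: (rip B (A (h m)) (h m)) (rip B (A (h m)) (h k)) (rip B (h m) (h k)).
  move=> a b' r e e' a' *; nra.
rewrite -[leRHS]mulrA ler_wpM2l ?mulr_ge0 ?invr_ge0 ?(ltW M0) ?(ltW K0)//.
rewrite mulr_suml ler_sum// => i _.
rewrite lB; have := lk i m km.
have : k.+1%:R^-1 <= 1 :> R by rewrite invf_le1// ler1n.
have : 0 <= k.+1%:R^-1 :> R by rewrite invr_ge0.
rewrite -[X in X <= 4 * _]real_normK ?num_real//.
have := normr_ge0 (l i (h m) - l i (h k)).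
move: (`|_|) (k.+1%:R^-1) => x y; nra.
Qed.

(** By Cauchy-Schwarz for the nonnegative form [M <u, v> - <A u, v>] on [Y], the
    vector [A h_k - M h_k] of a maximizing sequence becomes orthogonal to [Y].
    Since [A h_k] converges, so does [h_k], and the limit is a maximizer. *)
Lemma maximizer_exists h0 : Y h0 -> 0 < rip B (A h0) h0 ->
  exists (h : V) (M : R), [/\ nsq B h = 1, Y h, 0 < M,
    rip B (A h0) h0 <= M * nsq B h0 &
    inspan B L (A h - Complex M 0 *: h)].
Proof.
move=> Y0 A0.
have [C C0 CA] := compact_bd Aop.
have [C' C'0 CA'] := compact_bounded.
have AC f : rip B (A f) f <= C' * nsq B f + nsq B f.
  have := rip_young B (A f) f ltr01; rewrite invr1 !mul1r.
  have := CA' f; have := nsq_ge0 B f; have := nsq_ge0 B (A f); lra.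
have n0 : 0 < nsq B h0.
  rewrite lt_neqAle nsq_ge0 andbT; apply: contraTneq A0 => /esym h0n.
  by rewrite ripC /rip null_ip//= ltxx.
pose E : set R := [set x | exists h, [/\ Y h, nsq B h = 1 & x = rip B (A h) h]].
have normalize f : 0 < nsq B f -> Y f -> E (rip B (A f) f / nsq B f).
  move=> f0 Yf; pose t := Num.sqrt (nsq B f)^-1.
  have t2 : t ^+ 2 = (nsq B f)^-1 by rewrite sqr_sqrtr// invr_ge0 ltW.
  exists (Complex t 0 *: f); split; first exact: orthZ.
    by rewrite nsqZ /sqn /= expr0n /= addr0 t2 mulVf ?gt_eqF.
  rewrite [in RHS]/rip (eqnull_ipl _ (compactZ _ _)) -/(rip _ _ _).
  by rewrite ripZl ripZr mulrA -expr2 t2 mulrC.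
have E0 : E !=set0 by exists (rip B (A h0) h0 / nsq B h0); exact: normalize.
have Eub : has_ubound E.
  exists (C' + 1) => _ [h [_ h1 ->]]; have := AC h; rewrite h1; lra.
have Es : has_sup E by split.
pose M := sup E.
have M_ge f : 0 < nsq B f -> Y f -> rip B (A f) f <= M * nsq B f.
  by move=> f0 Yf; rewrite -ler_pdivrMr//; apply: ub_le_sup => //; exact: normalize.
have M0 : 0 < M.
  by rewrite -(pmulr_lgt0 _ n0); exact: lt_le_trans A0 (M_ge _ n0 Y0).
have Mub f : Y f -> rip B (A f) f <= M * nsq B f.
  move=> Yf; have := nsq_ge0 B f; rewrite le_eqVlt => /orP[/eqP f0|f0]; last exact: M_ge.
  by rewrite -f0 mulr0 ripC /rip null_ip.
have [eta e0|h [c Hh]] := maximizing_cauchy M0 Mub.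
  have [_ [h [Yh h1 ->]] Mh] := sup_adherent e0 Es.
  by exists h; split => //; rewrite addrC -/M in Mh *; rewrite addrC.
have [k m km|g [c' gc]] := compact_cvg Aop (f := h) (c := c).
  by have [_ _ _] := Hh k; exact.
(* M y is the component in Y of the limit g of A h_k, to be shown near M h_k *)
have [d Yg] := projection B L g.
pose y := Complex M^-1 0 *: (g - lc d L).
have MyE : Complex M 0 *: y = g - lc d L.
  rewrite /y scalerA.
  have -> : Complex M 0 * Complex M^-1 0 = 1 :> R[i].
    by congr Complex; rewrite ?divff ?gt_eqF//; ring.
  by rewrite scale1r.
have Yy : Y y by exact: orthZ.
(* the form M <,> - <A ,> is nonnegative on Y, so it obeys Cauchy-Schwarz *)
have QCS k v : Y v -> (M * rip B (h k) v - rip B (A (h k)) v) ^+ 2 <=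
     k.+1%:R^-1 * (M * nsq B v).
  move=> Yv; have [Yk k1 Qk _] := Hh k.
  set u := h k in Yk k1 Qk *.
  pose q x := M * nsq B x - rip B (A x) x.
  pose b := M * rip B u v - rip B (A u) v.
  have qt t : 0 <= q u + 2 * t * b + t ^+ 2 * q v.
    have Yuv : Y (u + Complex t 0 *: v).
      by move=> i; rewrite ipDl Yk (orthZ _ Yv) addr0.
    have := Mub _ Yuv; rewrite nsqD nsqZ ripZr /sqn /= expr0n addr0.
    have -> : rip B (A (u + Complex t 0 *: v)) (u + Complex t 0 *: v) =
        rip B (A u) u + 2 * t * rip B (A u) v + t ^+ 2 * rip B (A v) v.
      rewrite rip_sym ripDl ripZl -!rip_sym !ripDr !ripZr.
      rewrite (rip_sym v u) (ripC B v _); ring.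
    rewrite /q /b; lra.
  have qv0 : 0 <= q v by rewrite /q subr_ge0; exact: Mub.
  have qvM : q v <= M * nsq B v by rewrite /q lerBlDr lerDl compact_ge0.
  have quk : q u <= k.+1%:R^-1 by rewrite /q k1; move: Qk; move: (k.+1%:R^-1) => e; lra.
  have qu0 : 0 <= q u by rewrite /q subr_ge0; exact: Mub.
  apply: (@le_trans _ _ (q u * q v)); last by rewrite ler_pM.
  exact: quadratic_ge0 qt.
have near k : nsq B (Complex M 0 *: (y - h k)) <= (2 * (M + c')) / k.+1%:R.
  have [Yk k1 Qk _] := Hh k.
  set u := h k in Yk k1 Qk *.
  pose v := Complex M 0 *: (y - u).
  have Yv : Y v by apply: orthZ; exact: orthB.
  have vE : nsq B v = rip B (g - A u) v - (M * rip B u v - rip B (A u) v).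
    rewrite {1}/nsq {1}/v scalerBr MyE !ripBl ripZl.
    have -> : rip B (lc d L) v = 0 by rewrite ripC /rip orth_lc.
    ring.
  have H1 := QCS k v Yv.
  have H2 := rip_CS B (g - A u) v.
  have H3 := gc k; rewrite nsqB_sym -/u in H3.
  rewrite -/v; move: vE H1 H2 H3; rewrite -/u.
  have := nsq_ge0 B v; have := nsq_ge0 B (g - A u).
  set X := nsq B v; set W := nsq B _; set r := rip B _ _.
  set s := M * _ - _ => W0 X0 XE sM rW Wc.
  have XX : X ^+ 2 <= X * (2 * (M / k.+1%:R + W)).
    have : X ^+ 2 <= 2 * r ^+ 2 + 2 * s ^+ 2.
      by rewrite XE; have := sqr_ge0 (r + s); nra.
    move: rW sM; move: (k.+1%:R^-1) => e; nra.
  move: X0; rewrite le_eqVlt => /orP[/eqP<-|Xp].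
    rewrite divr_ge0// mulr_ge0// addr_ge0 ?(ltW M0)//.
    by rewrite -(pmulr_lge0 _ (x := k.+1%:R^-1)) ?invr_gt0// (le_trans W0).
  move: XX; rewrite expr2 ler_pM2l// => XX; move: XX Wc.
  by move: (k.+1%:R^-1) => e; lra.
have yh k : nsq B (y - h k) <= ((2 * (M + c')) / M ^+ 2) / k.+1%:R.
  have := near k; rewrite nsqZ /sqn /= expr0n addr0 => H.
  rewrite -(ler_pM2l (exprn_gt0 2 M0)) (le_trans H)//.
  rewrite le_eqVlt; apply/orP; left; apply/eqP.
  by move: (k.+1%:R^-1) => e; field; rewrite gt_eqF.
exists y, M; split => //.
- suff : (nsq B y - 1) ^+ 2 = 0.
    by move/eqP; rewrite sqrf_eq0 subr_eq0 => /eqP.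
  apply: (@le_inv_nat_eq0 _ _ (2 * ((2 * (M + c')) / M ^+ 2) ^+ 2 +
    8 * ((2 * (M + c')) / M ^+ 2))); first exact: sqr_ge0.
  move=> k; have [_ k1 _ _] := Hh k; have := yh k.
  set D := _ / M ^+ 2 => H.
  have ik : k.+1%:R^-1 <= 1 :> R by rewrite invf_le1// ler1n.
  have ik0 : 0 < k.+1%:R^-1 :> R by rewrite invr_gt0.
  have E1 : nsq B y - 1 = nsq B (y - h k) + 2 * rip B (y - h k) (h k).
    by rewrite -[in LHS](subrK (h k) y) nsqD k1; ring.
  have := rip_CS B (y - h k) (h k); rewrite k1 mulr1 E1.
  have := nsq_ge0 B (y - h k); move: H ik ik0.
  move: (nsq B (y - h k)) (rip B (y - h k) (h k)) (k.+1%:R^-1) D => X r e D.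
  move=> XD e1 e0 X0 rX.
  have D0 : 0 <= D by rewrite -(pmulr_lge0 _ e0) (le_trans X0).
  have XX : X * X <= D * e * (D * e) by exact: ler_pM.
  have := sqr_ge0 (X - 2 * r).
  have : 0 <= D * D * (e - e * e) by rewrite mulr_ge0 ?mulr_ge0//; nra.
  nra.
- exact: Mub.
exists d; apply: (@eqnull_trans _ _ B (g - (g - lc d L))); last first.
  by rewrite subKr; exact: eqnull_refl.
rewrite -MyE; apply: eqnullB; last exact: eqnull_refl.
(* A h_k tends to g and to A y *)
apply: (@le_inv_nat_eq0 _ _ (2 * C' * ((2 * (M + c')) / M ^+ 2) + 2 * c')).
  exact: nsq_ge0.
move=> k; rewrite -(subrKA (A (h k))) (le_trans (nsqD_le _ _ _))//.
rewrite [leRHS]mulrDl lerD//; last by rewrite -[leRHS]mulrA ler_pM2l// gc.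
rewrite -(eqnull_nsq (compactB _ _)) -!(mulrA 2) ler_pM2l//.
rewrite (le_trans (CA' _))// -mulrA ler_pM2l// (mulrA 2); exact: yh.
Qed.

End maximizer.
End compact_theory.

(** * Eigenvalues of Krein extensions *)

Section listing.
Variables (R : realType) (V : lmodType R[i]) (B : sip V).
Variable E : R -> V -> Prop.

(** [eigenvalue_listing] for an arbitrary eigenvalue equation [E mu f]. *)
Definition listing (P : set R) (lam : nat -> R) : Prop :=
  [/\ {homo lam : i j / (i <= j)%N >-> i <= j},
      forall j, P (lam j) &
      forall mu, P mu -> exists2 n : nat,
        exists phi : 'I_n -> V, [/\ forall i, E mu (phi i), free_fam B phi &
          forall f, E mu f -> inspan B phi f]
        & ([set j | lam j = mu] #= `I_n)%card].

(** Matching the indices [j] with [lam j = mu] to a basis of the eigenspace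
    turns a listing of eigenvalues into one sequence of eigenvectors. *)
Lemma listing_eigenvectors P lam : listing P lam ->
  exists psi : nat -> V,
  [/\ forall i, E (lam i) (psi i),
      forall n (c : 'I_n -> R[i]) mu,
        eqnull B (\sum_(i < n | lam i == mu) c i *: psi i) 0 ->
        forall i : 'I_n, lam i = mu -> c i = 0 &
      forall mu f g, P mu -> E mu f ->
        (forall i, lam i = mu -> B g (psi i) = 0) -> B g f = 0].
Proof.
move=> [mon Plam Hmu].
have /choice[D HD] : forall mu, exists D : (nat -> V) * (nat -> nat),
    P mu -> exists n,
    [/\ forall k, (k < n)%N -> E mu (D.1 k),
        free_fam B (fun i : 'I_n => D.1 i),
        forall f, E mu f -> inspan B (fun i : 'I_n => D.1 i) f &
        set_bij [set j | lam j = mu] `I_n D.2].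
  move=> mu; have [Pmu|Pmu] := pselect (P mu); last by exists (fun=> 0, id).
  have [n [phi [Ephi fphi sphi]] /card_set_bijP[b bb]] := Hmu _ Pmu.
  pose phi' k := if (insub k : option 'I_n) is Some o then phi o else 0.
  have phiE : (fun i : 'I_n => phi' i) = phi.
    by apply/funext => i; rewrite /phi' valK.
  exists (phi', b) => _; exists n; split => //=; rewrite ?phiE// => k kn.
  by rewrite -[k]/(val (Ordinal kn)) /phi' valK.
exists (fun i => (D (lam i)).1 ((D (lam i)).2 i)); split.
- move=> i; have [n [HE _ _ [b_in _ _]]] := HD _ (Plam i).
  by apply: HE; exact: (b_in i).
- move=> n c mu + i0 Ei0; have Pmu : P mu by rewrite -Ei0.
  have [N [HE Hf _ [b_in b_inj _]]] := HD _ Pmu.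
  set psi := (D mu).1 in HE Hf *; set b := (D mu).2 in b_in b_inj *.
  pose d (k : 'I_N) : R[i] := \sum_(i < n | (lam i == mu) && (b i == k)) c i.
  have bN i : lam i = mu -> (b i < N)%N by move=> /b_in.
  have i0N := bN _ Ei0.
  have -> : \sum_(i < n | lam i == mu) c i *: (D (lam i)).1 ((D (lam i)).2 i) =
      lc d (fun k : 'I_N => psi k).
    rewrite /lc /d (partition_big (fun i : 'I_n => insubd (Ordinal i0N) (b i)) xpredT)//=.
    apply: eq_bigr => k _; rewrite scaler_suml; apply: eq_big => [i|i].
      have [ei|] := eqVneq (lam i) mu => //=.
      by rewrite -(inj_eq val_inj) insubdK//; exact: bN.
    by move=> /andP[/eqP ei /eqP <-]; rewrite ei insubdK//; exact: bN.
  move=> /Hf /(_ (Ordinal i0N)); rewrite /d (bigD1 i0)/= ?Ei0 ?eqxx// big1 ?addr0//.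
  move=> i /andP[/andP[/eqP ei /eqP bi] /eqP ii0]; case: ii0; apply/val_inj.
  by apply: b_inj => //; rewrite inE.
- move=> mu f g Pmu Ef Hg.
  have [N [HE Hf Hs [b_in b_inj b_surj]]] := HD _ Pmu.
  have {Hs} := Hs _ Ef; apply: orth_inspan => k.
  have [i /= ei <-] := b_surj k (ltn_ord k).
  by have := Hg _ ei; rewrite ei.
Qed.

End listing.

Section krein_eigen.
Variables (R : realType) (V : lmodType R[i]) (B : sip V) (A : V -> V).
Variables (I : finType) (kappa : I -> V).
Hypothesis Aop : compact_op B A.
Hypothesis A_free : forall g, inspan B kappa (A g) -> nsq B g = 0.
Hypothesis kappa_free : free_fam B kappa.

(** The eigenvalue equation of the Krein-von Neumann extension of the operator
    whose graph is [{(A w, w) : w orthogonal to kappa}]; its adjoint consists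
    of the pairs [(f, h)] with [f - A h] in the span of [kappa]. *)
Definition krein_eigen (mu : R) (f : V) : Prop :=
  inspan B kappa (f - A (Complex mu 0 *: f)) /\
  exists w k, [/\ orth B kappa w, inspan B kappa k & eqnull B f (A w + k)].

(** If [f = A w + k] then [A (mu f - w)] lies in the span of [kappa], which
    forces [mu f = w]. *)
Lemma krein_eigen_pos (mu : R) f : mu != 0 ->
  krein_eigen mu f <->
  orth B kappa f /\ inspan B kappa (f - Complex mu 0 *: A f).
Proof.
move=> mu0; pose z := Complex mu 0.
have AZ := compactZ Aop z f.
have zK (v : V) : Complex mu^-1 0 *: (z *: v) = v.
  rewrite scalerA; have -> : Complex mu^-1 0 * z = 1 :> R[i].
    by congr Complex; rewrite ?mulVf//; ring.
  by rewrite scale1r.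
split=> [[Hf [w [k [ow sk fE]]]]|[of_ Hf]].
  have fA : inspan B kappa (A (z *: f - w)).
    have H1 : eqnull B (A (z *: f - w)) (A (z *: f) - A w) by exact: compactB.
    apply: (inspan_eqnull (eqnull_sym H1)).
    have H2 : eqnull B (k - (f - A (z *: f))) (A (z *: f) - A w).
      have H3 : eqnull B (k + A w - f) 0.
        rewrite -[X in eqnull _ _ X](subrr f).
        apply: eqnullB; last exact: eqnull_refl.
        by rewrite addrC; exact: eqnull_sym.
      rewrite /eqnull; have -> : k - (f - A (z *: f)) - (A (z *: f) - A w) =
        k + A w - f - 0.
        by rewrite subr0 !opprB -!addrA; congr (k + _); rewrite addrA addrC subrKA.
      exact: H3.
    by apply: (inspan_eqnull H2); exact: inspanB.
  have {fA} := A_free fA; rewrite -/(eqnull B (z *: f) w) => fw.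
  split; last first.
    apply: inspan_eqnull Hf; apply: eqnullB; [exact: eqnull_refl|exact: AZ].
  have := orth_eqnull_trans (eqnull_sym fw) ow.
  by move=> /(orthZ (Complex mu^-1 0)); rewrite zK.
split.
  apply: inspan_eqnull Hf; apply: eqnullB; [exact: eqnull_refl|exact: eqnull_sym AZ].
exists (z *: f), (f - z *: A f); split=> //; first exact: orthZ.
rewrite -{1}[f](subrKC (z *: A f)); apply: eqnullD; last exact: eqnull_refl.
exact: eqnull_sym.
Qed.

Lemma krein_eigen_zero f : krein_eigen 0 f <-> inspan B kappa f.
Proof.
have A0 : eqnull B (A (Complex 0 0 *: f)) 0.
  by apply: (eqnull_trans (compactZ Aop _ _)); rewrite scale0r; exact: eqnull_refl.
have E0 : eqnull B (f - A (Complex 0 0 *: f)) f.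
  by rewrite -[X in eqnull _ _ X]subr0; apply: eqnullB => //; exact: eqnull_refl.
split=> [[Hf _]|Hf]; first exact: inspan_eqnull Hf.
split; first exact: inspan_eqnull (eqnull_sym E0) Hf.
exists 0, f; split=> //; first by move=> i; rewrite ip0l.
rewrite -{1}[f]add0r; apply: eqnullD; last exact: eqnull_refl.
by apply: eqnull_sym; move: A0; rewrite scale0r.
Qed.

Lemma krein_eigen_neg mu f : mu < 0 -> krein_eigen mu f -> nsq B f = 0.
Proof.
move=> mu0 /krein_eigen_pos[|of_ Hf]; first by rewrite lt_eqF.
have := orth_inspan of_ Hf; rewrite ipBr => /(congr1 (@complex.Re R)).
rewrite raddfB /= -!/(rip _ _ _) ripZr -(rip_sym Aop) -/(nsq B f).
have := compact_ge0 Aop f; have := nsq_ge0 B f; nra.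
Qed.

Lemma krein_eigen_orth mu nu f g : 0 < mu -> 0 < nu -> mu != nu ->
  krein_eigen mu f -> krein_eigen nu g -> B f g = 0.
Proof.
move=> mu0 nu0 mn.
move=> /krein_eigen_pos[|of_ Hf]; first by rewrite gt_eqF.
move=> /krein_eigen_pos[|og Hg]; first by rewrite gt_eqF.
have H1 := orth_inspan of_ Hg; have := orth_inspan og Hf.
rewrite ipBr ipZr -(compact_sym Aop) => H2.
move: H1; rewrite ipBr ipZr => H1.
have E2 : B f g = Complex mu 0 * B f (A g).
  move: H2; rewrite (ipC B f g) (ipC B f (A g)).
  case: (B f g) (B f (A g)) => [x y] [x' y'] /= [] H3 H4.
  by congr Complex; move: H3 H4; lra.
move: H1 E2.
case: (B f g) (B f (A g)) => [x y] [x' y'] /= [] H3 H4 [] H5 H6.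
have mn' : mu - nu != 0 by rewrite subr_eq0.
have x0 : (mu - nu) * x' = 0 by lra.
have y0 : (mu - nu) * y' = 0 by lra.
move/eqP: x0; rewrite mulf_eq0 (negbTE mn') => /eqP x0.
move/eqP: y0; rewrite mulf_eq0 (negbTE mn') => /eqP y0.
by congr Complex; rewrite ?H5 ?H6 x0 y0; ring.
Qed.

(** The eigenspace for 0 is the span of the free family [kappa] and there are no
    negative eigenvalues, so 0 fills exactly the first [#|I|] places. *)
Lemma krein_listing_shift lam : listing B krein_eigen setT lam ->
  let N := #|I| in
  [/\ forall i, (lam i == 0) = (i < N)%N, forall i, 0 <= lam i &
      listing B krein_eigen [set mu | 0 < mu] (fun i => lam (N + i)%N)].
Proof.
move=> [mon _ Hmu] N.
have lam0 i : 0 <= lam i.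
  rewrite leNgt; apply/negP => li.
  have [n [phi [Ephi fphi _]] /card_set_bijP[b [b_in _ _]]] := Hmu (lam i) Logic.I.
  have := b_in i erefl => /= bn.
  have := fphi (fun i => (i == Ordinal bn)%:R).
  rewrite /lc (bigD1 (Ordinal bn))//= eqxx scale1r big1 => [|k /negbTE->]; last first.
    by rewrite scale0r.
  rewrite addr0 => /(_ _ (Ordinal bn)); rewrite eqxx => H.
  have /eqP : (1 : R[i]) = 0.
    by apply: H; rewrite /eqnull subr0; apply: krein_eigen_neg (Ephi _).
  by rewrite oner_eq0.
have zeroE i : (lam i == 0) = (i < N)%N.
  have [n [phi [Ephi fphi sphi]] Hc] := Hmu 0 Logic.I.
  have nN : n = N.
    apply/eqP; rewrite eqn_leq; apply/andP; split.
      by apply: (free_le fphi) => k; apply/krein_eigen_zero.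
    have := @free_le _ _ B N 'I_n (fun k : 'I_N => kappa (enum_val k)) phi.
    rewrite card_ord; apply.
      move=> c; have -> : lc c (fun k : 'I_N => kappa (enum_val k)) =
          lc (fun i => c (enum_rank i)) kappa.
        rewrite /lc [RHS](reindex (fun k : 'I_N => enum_val k)) /=.
          by apply: eq_bigr => k _; rewrite enum_valK.
        by exists enum_rank => k _; rewrite ?enum_valK ?enum_rankK.
      by move=> /kappa_free H k; have := H (enum_val k); rewrite enum_valK.
    move=> k; apply: sphi; apply/krein_eigen_zero.
    exists (fun i => (i == enum_val k)%:R).
    rewrite /lc (bigD1 (enum_val k))//= eqxx scale1r big1 ?addr0.
      exact: eqnull_refl.
    by move=> j /negbTE->; rewrite scale0r.
  rewrite {}nN in Hc; have [Hc1 Hc2] : ([set j | lam j = 0] #<= `I_N)%card /\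
      (`I_N #<= [set j | lam j = 0])%card.
    by move: Hc; rewrite card_eq_le => /andP[].
  apply/eqP/idP => [li|iN].
    have : (`I_i.+1 #<= `I_N)%card.
      apply: card_le_trans Hc1; apply: subset_card_le => k /= ki.
      by apply/le_anti; rewrite lam0 andbT -li; exact: mon.
    by rewrite card_le_II.
  apply/eqP; apply: contraT => li.
  have : (`I_N #<= `I_i)%card.
    apply: card_le_trans Hc2 _; apply: subset_card_le => k /= lk.
    rewrite ltnNge; apply/negP => ik; move/negP: li; apply.
    by rewrite eq_le lam0 andbT -lk; exact: mon.
  by rewrite card_le_II leqNgt iN.
split=> //; split.
- by move=> i j ij; apply: mon; rewrite leq_add2l.
- by move=> j /=; rewrite lt_neqAle eq_sym zeroE -leqNgt leq_addr lam0.
- move=> mu mu0; have [n Hn Hc] := Hmu mu Logic.I; exists n => //.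
  apply: card_eq_trans Hc; rewrite card_eq_sym.
  apply/card_set_bijP; exists (fun i => (i - N)%N).
  have lN i : lam i = mu -> (N <= i)%N.
    by move=> li; rewrite leqNgt -zeroE li gt_eqF.
  split => [i /= li|i j|i /= li].
  - by rewrite subnKC// lN.
  - rewrite !inE /= => /lN Ni /lN Nj /(congr1 (addn N)).
    by rewrite !subnKC.
  - by exists (N + i)%N => //=; rewrite addKn.
Qed.

End krein_eigen.

Section comparison.
Variables (R : realType).
Variables (V : lmodType R[i]) (B : sip V) (A : V -> V).
Variables (I : finType) (kappa : I -> V).
Hypothesis Aop : compact_op B A.
Hypothesis A_free : forall g, inspan B kappa (A g) -> nsq B g = 0.
Variables (V' : lmodType R[i]) (B' : sip V') (A' : V' -> V').
Variables (I' : finType) (kappa' : I' -> V').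
Hypothesis Aop' : compact_op B' A'.
Hypothesis A_free' : forall g, inspan B' kappa' (A' g) -> nsq B' g = 0.
Variable iota : V -> V'.
Hypothesis iota_isometry : forall f g, B' (iota f) (iota g) = B f g.
Hypothesis iota_A : forall f g, B' (A' (iota f)) (iota g) = B (A f) g.
Hypothesis iota_orth : forall f, orth B kappa f -> orth B' kappa' (iota f).
Hypothesis iota_lc : forall n (c : 'I_n -> R[i]) (L : 'I_n -> V),
  iota (lc c L) = lc c (fun i => iota (L i)).

Let E := krein_eigen B A kappa.
Let E' := krein_eigen B' A' kappa'.

(** On the span of eigenvectors [psi i] with eigenvalues at most [mu], the
    image [w] of a vector under the operator satisfies
    [<w, w> <= mu <A w, w>]: the difference is the square norm of a vector,
    since eigenvectors for different eigenvalues are orthogonal. *)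
Lemma eigenspan_form n (lam : 'I_n -> R) (psi : 'I_n -> V) mu
    (c : 'I_n -> R[i]) :
  (forall i, 0 < lam i <= mu) -> (forall i, E (lam i) (psi i)) ->
  let w := lc (fun i => c i * Complex (lam i) 0) psi in
  orth B kappa w /\ nsq B w <= mu * rip B (A w) w.
Proof.
move=> lam_mu Epsi w.
have psi_orth i : orth B kappa (psi i).
  have /andP[l0 _] := lam_mu i.
  by have /krein_eigen_pos[] := Epsi i => //; rewrite gt_eqF.
have psi_span i : inspan B kappa (psi i - Complex (lam i) 0 *: A (psi i)).
  have /andP[l0 _] := lam_mu i.
  by have /krein_eigen_pos[] := Epsi i => //; rewrite gt_eqF.
have ow : orth B kappa w.
  move=> k; rewrite lc_ip big1// => i _.
  by rewrite psi_orth mulr0.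
split => //.
pose u := lc c psi.
have uw : inspan B kappa (u - A w).
  have Aw : eqnull B (A w) (lc (fun i => c i * Complex (lam i) 0) (A \o psi)).
    exact: compact_lc.
  apply: (@inspan_eqnull _ _ _ _ _
    (lc c (fun i => psi i - Complex (lam i) 0 *: A (psi i)))).
    rewrite /lc; under eq_bigr do rewrite scalerBr scalerA.
    by rewrite sumrB; apply: eqnullB; [exact: eqnull_refl|exact: eqnull_sym].
  exact: inspan_lc.
have -> : rip B (A w) w = rip B u w.
  have := orth_inspan ow uw; rewrite ipBr => /eqP; rewrite subr_eq0 => /eqP H.
  by rewrite ripC [RHS]ripC /rip H.
pose t i := Num.sqrt (lam i * (mu - lam i)).
have := nsq_ge0 B (lc (fun i => c i * Complex (t i) 0) psi).
suff -> : nsq B (lc (fun i => c i * Complex (t i) 0) psi) = mu * rip B u w - nsq B w.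
  by rewrite subr_ge0.
rewrite -ripZl /nsq -ripBl /rip; congr complex.Re.
have -> : Complex mu 0 *: u - w = lc (fun i => c i * Complex (mu - lam i) 0) psi.
  rewrite /u /w lcZ lcB; apply: eq_bigr => i _; congr (_ *: _).
  by case: (c i) => x y; congr Complex; ring.
rewrite !ip_suml; apply: eq_bigr => i _; rewrite !ip_sumr; apply: eq_bigr => k _.
rewrite !ipZl !ipZr.
have [lik|lik] := eqVneq (lam i) (lam k); last first.
  have /andP[l0 _] := lam_mu i; have /andP[l0' _] := lam_mu k.
  by rewrite (krein_eigen_orth Aop A_free l0 l0' lik (Epsi i) (Epsi k)) !mulr0.
have tt : t i * t k = lam k * (mu - lam i).
  rewrite /t lik -expr2 sqr_sqrtr// mulr_ge0 ?subr_ge0//.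
    by have /andP[/ltW] := lam_mu k.
  by have /andP[_] := lam_mu k.
rewrite !mulrA; congr (_ * _).
case: (c i) (c k) => [x y] [x' y'] /=.
have E1 (s s' : R) : Complex x y * Complex s 0 * conjc (Complex x' y' * Complex s' 0)
  = Complex (s * s') 0 * (Complex x y * conjc (Complex x' y')).
  by congr Complex; ring.
by rewrite !E1 tt (mulrC (lam k)).
Qed.

(** A coefficient vector of length [j + 1] can be chosen so that the extended
    vector is orthogonal to the first [j] eigenvectors of the larger operator.
    If the claim failed, the maximizer of the quotient
    [<A' h, h> / <h, h>] on the complement of these eigenvectors would be an
    eigenvector orthogonal to its own eigenspace. *)
Theorem krein_comparison lam lam' :
  listing B E [set mu | 0 < mu] lam -> listing B' E' [set mu | 0 < mu] lam' ->
  forall j, lam' j <= lam j.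
Proof.
move=> Hl Hl' j; rewrite leNgt; apply/negP => lj.
have [mon lam0 _] := Hl; have [mon' lam0' _] := Hl'.
have [psi [Epsi fpsi _]] := listing_eigenvectors Hl.
have [psi' [Epsi' _ spsi']] := listing_eigenvectors Hl'.
have [c [i0 ci0] cN] : exists2 c : 'I_j.+1 -> R[i], exists i, c i != 0 &
    forall k : 'I_j, \sum_i c i * (Complex (lam i) 0 * B' (iota (psi i)) (psi' k)) = 0.
  pose M : 'M[R[i]]_(j.+1, j) :=
    \matrix_(i, k) (Complex (lam i) 0 * B' (iota (psi i)) (psi' k)).
  have : kermx M != 0.
    rewrite -mxrank_eq0 mxrank_ker subn_eq0 -ltnNge.
    exact: leq_ltn_trans (rank_leq_col M) _.
  move=> /rowV0Pn[v /sub_kermxP vM v0]; exists (fun i => v 0 i).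
    apply: contra_neqP v0 => H; apply/rowP => i; rewrite mxE.
    by apply/eqP; apply/negP => /negP vi; apply: H; exists i.
  move=> k; have := congr1 (fun X : 'rV[R[i]]_j => X 0 k) vM.
  by rewrite !mxE => E0; rewrite -[RHS]E0; apply: eq_bigr => i _; rewrite mxE.
pose w := lc (fun i : 'I_j.+1 => c i * Complex (lam i) 0) (fun i => psi i).
have [||ow wA] := @eigenspan_form j.+1 (fun i => lam i) (fun i => psi i) (lam j) c.
- by move=> i; rewrite (lam0 i)/=; apply: mon; rewrite -ltnS.
- by move=> i; exact: Epsi.
rewrite -/w in ow wA.
have wn : nsq B w != 0.
  apply/eqP => w0; case/eqP: ci0.
  have : c i0 * Complex (lam i0) 0 = 0.
    apply: (fpsi _ (fun i => c i * Complex (lam i) 0) (lam i0)) => //.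
    set s := \sum_(i < _ | _) _.
    rewrite /eqnull subr0 /nsq /rip.
    suff -> : B s s = B w s by rewrite null_ip.
    rewrite /w ip_suml (bigID (fun i : 'I_j.+1 => lam i == lam i0)) /=.
    rewrite [X in _ = _ + X]big1 ?addr0.
      rewrite {1}/s; elim/big_rec2: _ => [|i x y _ <-]; first by rewrite ip0l.
      by rewrite ipDl.
    move=> i li; rewrite /s ipZl.
    have -> : B (psi i) (\sum_(k < j.+1 | lam k == lam i0)
        (c k * Complex (lam k) 0) *: psi k) = 0; last by rewrite mulr0.
    elim/big_rec: _ => [|k x /eqP lk IH]; first by rewrite ip0r.
    have nik : lam i != lam k by rewrite lk.
    have -> : B (psi i) (c k * Complex (lam k) 0 *: psi k + x) = 0; last by [].
    rewrite ipDr IH addr0 ipZr.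
    by rewrite (krein_eigen_orth Aop A_free (lam0 i) (lam0 k) nik) ?mulr0//; exact: Epsi.
  move/eqP; rewrite mulf_eq0 => /orP[/eqP//|/eqP[] l0].
  by have /= := lam0 i0; rewrite l0 ltxx.
have wp : 0 < nsq B w by rewrite lt_neqAle eq_sym wn nsq_ge0.
have lj0 : 0 < lam j := lam0 j.
have Awp : 0 < rip B (A w) w.
  by rewrite -(pmulr_rgt0 _ lj0) (lt_le_trans wp).
pose L (x : I' + 'I_j) := match x with inl k => kappa' k | inr k => psi' k end.
have iw : iota w =
    lc (fun i : 'I_j.+1 => c i * Complex (lam i) 0) (fun i => iota (psi i)).
  exact: iota_lc.
have [||h [M [h1 hY M0 hM [d hd]]]] := maximizer_exists Aop' (L := L) (h0 := iota w).
- case=> [k|k] /=; first exact: iota_orth.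
  by rewrite iw lc_ip -[RHS](cN k); apply: eq_bigr => i _; rewrite mulrA.
- by rewrite /rip iota_A.
have ok : orth B' kappa' h by move=> k; exact: (hY (inl k)).
have op (k : 'I_j) : B' h (psi' k) = 0 by exact: (hY (inr k)).
have MlM : 1 <= lam j * M.
  move: hM; rewrite /nsq {1}/rip iota_A /rip iota_isometry -!/(rip _ _ _) -/(nsq B w).
  move=> hM; rewrite -(ler_pM2r wp) mul1r (le_trans wA)// -mulrA ler_pM2l//.
have l0 k : lam' k != 0 by rewrite gt_eqF//; exact: lam0'.
have psi_orth k : orth B' kappa' (psi' k).
  by have [] := (krein_eigen_pos Aop' A_free' (psi' k) (l0 k)).1 (Epsi' k).
have psi_span k : inspan B' kappa' (psi' k - Complex (lam' k) 0 *: A' (psi' k)).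
  by have [] := (krein_eigen_pos Aop' A_free' (psi' k) (l0 k)).1 (Epsi' k).
set r := A' h - Complex M 0 *: h in hd.
have r_psi (k : 'I_j) : B' r (psi' k) = 0.
  rewrite /r ipBl ipZl op mulr0 subr0 (compact_sym Aop').
  have := orth_inspan ok (psi_span k); rewrite ipBr op ipZr sub0r => /eqP.
  rewrite oppr_eq0 mulf_eq0 => /orP[/eqP[] lk0|/eqP//].
  by have /= := lam0' k; rewrite lk0 ltxx.
pose phi := lc (fun k => d (inr k)) (fun k : 'I_j => psi' k).
pose graph_kernel := lc (fun k => d (inl k)) kappa'.
have rE : lc d L = graph_kernel + phi by rewrite /lc big_sumType.
have phi0 : nsq B' phi = 0.
  rewrite /nsq /rip; have -> : B' phi phi = B' (lc d L) phi - B' graph_kernel phi.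
    by rewrite rE ipDl addrAC subrr add0r.
  rewrite -(eqnull_ipl _ hd).
  have -> : B' r phi = 0 by apply: orth_lc => k; exact: r_psi.
  rewrite sub0r ipC orth_lc ?conjc0 ?oppr0// => k.
  by rewrite lc_ip big1// => i _; rewrite psi_orth mulr0.
have Eh : E' M^-1 h.
  apply/krein_eigen_pos => //; first by rewrite invr_eq0 gt_eqF.
  split => //.
  have rk : inspan B' kappa' r.
    exists (fun k => d (inl k)); apply: (eqnull_trans hd); rewrite rE /eqnull.
    by rewrite addrAC -/graph_kernel subrr add0r.
  have := inspanZ (Complex (- M^-1) 0) rk; rewrite /r scalerBr scalerA.
  have -> : Complex (- M^-1) 0 * Complex M 0 = -1 :> R[i].
    by congr Complex; rewrite ?mulNr ?mulVf ?gt_eqF//; ring.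
  have -> : Complex (- M^-1) 0 = - Complex M^-1 0 :> R[i].
    by congr Complex; rewrite oppr0.
  by rewrite scaleN1r opprK scaleNr addrC.
have MV : M^-1 <= lam j by rewrite -(ler_pM2r M0) mulVf ?gt_eqF.
suff : B' h h = 0 by move: h1; rewrite /nsq /rip => + H; rewrite H /=; lra.
apply: (spsi' M^-1 h h) => //=; first by rewrite invr_gt0.
move=> i li; have [ij|ji] := ltnP i j; first exact: (op (Ordinal ij)).
by have := mon' _ _ ji; rewrite li leNgt (le_lt_trans MV lj).
Qed.

End comparison.

(** * Square integrable functions on an interval *)

Section interval_integral.
Variables (R : realType) (l : R).
Hypothesis l_gt0 : 0 < l.
Implicit Types (f g h p : R -> R) (x y : R).

Let mu := @lebesgue_measure R.
Let D : set (measurableTypeR R) := `]0, l[.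
Let mD : measurable D. Proof. exact: measurable_itv. Qed.

Let muDE : mu D = l%:E.
Proof. by rewrite /mu /D lebesgue_measure_itv /= lte_fin l_gt0 oppr0 addr0. Qed.

Let muD : (mu D < +oo)%E. Proof. by rewrite muDE ltry. Qed.

Let ae_filter : Filter (nbhs (almost_everywhere mu)).
Proof. exact: (ae_filter_ringOfSetsType mu). Qed.

Definition L1 f := mu.-integrable D (fun x => (f x)%:E).
Definition Int f : R := \int[mu]_(x in D) f x.
Definition rL2 f := measurable_fun D f /\ L1 (fun x => f x ^+ 2).

Lemma L1_measurable f : L1 f -> measurable_fun D f.
Proof. by move=> /measurable_int /measurable_EFinP. Qed.

Lemma L1_le f g : measurable_fun D f -> L1 g ->
  (forall x, D x -> `|f x| <= g x) -> L1 f.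
Proof.
move=> mf g1 fg; apply: (le_integrable mD _ _ g1); first exact/measurable_EFinP.
by move=> x Dx; rewrite /= lee_fin (le_trans (fg x Dx))// ler_norm.
Qed.

Lemma L1D f g : L1 f -> L1 g -> L1 (fun x => f x + g x).
Proof.
move=> f1 g1; have := integrableD mD f1 g1.
by apply: eq_integrable => // x _ /=; rewrite EFinD.
Qed.

Lemma L1Z (a : R) f : L1 f -> L1 (fun x => a * f x).
Proof. by move=> f1; have := integrableZl mD a f1. Qed.

Lemma L1N f : L1 f -> L1 (fun x => - f x).
Proof.
by move=> /(L1Z (-1)); apply: eq_integrable => // x _; rewrite mulN1r.
Qed.

Lemma L1B f g : L1 f -> L1 g -> L1 (fun x => f x - g x).
Proof. by move=> f1 /L1N g1; exact: L1D. Qed.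

Lemma L1_bounded f (M : R) : measurable_fun D f ->
  (forall x, D x -> `|f x| <= M) -> L1 f.
Proof.
move=> mf fM; apply: measurable_bounded_integrable => //.
exists M; split; first exact: num_real.
by move=> x Mx y Dy; apply: le_trans (fM y Dy) _; exact: ltW.
Qed.

Lemma L1_cst (c : R) : L1 (fun=> c).
Proof. by apply: (@L1_bounded _ `|c|) => //; exact: measurable_cst. Qed.

Lemma rL2_measurable f : rL2 f -> measurable_fun D f.
Proof. by case. Qed.

Lemma rL2_mul f g : rL2 f -> rL2 g -> L1 (fun x => f x * g x).
Proof.
move=> [mf f2] [mg g2]; apply: (L1_le _ (L1D f2 g2)).
  exact: measurable_funM.
move=> x _; rewrite normrM; set a := f x; set b := g x.
rewrite -(real_normK (num_real a)) -(real_normK (num_real b)).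
have := normr_ge0 a; have := normr_ge0 b; nra.
Qed.

Lemma rL2D f g : rL2 f -> rL2 g -> rL2 (fun x => f x + g x).
Proof.
move=> [mf f2] [mg g2]; split; first exact: measurable_funD.
apply: (L1_le _ (L1D (L1Z 2 f2) (L1Z 2 g2))).
  by apply: measurable_funX; exact: measurable_funD.
move=> x _; rewrite ger0_norm ?sqr_ge0//.
have := sqr_ge0 (f x - g x); nra.
Qed.

Lemma rL2_bmul f p (M : R) : measurable_fun D p ->
  (forall x, D x -> `|p x| <= M) -> rL2 f -> rL2 (fun x => p x * f x).
Proof.
move=> mp pM [mf f2]; split; first exact: measurable_funM.
apply: (L1_le _ (L1Z (M ^+ 2) f2)).
  by apply: measurable_funX; exact: measurable_funM.
move=> x Dx; rewrite ger0_norm ?sqr_ge0// exprMn ler_wpM2r ?sqr_ge0//.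
rewrite -(real_normK (num_real (p x))).
by rewrite ler_pXn2r ?nnegrE ?(le_trans _ (pM x Dx)) ?normr_ge0 ?pM.
Qed.

Lemma rL2Z (a : R) f : rL2 f -> rL2 (fun x => a * f x).
Proof. by apply: (@rL2_bmul _ (fun=> a) `|a|). Qed.

Lemma rL2N f : rL2 f -> rL2 (fun x => - f x).
Proof.
by move=> /(rL2Z (-1)); congr rL2; apply/funext => x; rewrite mulN1r.
Qed.

Lemma rL2B f g : rL2 f -> rL2 g -> rL2 (fun x => f x - g x).
Proof. by move=> f2 /rL2N g2; exact: rL2D. Qed.

Lemma rL2_bounded f (M : R) : measurable_fun D f ->
  (forall x, D x -> `|f x| <= M) -> rL2 f.
Proof.
move=> mf fM; split => //; apply: (@L1_bounded _ (M ^+ 2)).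
  exact: measurable_funX.
move=> x Dx; rewrite normrX.
by rewrite ler_pXn2r ?nnegrE ?(le_trans _ (fM x Dx)) ?normr_ge0 ?fM.
Qed.

Lemma rL2_cst (c : R) : rL2 (fun=> c).
Proof. by apply: (@rL2_bounded _ `|c|). Qed.

Lemma rL2_L1 f : rL2 f -> L1 f.
Proof.
move=> f2; have := rL2_mul f2 (rL2_cst 1).
by congr (L1 _); apply/funext => x; rewrite mulr1.
Qed.

Lemma IntD f g : L1 f -> L1 g -> Int (fun x => f x + g x) = Int f + Int g.
Proof. exact: RintegralD. Qed.

Lemma IntB f g : L1 f -> L1 g -> Int (fun x => f x - g x) = Int f - Int g.
Proof. exact: RintegralB. Qed.

Lemma IntZ (a : R) f : L1 f -> Int (fun x => a * f x) = a * Int f.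
Proof. by move=> f1; exact: RintegralZl. Qed.

Lemma eq_Int f g : (forall x, D x -> f x = g x) -> Int f = Int g.
Proof. by move=> fg; apply: eq_Rintegral => x; rewrite inE; exact: fg. Qed.

Lemma Int_cst (c : R) : Int (fun=> c) = c * l.
Proof.
by rewrite /Int Rintegral_cst// [X in fine X]muDE.
Qed.

Lemma Int_ge0 f : (forall x, D x -> 0 <= f x) -> 0 <= Int f.
Proof. by move=> f0; apply: Rintegral_ge0 => x Dx; exact: f0. Qed.

Lemma le_Int f g : L1 f -> L1 g -> (forall x, D x -> f x <= g x) ->
  Int f <= Int g.
Proof. by move=> f1 g1 fg; apply: le_Rintegral. Qed.

Lemma ae_onS (P Q : R -> Prop) : (forall x, D x -> P x -> Q x) ->
  ae_on l P -> ae_on l Q.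
Proof.
rewrite /ae_on => PQ; apply: (@filterS _ _ ae_filter) => x Px Dx; exact: PQ (Px Dx).
Qed.

Lemma ae_onI (P Q : R -> Prop) :
  ae_on l P -> ae_on l Q -> ae_on l (fun x => P x /\ Q x).
Proof.
rewrite /ae_on => HP HQ; apply: (@filterS2 _ _ ae_filter) HP HQ => x Px Qx Dx.
by split; [exact: Px|exact: Qx].
Qed.

Lemma ae_onT (P : R -> Prop) : (forall x, D x -> P x) -> ae_on l P.
Proof. by move=> HP; rewrite /ae_on; apply: aeW => x; exact: HP. Qed.

Lemma ae_Int f g : measurable_fun D f -> measurable_fun D g ->
  ae_on l (fun x => f x = g x) -> Int f = Int g.
Proof.
move=> mf mg fg; congr fine; apply: ae_eq_integral => //.
- exact/measurable_EFinP.
- exact/measurable_EFinP.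
- by move: fg; rewrite /ae_on; apply: (@filterS _ _ ae_filter) => x H Dx; rewrite /= H.
Qed.

Lemma Int_eq0 f : L1 f -> (forall x, D x -> 0 <= f x) -> Int f = 0 ->
  ae_on l (fun x => f x = 0).
Proof.
move=> f1 f0 If; have mf := L1_measurable f1.
have : ae_eq mu D (fun x => (f x)%:E) (cst 0%E).
  apply/(ae_eq_integral_abs _ mD); first exact/measurable_EFinP.
  have -> : (\int[mu]_(x in D) `|(f x)%:E| = \int[mu]_(x in D) (f x)%:E)%E.
    by apply: eq_integral => x; rewrite inE => Dx /=; rewrite ger0_norm ?f0.
  rewrite -[LHS]fineK ?integrable_fin_num//.
  by rewrite [X in X%:E](_ : _ = Int f)// If.
by rewrite /ae_on; apply: (@filterS _ _ ae_filter) => x H Dx; have [] := H Dx.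
Qed.

Lemma Int_CS f g : rL2 f -> rL2 g ->
  Int (fun x => f x * g x) ^+ 2 <=
  Int (fun x => f x ^+ 2) * Int (fun x => g x ^+ 2).
Proof.
move=> f2 g2; apply: quadratic_ge0 => t.
have fg := rL2_mul f2 g2; have [_ ff] := f2; have [_ gg] := g2.
rewrite -(IntZ _ fg) -(IntZ _ gg) -(IntD ff (L1Z _ fg)).
rewrite -(IntD (L1D ff (L1Z _ fg)) (L1Z _ gg)).
by apply: Int_ge0 => x _; have := sqr_ge0 (f x + t * g x); nra.
Qed.

(** The primitive is the pairing with an indicator, so that all integrals
    range over the same interval. *)
Definition chi x : R -> R := fun t => (t < x)%R%:R.

Lemma chi_rL2 x : rL2 (chi x).
Proof.
apply: (@rL2_bounded _ 1) => [|t _]; last first.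
  by rewrite /chi; case: (t < x); rewrite ?normr1 ?normr0.
have -> : chi x = \1_(`]-oo, x[%classic : set R).
  apply/funext => t; rewrite /chi indicE; congr (_%:R); congr nat_of_bool.
  by apply/idP/idP; rewrite inE/= in_itv.
exact: measurable_indic.
Qed.

Definition prim f x : R := Int (fun t => f t * chi x t).

Lemma primE f x : 0 <= x <= l ->
  prim f x = \int[mu]_(t in `]0, x[) f t.
Proof.
move=> /andP[x0 xl]; rewrite /prim /Int.
rewrite [RHS]Rintegral_mkcond [LHS]Rintegral_mkcond; congr (Rintegral _ _ _).
apply/funext => t; rewrite !patchE !mem_setE /chi !in_itv /=.
have [t0|//] := ltP 0 t; have [tx|tx] /= := ltP t x.
  by rewrite mulr1 (lt_le_trans tx xl).
by rewrite mulr0 if_same.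
Qed.

Lemma prim0 f : prim f 0 = 0.
Proof.
rewrite /prim (eq_Int (g := fun=> 0)) ?Int_cst ?mul0r// => t.
rewrite /D /= in_itv /= => /andP[t0 _].
by rewrite /chi ltNge ltW// mulr0.
Qed.

Lemma priml f : prim f l = Int f.
Proof.
apply: eq_Int => t; rewrite /D /= in_itv /= => /andP[_ tl].
by rewrite /chi tl mulr1.
Qed.

Lemma Int_itv x y : x <= y ->
  Int (fun t => (chi y t - chi x t) ^+ 2) <= y - x.
Proof.
move=> xy.
have E t : (chi y t - chi x t) ^+ 2 = \1_(`[x, y[%classic : set R) t.
  rewrite /chi indicE mem_setE in_itv /=.
  have [tx|tx] := ltP t x; first by rewrite (lt_le_trans tx xy) subrr expr0n.
  by case: ltP => _; rewrite /= subr0 ?expr1n ?expr0n.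
rewrite (eq_Int (fun t _ => E t)) /Int /Rintegral integral_indic//.
have := @measureIr _ _ _ mu D `[x, y[%classic.
have E2 : mu (`[x, y[%classic : set R) = (y - x)%:E.
  rewrite /mu lebesgue_measure_itv /= lte_fin.
  by move: xy; rewrite le_eqVlt => /predU1P[->|->//]; rewrite ltxx subrr.
have le1 : (mu (`[x, y[%classic `&` D) <= (y - x)%:E)%E.
  by rewrite -E2 le_measure ?inE//=; exact: measurableI.
move=> _; rewrite -lee_fin fineK// ge0_fin_numE//.
by rewrite (le_lt_trans le1)// ltry.
Qed.

(** Cauchy-Schwarz against the indicator of the interval from [x] to [y]. *)
Lemma prim_diff f x y : rL2 f ->
  (prim f y - prim f x) ^+ 2 <= `|y - x| * Int (fun t => f t ^+ 2).
Proof.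
move=> f2; wlog xy : x y / x <= y.
  move=> H; have [/H//|yx] := leP x y.
  have := H y x (ltW yx).
  by rewrite distrC -sqrrN opprB.
rewrite ger0_norm ?subr_ge0//.
rewrite /prim -IntB; [|exact: (rL2_mul f2 (chi_rL2 _))..].
rewrite (eq_Int (g := fun t => f t * (chi y t - chi x t))); last first.
  by move=> t _; rewrite mulrBr.
rewrite (le_trans (Int_CS f2 (rL2B (chi_rL2 _) (chi_rL2 _))))//.
rewrite mulrC ler_wpM2r ?Int_itv//.
by apply: Int_ge0 => t _; rewrite sqr_ge0.
Qed.

Lemma prim_sqr_le f x : rL2 f -> 0 <= x <= l ->
  prim f x ^+ 2 <= l * Int (fun t => f t ^+ 2).
Proof.
move=> f2 /andP[x0 xl]; have := prim_diff 0 x f2.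
rewrite prim0 !subr0 ger0_norm// => H; apply: (le_trans H).
rewrite ler_wpM2r//; by apply: Int_ge0 => t _; rewrite sqr_ge0.
Qed.

Lemma prim_continuous f : rL2 f -> continuous (prim f).
Proof.
move=> f2 x; set c := Int (fun t => f t ^+ 2).
have c0 : 0 <= c by apply: Int_ge0 => t _; rewrite sqr_ge0.
apply/cvgrPdist_lt => e e0; near=> y.
rewrite -(ltr_pXn2r (n := 2)) ?nnegrE ?normr_ge0 ?(ltW e0)//.
rewrite real_normK ?num_real// (le_lt_trans (prim_diff y x f2))//.
rewrite -/c (le_lt_trans (y := `|x - y| * (c + 1)))//.
  by rewrite ler_wpM2l// lerDl.
rewrite -ltr_pdivlMr ?ltr_wpDl//.
near: y; apply: (nbhsx_ballx x (e ^+ 2 / (c + 1))).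
by rewrite divr_gt0 ?exprn_gt0 ?ltr_wpDl.
Unshelve. all: by end_near. Qed.

Lemma prim_rL2 f : rL2 f -> rL2 (prim f).
Proof.
move=> f2; apply: (@rL2_bounded _ (l * Int (fun t => f t ^+ 2) + 1)).
  apply: measurable_funTS; apply: continuous_measurable_fun.
  exact: prim_continuous.
move=> x; rewrite /D /= in_itv /= => /andP[x0 xl].
have := @prim_sqr_le f x f2; rewrite (ltW x0) (ltW xl) => /(_ isT).
rewrite -[X in X <= _ -> _]real_normK ?num_real//.
have := normr_ge0 (prim f x); move: (`|_|) (l * _) => a c; nra.
Qed.

Lemma primD f g x : rL2 f -> rL2 g ->
  prim (fun t => f t + g t) x = prim f x + prim g x.
Proof.
move=> f2 g2; rewrite /prim -IntD; [|exact: (rL2_mul _ (chi_rL2 _))..].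
by apply: eq_Int => t _; rewrite mulrDl.
Qed.

Lemma primZ (a : R) f x : rL2 f -> prim (fun t => a * f t) x = a * prim f x.
Proof.
move=> f2; rewrite /prim -IntZ; last exact: (rL2_mul _ (chi_rL2 _)).
by apply: eq_Int => t _; rewrite mulrA.
Qed.

Lemma primB f g x : rL2 f -> rL2 g ->
  prim (fun t => f t - g t) x = prim f x - prim g x.
Proof.
move=> f2 g2; rewrite /prim -IntB; [|exact: (rL2_mul _ (chi_rL2 _))..].
by apply: eq_Int => t _; rewrite mulrBl.
Qed.

Lemma ae_prim f g x : measurable_fun D f -> measurable_fun D g ->
  ae_on l (fun t => f t = g t) -> prim f x = prim g x.
Proof.
move=> mf mg fg; have mc := rL2_measurable (chi_rL2 x).
apply: ae_Int; [exact: measurable_funM..|].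
by apply: ae_onS fg => t _ ->.
Qed.

Lemma eq_prim f g x : (forall t, D t -> f t = g t) -> prim f x = prim g x.
Proof. by move=> fg; apply: eq_Int => t Dt; rewrite fg. Qed.

End interval_integral.

Section by_parts.
Variables (R : realType) (l : R).
Hypothesis l_gt0 : 0 < l.
Implicit Types (f g h p : R -> R) (x y : R).

Let mu := @lebesgue_measure R.
Let D : set (measurableTypeR R) := `]0, l[.
Let mD : measurable D. Proof. exact: measurable_itv. Qed.

Lemma patchR f x : (f \_ D) x = if x \in D then f x else 0.
Proof. by rewrite patchE. Qed.

Lemma IntE f : L1 l f -> (\int[mu]_(x in D) (f x)%:E = (Int l f)%:E)%E.
Proof. by move=> f1; rewrite -[LHS]fineK ?integrable_fin_num. Qed.

Lemma IntT f : L1 l f -> (\int[mu]_x ((f \_ D) x)%:E = (Int l f)%:E)%E.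
Proof.
by move=> f1; rewrite -IntE// [RHS]integral_mkcond restrict_EFin.
Qed.

Lemma measurable_patch f : measurable_fun D f ->
  measurable_fun [set: measurableTypeR R] (f \_ D).
Proof. by move=> mf; apply/(measurable_restrictT _ mD). Qed.

Lemma rL2_norm f : rL2 l f -> rL2 l (fun x => `|f x|).
Proof.
move=> [mf f2]; split; first exact: measurableT_comp.
by move: f2; congr (L1 _ _); apply/funext => x; rewrite real_normK ?num_real.
Qed.

Lemma triangle_inner1 f g x : rL2 l g ->
  (\int[mu]_t ((f \_ D) x * (g \_ D) t * (t < x)%R%:R)%:E =
   ((f \_ D) x * prim l g x)%:E)%E.
Proof.
move=> g2; have gc := rL2_mul g2 (chi_rL2 l_gt0 x).
rewrite /prim -IntZ// -IntT; last exact: L1Z.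
apply: eq_integral => t _; congr EFin.
by rewrite /= [in RHS]patchR [(g \_ D) t]patchR /chi; case: ifPn => _; ring.
Qed.

(** The diagonal of the square is negligible. *)
Lemma Int_point f x : rL2 l f -> Int l (fun t => f t * (t == x)%:R) = 0.
Proof.
move=> f2; rewrite (@ae_Int _ l _ (fun=> 0)) ?Int_cst ?mul0r//.
- apply: measurable_funM; first exact: rL2_measurable f2.
  have -> : (fun t : R => (t == x)%:R) = \1_([set x] : set R) :> (R -> R).
    apply/funext => t; rewrite indicE; congr (_%:R); congr nat_of_bool.
    by apply/eqP/idP; rewrite inE.
  exact: measurable_indic.
- rewrite /ae_on; exists [set x]; split => //; first exact: lebesgue_measure_set1.
  move=> t /= Ht; apply: contrapT => tx; apply: Ht => _.
  by rewrite (negbTE (introN eqP tx)) mulr0.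
Qed.

Lemma triangle_inner2 f g t : rL2 l f ->
  (\int[mu]_x ((f \_ D) x * (g \_ D) t * (t < x)%R%:R)%:E =
   ((g \_ D) t * (Int l f - prim l f t))%:E)%E.
Proof.
move=> f2; have fc := rL2_mul f2 (chi_rL2 l_gt0 t).
have f1 := rL2_L1 l_gt0 f2.
have pt2 : rL2 l (fun x : R => (x == t)%:R).
  apply: (@rL2_bounded _ _ l_gt0 _ 1) => [|x _]; last first.
    by case: (x == t); rewrite ?normr1 ?normr0.
  have -> : (fun x : R => (x == t)%:R) = \1_([set t] : set R) :> (R -> R).
    apply/funext => x; rewrite indicE; congr (_%:R); congr nat_of_bool.
    by apply/eqP/idP; rewrite inE.
  exact: measurable_indic.
have fp := rL2_mul f2 pt2.
have -> : Int l f - prim l f t =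
    Int l (fun x => f x - f x * chi t x - f x * (x == t)%:R).
  rewrite IntB//; last exact: L1B.
  by rewrite Int_point// subr0 IntB.
rewrite -IntZ//; last by apply: L1B => //; exact: L1B.
rewrite -IntT; last by apply: L1Z; apply: L1B => //; exact: L1B.
apply: eq_integral => x _; congr EFin.
rewrite /= [in RHS]patchR [(f \_ D) x]patchR /chi; case: ifPn => _; last by ring.
by case: (ltgtP t x) => _ /=; ring.
Qed.

(** Both sides are the integral of [f x * g t] over the triangle [t < x]. *)
Lemma Int_swap f g : rL2 l f -> rL2 l g ->
  Int l (fun x => f x * prim l g x) =
  Int l (fun t => g t * (Int l f - prim l f t)).
Proof.
move=> f2 g2.
have f1 := rL2_L1 l_gt0 f2; have g1 := rL2_L1 l_gt0 g2.
pose h (z : measurableTypeR R * measurableTypeR R) : \bar R :=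
  ((f \_ D) z.1 * (g \_ D) z.2 * (z.2 < z.1)%R%:R)%:E.
have mf := measurable_patch (rL2_measurable f2).
have mg := measurable_patch (rL2_measurable g2).
have mh : measurable_fun setT h.
  apply/measurable_EFinP; apply: measurable_funM; first apply: measurable_funM.
  - exact: (measurableT_comp mf measurable_fst).
  - exact: (measurableT_comp mg measurable_snd).
  - have mb : measurable_fun [set: measurableTypeR R * measurableTypeR R]
        (fun z => z.2 < z.1)%R.
      by apply: measurable_fun_ltr; [exact: measurable_snd|exact: measurable_fst].
    by apply: (measurableT_comp (f := fun b : bool => b%:R : R) _ mb).
have outer f' g' : rL2 l f' -> rL2 l g' ->
    (\int[mu]_x \int[mu]_t ((f' \_ D) x * (g' \_ D) t * (t < x)%R%:R)%:E =
     (Int l (fun x => f' x * prim l g' x)%R)%:E)%E.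
  move=> f'2 g'2.
  rewrite -IntT; last by apply: rL2_mul => //; exact: prim_rL2.
  apply: eq_integral => x _; rewrite triangle_inner1//; congr EFin.
  by rewrite [in RHS]patchR [(f' \_ D) x]patchR; case: ifPn => // _; rewrite mul0r.
have ih : (mu \x mu)%E.-integrable setT h.
  apply/(integrable12ltyP (@lebesgue_measure R) (@lebesgue_measure R) mh).
  rewrite [X in (X < _)%E](_ : _ =
    (\int[mu]_x \int[mu]_t (((fun x => `|f x|) \_ D) x *
       ((fun x => `|g x|) \_ D) t * (t < x)%R%:R)%:E)%E); last first.
    apply: eq_integral => x _; apply: eq_integral => t _.
    rewrite /h /= !normrM normr_nat; congr EFin; congr (_ * _ * _).
      by rewrite !patchR; case: ifPn => // _; rewrite normr0.
    by rewrite !patchR; case: ifPn => // _; rewrite normr0.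
  by rewrite outer; [rewrite ltry|exact: rL2_norm..].
have := Fubini ih; rewrite /h /= outer// => E1; apply: EFin_inj; rewrite {}E1.
rewrite -IntT; last first.
  apply: rL2_mul => //; apply: rL2B => //; first exact: rL2_cst.
  exact: prim_rL2.
apply: eq_integral => t _; rewrite triangle_inner2//; congr EFin.
by rewrite [in RHS]patchR [(g \_ D) t]patchR; case: ifPn => // _; rewrite mul0r.
Qed.

(** The triangles [t < x] and [x < t] fill the square up to the diagonal. *)
Lemma Int_by_parts f g (F0 G0 : R) : rL2 l f -> rL2 l g ->
  Int l (fun x => f x * (G0 + prim l g x)) +
  Int l (fun x => (F0 + prim l f x) * g x) =
  (F0 + Int l f) * (G0 + Int l g) - F0 * G0.
Proof.
move=> f2 g2; have f1 := rL2_L1 l_gt0 f2; have g1 := rL2_L1 l_gt0 g2.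
have fpg := rL2_mul f2 (prim_rL2 l_gt0 g2).
have gpf := rL2_mul g2 (prim_rL2 l_gt0 f2).
have -> : Int l (fun x => f x * (G0 + prim l g x)) =
    G0 * Int l f + Int l (fun x => f x * prim l g x).
  rewrite -IntZ// -IntD//; last exact: L1Z.
  by apply: eq_Int => x _; ring.
have -> : Int l (fun x => (F0 + prim l f x) * g x) =
    F0 * Int l g + Int l (fun x => g x * prim l f x).
  rewrite -IntZ// -IntD//; last exact: L1Z.
  by apply: eq_Int => x _; ring.
rewrite Int_swap//.
have -> : Int l (fun t => g t * (Int l f - prim l f t)) =
    Int l f * Int l g - Int l (fun t => g t * prim l f t).
  rewrite -IntZ// -IntB//; last exact: L1Z.
  by apply: eq_Int => x _; ring.
ring.
Qed.

(** The primitive determines the function, by Lebesgue's differentiation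
    theorem. *)
Lemma prim_inj f : rL2 l f -> (forall x, 0 < x < l -> prim l f x = 0) ->
  ae_on l (fun x => f x = 0).
Proof.
move=> f2 Hf; have f1 := rL2_L1 l_gt0 f2.
pose F := f \_ D.
have intF : mu.-integrable setT (EFin \o F).
  by rewrite -restrict_EFin; apply/(integrable_mkcond _ mD).
have intFy y : mu.-integrable `]-oo, y] (EFin \o F) by exact: integrableS intF.
have locF : locally_integrable setT F by exact: integrable_locally_restrict.
have := FTC1Ny intFy locF.
have primF y : (\int[mu]_(t in `]-oo, y]) F t = prim l f y)%R.
  have intFo : mu.-integrable `]-oo, y[ (EFin \o F) by exact: integrableS intF.
  rewrite -(Rintegral_itv_bndo_bndc intFo).
  rewrite Rintegral_mkcond /prim /Int [RHS]Rintegral_mkcond.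
  congr Rintegral; apply/funext => t; rewrite !patchE /chi !mem_setE !in_itv /=.
  rewrite /F patchE mem_setE in_itv /=.
  by case: ifPn; case: ifPn => _ _; rewrite ?mulr1 ?mulr0.
rewrite /ae_on; apply: filterS; first exact: (ae_filter_ringOfSetsType mu).
move=> x [_ dF]; rewrite in_itv /= => /andP[x0 xl].
have <- : F x = f x by rewrite /F patchE mem_setE in_itv /= x0 xl.
rewrite -dF derive1E (near_eq_derive (g := cst 0)); last first.
  near=> y; rewrite primF Hf//; apply/andP; split.
    by near: y; exact: lt_nbhsr.
  by near: y; exact: lt_nbhsl.
by rewrite -derive1E derive1_cst.
Unshelve. all: by end_near. Qed.

End by_parts.

(** * The equation -u'' + p u = h on an interval *)

Section dirichlet.
Variables (R : realType) (l : R).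
Hypothesis l_gt0 : 0 < l.
Implicit Types (f g h p r u du : R -> R) (x y a d : R).

Let D : set (measurableTypeR R) := `]0, l[.
Let DE x : D x -> 0 < x < l. Proof. by rewrite /D /= in_itv. Qed.

Lemma prim_cst (c x : R) : 0 <= x <= l -> prim l (fun=> c) x = c * x.
Proof.
move=> /andP[x0 xl]; rewrite primE ?x0 ?xl// Rintegral_cst//.
have E : @lebesgue_measure R (`]0, x[%classic : set R) = x%:E.
  rewrite lebesgue_measure_itv/= lte_fin; move: x0; rewrite le_eqVlt.
  by move=> /predU1P[<-|->]; rewrite ?ltxx// oppr0 addr0.
by rewrite [X in fine X]E.
Qed.

Lemma rL2_affine a f : rL2 l f -> rL2 l (fun x => a + prim l f x).
Proof. by move=> f2; apply: rL2D => //; [exact: rL2_cst|exact: prim_rL2]. Qed.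

Definition potential p :=
  measurable_fun D p /\ exists M, forall x, D x -> 0 <= p x <= M.

Lemma rL2_pot p u : potential p -> rL2 l u -> rL2 l (fun x => p x * u x).
Proof.
move=> [mp [M pM]]; apply: (rL2_bmul mp (M := M)) => x Dx.
by have /andP[p0 pm] := pM x Dx; rewrite ger0_norm.
Qed.

(** The solution [u] with [u(0) = a] and [u'(0) = d], in integrated form; it
    is encoded by its derivative [du], and [u] itself is [a + prim l du]. *)
Definition solves p h a d du : Prop :=
  rL2 l du /\
  forall x, D x -> du x = d + prim l (fun t => p t * (a + prim l du t) - h t) x.

Lemma sol_rhs_rL2 p h a du : potential p -> rL2 l h -> rL2 l du ->
  rL2 l (fun t => p t * (a + prim l du t) - h t).
Proof.
move=> pp h2 du2; apply: rL2B => //; apply: rL2_pot => //.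
exact: rL2_affine.
Qed.

(** Integration by parts against [v], with [v(0) = b] and [v' = dv]. *)
Lemma sol_weak p h a d du b dv : potential p -> rL2 l h -> solves p h a d du ->
  rL2 l dv ->
  let d' := d + Int l (fun t => p t * (a + prim l du t) - h t) in
  Int l (fun x => h x * (b + prim l dv x)) =
  Int l (fun x => du x * dv x) +
  Int l (fun x => p x * (a + prim l du x) * (b + prim l dv x)) -
  (d' * (b + Int l dv) - d * b).
Proof.
move=> pp h2 [du2 duE] dv2.
set f := (fun t => p t * (a + prim l du t) - h t) in duE * => /=.
set d' := d + Int l f.
have f2 : rL2 l f by exact: sol_rhs_rL2.
have := Int_by_parts l_gt0 d b f2 dv2.
have -> : Int l (fun x => (d + prim l f x) * dv x) = Int l (fun x => du x * dv x).
  by apply: eq_Int => x Dx; rewrite duE.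
have v2 := rL2_affine b dv2; have u2 := rL2_affine a du2.
have -> : Int l (fun x => f x * (b + prim l dv x)) =
    Int l (fun x => p x * (a + prim l du x) * (b + prim l dv x)) -
    Int l (fun x => h x * (b + prim l dv x)).
  rewrite -IntB//; [|exact: (rL2_mul (rL2_pot pp u2) v2)|exact: rL2_mul].
  by apply: eq_Int => x _; rewrite /f mulrBl.
rewrite -/d' => <-; ring.
Qed.

Lemma sol_add p h g a b d e du dv : potential p -> rL2 l h -> rL2 l g ->
  solves p h a d du -> solves p g b e dv ->
  solves p (fun x => h x + g x) (a + b) (d + e) (fun x => du x + dv x).
Proof.
move=> pp h2 g2 [du2 duE] [dv2 dvE]; split; first exact: rL2D.
move=> x Dx; rewrite duE// dvE// addrACA; congr (_ + _).
rewrite -primD//; [|exact: sol_rhs_rL2..].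
by apply: eq_prim => t _; rewrite primD//; ring.
Qed.

Lemma sol_scale p h a d du c : potential p -> rL2 l h ->
  solves p h a d du ->
  solves p (fun x => c * h x) (c * a) (c * d) (fun x => c * du x).
Proof.
move=> pp h2 [du2 duE]; split; first exact: rL2Z.
move=> x Dx; rewrite duE// mulrDr; congr (_ + _).
rewrite -primZ//; last exact: sol_rhs_rL2.
by apply: eq_prim => t _; rewrite primZ//; ring.
Qed.

Definition solves_dirichlet p h du := (exists d, solves p h 0 d du) /\ Int l du = 0.

Lemma dir_rL2 p h du : solves_dirichlet p h du -> rL2 l du.
Proof. by move=> [[d []]]. Qed.

Lemma dir_add p h g du dv : potential p -> rL2 l h -> rL2 l g ->
  solves_dirichlet p h du -> solves_dirichlet p g dv ->
  solves_dirichlet p (fun x => h x + g x) (fun x => du x + dv x).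
Proof.
move=> pp h2 g2 [[d du1] du0] [[e dv1] dv0]; split.
  by exists (d + e); rewrite -[X in solves _ _ X](addr0 0); exact: sol_add.
have [du2 _] := du1; have [dv2 _] := dv1.
by rewrite IntD ?du0 ?dv0 ?addr0//; exact: rL2_L1.
Qed.

Lemma dir_scale p h du c : potential p -> rL2 l h -> solves_dirichlet p h du ->
  solves_dirichlet p (fun x => c * h x) (fun x => c * du x).
Proof.
move=> pp h2 [[d du1] du0]; split.
  by exists (c * d); rewrite -[X in solves _ _ X](mulr0 c); exact: sol_scale.
have [du2 _] := du1.
by rewrite IntZ ?du0 ?mulr0//; exact: rL2_L1.
Qed.

Lemma dir_sub p h g du dv : potential p -> rL2 l h -> rL2 l g ->
  solves_dirichlet p h du -> solves_dirichlet p g dv ->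
  solves_dirichlet p (fun x => h x - g x) (fun x => du x - dv x).
Proof.
move=> pp h2 g2 hu /(dir_scale (-1) pp g2) gv.
have := dir_add pp h2 (rL2Z (-1) g2) hu gv.
by congr (solves_dirichlet p); apply/funext => x; rewrite mulN1r.
Qed.

Lemma dir_energy p h du g dv : potential p -> rL2 l h -> rL2 l g ->
  solves_dirichlet p h du -> solves_dirichlet p g dv ->
  Int l (fun x => h x * prim l dv x) =
  Int l (fun x => du x * dv x) + Int l (fun x => p x * prim l du x * prim l dv x).
Proof.
move=> pp h2 g2 [[d du1] du0] [[e [dv2 _]] dv0].
have := sol_weak 0 pp h2 du1 dv2; rewrite /= dv0 addr0 !mulr0 !subr0.
have E (f f' : R -> R) : (forall x, f x = f' x) -> Int l f = Int l f'.
  by move=> ff'; apply: eq_Int => x _; exact: ff'.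
rewrite (E _ (fun x => h x * prim l dv x)); last by move=> x; rewrite add0r.
rewrite [X in _ + X](E _ (fun x => p x * prim l du x * prim l dv x))//.
by move=> x; rewrite !add0r.
Qed.

Lemma dir_sym p h du g dv : potential p -> rL2 l h -> rL2 l g ->
  solves_dirichlet p h du -> solves_dirichlet p g dv ->
  Int l (fun x => h x * prim l dv x) = Int l (fun x => g x * prim l du x).
Proof.
move=> pp h2 g2 hu gv; rewrite (dir_energy pp h2 g2 hu gv).
rewrite (dir_energy pp g2 h2 gv hu).
by congr (_ + _); apply: eq_Int => x _; ring.
Qed.

Lemma dir_coercive p h du : potential p -> rL2 l h -> solves_dirichlet p h du ->
  Int l (fun x => du x ^+ 2) <= Int l (fun x => h x * prim l du x).
Proof.
move=> pp h2 hu; rewrite (dir_energy pp h2 h2 hu hu) -lerBlDl subrr.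
have [_ [M pM]] := pp; apply: Int_ge0 => x Dx.
by have /andP[p0 _] := pM x Dx; rewrite -mulrA mulr_ge0// -expr2 sqr_ge0.
Qed.

Lemma Int_sqr_ge0 f : 0 <= Int l (fun x => f x ^+ 2).
Proof. by apply: Int_ge0 => x _; exact: sqr_ge0. Qed.

Lemma Int_prim_sqr_le du : rL2 l du ->
  Int l (fun x => prim l du x ^+ 2) <= l ^+ 2 * Int l (fun x => du x ^+ 2).
Proof.
move=> du2; have [_ pdu] := prim_rL2 l_gt0 du2.
have := Int_cst l_gt0 (l * Int l (fun x => du x ^+ 2)).
rewrite mulrAC -expr2 => <-; apply: le_Int => //; first exact: L1_cst.
move=> x /DE /andP[x0 xl]; apply: prim_sqr_le => //.
by rewrite !ltW.
Qed.

Lemma dir_energy_le p h du : potential p -> rL2 l h -> solves_dirichlet p h du ->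
  Int l (fun x => du x ^+ 2) <= l ^+ 2 * Int l (fun x => h x ^+ 2).
Proof.
move=> pp h2 hu; have du2 := dir_rL2 hu.
have H1 := dir_coercive pp h2 hu.
have H2 := Int_CS h2 (prim_rL2 l_gt0 du2).
have H3 := Int_prim_sqr_le du2.
have E0 := Int_sqr_ge0 du; have h0 := Int_sqr_ge0 h.
move: H1 H2 H3 E0 h0.
move: (Int l (fun x => du x ^+ 2)) (Int l (fun x => h x ^+ 2)) => E H.
move: (Int l (fun x => h x * prim l du x)) => r.
move: (Int l (fun x => prim l du x ^+ 2)) => U Er rHU UE E0 H0.
have [->|En] := eqVneq E 0; first by rewrite mulr_ge0 ?sqr_ge0.
have Ep : 0 < E by rewrite lt_neqAle eq_sym En.
rewrite -(ler_pM2r Ep) -expr2 (le_trans (y := r ^+ 2))//.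
  by rewrite ler_pXn2r ?nnegrE// (le_trans E0).
by rewrite (le_trans rHU)// mulrAC mulrC ler_wpM2r.
Qed.

Lemma dir_sup p h du x : potential p -> rL2 l h -> solves_dirichlet p h du ->
  0 <= x <= l -> prim l du x ^+ 2 <= l ^+ 3 * Int l (fun x => h x ^+ 2).
Proof.
move=> pp h2 hu xl; have du2 := dir_rL2 hu.
apply: (le_trans (prim_sqr_le l_gt0 du2 xl)).
by rewrite exprS -mulrA ler_pM2l//; exact: dir_energy_le hu.
Qed.

(** A bound in the supremum norm that is uniform in the potential, so that it
    can be used again after each change of the potential. *)
Lemma dir_stable p h du (G : R) : potential p -> rL2 l h -> solves_dirichlet p h du ->
  0 <= G -> (forall x, D x -> `|h x| <= G) ->
  forall x, 0 <= x <= l -> `|prim l du x| <= l ^+ 2 * G.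
Proof.
move=> pp h2 hu G0 hG x xl; have H := dir_sup pp h2 hu xl.
have hG2 : Int l (fun x => h x ^+ 2) <= G ^+ 2 * l.
  rewrite -(Int_cst l_gt0); apply: le_Int => //; [by case: h2|exact: L1_cst|].
  move=> t Dt; rewrite -real_normK ?num_real//.
  by rewrite ler_pXn2r ?nnegrE ?normr_ge0 ?hG.
rewrite -(ler_pXn2r (n := 2)) ?nnegrE ?normr_ge0 ?mulr_ge0 ?sqr_ge0 ?(ltW l_gt0)//.
rewrite real_normK ?num_real// (le_trans H)//.
have -> : (l ^+ 2 * G) ^+ 2 = l ^+ 3 * (G ^+ 2 * l) by ring.
by rewrite ler_pM2l ?exprn_gt0.
Qed.

(** The difference of two solutions has zero energy. *)
Lemma dir_unique p h du dv x : potential p -> rL2 l h ->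
  solves_dirichlet p h du -> solves_dirichlet p h dv -> 0 <= x <= l ->
  prim l du x = prim l dv x.
Proof.
move=> pp h2 hu hv xl; have h0 := dir_sub pp h2 h2 hu hv.
have := dir_sup pp (rL2B h2 h2) h0 xl.
rewrite primB//; [|exact: dir_rL2 hu|exact: dir_rL2 hv].
rewrite [X in _ * X](_ : _ = 0); last first.
  rewrite (eq_Int (g := fun=> 0)) ?Int_cst ?mul0r// => t _.
  by rewrite subrr expr0n.
rewrite mulr0 => H; apply/eqP; rewrite -subr_eq0 -sqrf_eq0.
by apply/eqP/le_anti; rewrite H sqr_ge0.
Qed.

Lemma eq_solves_dirichlet p p' h h' du : (forall x, D x -> p x = p' x) ->
  (forall x, D x -> h x = h' x) -> solves_dirichlet p h du -> solves_dirichlet p' h' du.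
Proof.
move=> pE hE [[d [du2 duE]] du0]; split => //; exists d; split => // x Dx.
rewrite duE//; congr (_ + _); apply: eq_prim => t Dt.
by rewrite pE// hE.
Qed.

Definition solvable p := forall h, rL2 l h -> exists du, solves_dirichlet p h du.

(** Integrate twice, then correct the slope. *)
Lemma solvable0 : solvable (fun=> 0).
Proof.
move=> h h2; pose f := prim l (fun t => - h t).
have f2 : rL2 l f by apply: prim_rL2 => //; exact: rL2N.
pose d := - Int l f / l; exists (fun x => d + f x); split; last first.
  rewrite IntD; [|exact: L1_cst|exact: rL2_L1].
  by rewrite Int_cst// /d mulfVK ?gt_eqF// addNr.
exists d; split; first by apply: rL2D => //; exact: rL2_cst.
by move=> x Dx; congr (_ + _); apply: eq_prim => t _; rewrite mul0r sub0r.
Qed.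

Lemma uniform_limit (u : nat -> R -> R) (e : nat -> R) :
  e @ \oo --> (0 : R) ->
  (forall n, measurable_fun D (u n)) ->
  (forall n m x, D x -> (n <= m)%N -> `|u m x - u n x| <= e n) ->
  exists v : R -> R, measurable_fun D v /\
    forall n x, D x -> `|v x - u n x| <= e n.
Proof.
move=> e0 mu Cu; exists (fun x => lim (u ^~ x @ \oo)).
have cu x : D x -> u ^~ x @ \oo --> lim (u ^~ x @ \oo).
  move=> Dx; apply/cauchy_cvgP; apply: cauchy_exP => eps eps0.
  have /cvgrPdist_lt/(_ _ eps0)[n _ Hn] := e0.
  exists (u n x); exists n => // m /= nm.
  rewrite /ball /= distrC (le_lt_trans (Cu n m x Dx nm))//.
  have := Hn n (leqnn n); rewrite sub0r normrN.
  by apply: le_lt_trans; exact: ler_norm.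
split; first exact: measurable_fun_cvg cu.
move=> n x Dx; apply: (cvgr_to_le (F := \oo) (f := fun m => `|u m x - u n x|)).
  by apply: cvg_norm; apply: cvgB; [exact: cu|exact: cvg_cst].
by exists n => // m /= nm; exact: Cu.
Qed.

(** The map sending [u] to the Dirichlet solution for [p] with right-hand side
    [h - r u] contracts the supremum norm by the factor 1/2, by [dir_stable];
    its fixed point solves the problem for [p + r]. *)
Lemma solvable_step p r : potential p -> measurable_fun D r ->
  (forall x, D x -> 0 <= r x <= (2 * l ^+ 2)^-1) ->
  solvable p -> solvable (fun x => p x + r x).
Proof.
move=> pp mr rb Sp h h2.
have /choice[S HS] : forall g, exists du, rL2 l g -> solves_dirichlet p g du.
  move=> g; have [g2|ng] := pselect (rL2 l g); last by exists (fun=> 0).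
  by have [du] := Sp _ g2; exists du.
have ru2 u : rL2 l u -> rL2 l (fun x => r x * u x).
  apply: rL2_pot; split => //; exists (2 * l ^+ 2)^-1; exact: rb.
pose dU := fix dU n := if n is k.+1
  then S (fun x => h x - r x * prim l (dU k) x) else fun=> 0.
have rhs2 u : rL2 l u -> rL2 l (fun x => h x - r x * u x).
  by move=> u2; apply: rL2B => //; exact: ru2.
have dU2 n : rL2 l (dU n).
  elim: n => [|n IH]; first exact: rL2_cst.
  by apply: dir_rL2 (HS _ _); apply: rhs2; exact: prim_rL2.
have dUS n : solves_dirichlet p (fun x => h x - r x * prim l (dU n) x) (dU n.+1).
  by apply: HS; apply: rhs2; exact: prim_rL2.
have contr u v du dv G : rL2 l u -> rL2 l v ->
    solves_dirichlet p (fun x => h x - r x * u x) du ->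
    solves_dirichlet p (fun x => h x - r x * v x) dv ->
    0 <= G -> (forall x, D x -> `|u x - v x| <= G) ->
    forall x, D x -> `|prim l du x - prim l dv x| <= G / 2.
  move=> u2 v2 Hu Hv G0 uv x /DE/andP[x0 xl].
  have Huv := dir_sub pp (rhs2 _ u2) (rhs2 _ v2) Hu Hv.
  rewrite -primB//; [|exact: dir_rL2 Hu|exact: dir_rL2 Hv].
  have := dir_stable pp (rL2B (rhs2 _ u2) (rhs2 _ v2)) Huv
    (G := (2 * l ^+ 2)^-1 * G).
  have -> : l ^+ 2 * ((2 * l ^+ 2)^-1 * G) = G / 2.
    by field; rewrite gt_eqF.
  apply; last by rewrite !ltW.
    by rewrite mulr_ge0// invr_ge0 mulr_ge0// sqr_ge0.
  move=> t Dt; have /andP[r0 r1] := rb t Dt.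
  have -> : h t - r t * u t - (h t - r t * v t) = - (r t * (u t - v t)) by ring.
  by rewrite normrN normrM ger0_norm// ler_pM// uv.
pose K0 := l * Int l (fun x => dU 1 x ^+ 2) + 1.
have K00 : 0 <= K0.
  by rewrite addr_ge0 ?mulr_ge0 ?Int_sqr_ge0 ?(ltW l_gt0).
pose q n := K0 * 2^-1 ^+ n.
have q0 n : 0 <= q n by rewrite mulr_ge0// exprn_ge0.
have qS n : q n.+1 = q n / 2 by rewrite /q exprSr mulrA.
have prim00 x : D x -> prim l (dU 0) x = 0.
  move=> /DE/andP[x0 xl]; rewrite /= prim_cst ?mul0r//.
  by rewrite !ltW.
have step n x : D x -> `|prim l (dU n.+1) x - prim l (dU n) x| <= q n.
  elim: n x => [|n IH] x Dx.
    rewrite prim00// subr0 /q expr0 mulr1 /K0.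
    have /andP[x0 xl] := DE Dx.
    have := @prim_sqr_le _ l l_gt0 (dU 1) x (dU2 1); rewrite (ltW x0) (ltW xl).
    move=> /(_ isT); rewrite -[X in X <= _ -> _]real_normK ?num_real//.
    have := normr_ge0 (prim l (dU 1) x); move: (`|_|) (l * _) => a c; nra.
  rewrite qS; apply: (contr (prim l (dU n.+1)) (prim l (dU n))) => //.
  - exact: prim_rL2.
  - exact: prim_rL2.
have cauchy n m x : D x -> (n <= m)%N ->
    `|prim l (dU m) x - prim l (dU n) x| <= 2 * q n.
  move=> Dx nm; apply: (@le_trans _ _ (2 * q n - 2 * q m)); last first.
    by rewrite lerBlDr lerDl mulr_ge0.
  rewrite -(subnK nm); elim: (m - n)%N => [|k IH].
    by rewrite add0n !subrr normr0.
  rewrite addSn -(subrKA (prim l (dU (k + n)%N) x)).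
  rewrite (le_trans (ler_normD _ _))//.
  have := step (k + n)%N x Dx; rewrite qS; lra.
have e0 : (fun n => 2 * q n) @ \oo --> (0 : R).
  rewrite -(mulr0 2); apply: cvgM; first exact: cvg_cst.
  rewrite -(mulr0 K0); apply: cvgM; first exact: cvg_cst.
  by apply: cvg_expr; rewrite ger0_norm// invf_lt1// ltr1n.
have [u [mu Hu]] := uniform_limit e0
  (fun n => rL2_measurable (prim_rL2 l_gt0 (dU2 n))) cauchy.
have u2 : rL2 l u.
  apply: (rL2_bounded l_gt0 (M := 2 * q 0)) => // x Dx.
  by have := Hu 0 x Dx; rewrite prim00// subr0.
have Hv := HS _ (rhs2 _ u2).
exists (S (fun x => h x - r x * u x)); set dv := S _ in Hv *.
have uv x : D x -> prim l dv x = u x.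
  move=> Dx; apply/eqP; rewrite -subr_eq0 -normr_le0.
  apply: (cvgr_to_ge (F := \oo) (f := fun n => 2 * q n)) => //.
  near=> n.
  rewrite -(subrKA (prim l (dU n.+1) x)) (le_trans (ler_normD _ _))//.
  have H1 : `|prim l dv x - prim l (dU n.+1) x| <= (2 * q n) / 2.
    apply: (contr u (prim l (dU n))) => //; first exact: prim_rL2.
      by rewrite mulr_ge0.
    by move=> t Dt; exact: Hu.
  have := Hu n.+1 x Dx; rewrite distrC qS; lra.
have [[d [dv2 dvE]] dv0] := Hv; split => //; exists d; split => // x Dx.
rewrite dvE//; congr (_ + _); apply: eq_prim => t Dt.
by rewrite add0r uv//; ring.
Unshelve. all: by end_near. Qed.

(** The potential is switched on in steps so small that the zeroth order term
    is a contraction; the estimates for one step only use that the potential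
    is nonnegative, so the steps can be iterated. *)
Lemma potential_solvable p : potential p -> solvable p.
Proof.
move=> [mp [M pM]].
have l20 : 0 < 2 * l ^+ 2 by rewrite mulr_gt0// exprn_gt0.
pose N := (Num.truncn (M * (2 * l ^+ 2))).+1.
have NM : M * (2 * l ^+ 2) < N%:R by exact: truncnS_gt.
have N0 : 0 < N%:R :> R by rewrite ltr0n.
pose r x := N%:R^-1 * p x.
have mr : measurable_fun D r by exact: measurable_funM.
have rb x : D x -> 0 <= r x <= (2 * l ^+ 2)^-1.
  move=> Dx; have /andP[p0 pm] := pM x Dx.
  rewrite mulr_ge0 ?invr_ge0 ?(ltW N0)//= [leLHS]mulrC ler_pdivrMr//.
  by rewrite [leRHS]mulrC ler_pdivlMr// (le_trans _ (ltW NM))// ler_wpM2r ?(ltW l20).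
have pk (k : nat) : potential (fun x => k%:R * r x).
  split; first exact: measurable_funM.
  exists (k%:R * (2 * l ^+ 2)^-1) => x Dx; have /andP[r0 r1] := rb x Dx.
  by rewrite mulr_ge0//= ler_wpM2l.
have H k : solvable (fun x => k%:R * r x).
  elim: k => [|k IH] h h2.
    have [du Hdu] := solvable0 h2; exists du.
    by apply: eq_solves_dirichlet Hdu => // x _; rewrite mul0r.
  have [du Hdu] := solvable_step (pk k) mr rb IH h2; exists du.
  by apply: eq_solves_dirichlet Hdu => // x _; rewrite -natr1 mulrDl mul1r.
move=> h h2; have [du Hdu] := H N h h2; exists du.
apply: eq_solves_dirichlet Hdu => // x _.
by rewrite /r mulrA divff ?mul1r// gt_eqF.
Qed.

End dirichlet.

(** * Complex L^2 on an interval and on a graph *)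

Section complex_L2.
Variables (R : realType) (l : R).
Hypothesis l_gt0 : 0 < l.
Implicit Types f g h : R -> R[i].

Let D : set (measurableTypeR R) := `]0, l[.

Definition re f : R -> R := fun x => complex.Re (f x).
Definition im f : R -> R := fun x => complex.Im (f x).

Lemma L2P f : L2 l f <-> rL2 l (re f) /\ rL2 l (im f).
Proof.
split=> [[mr mi fi]|[[mr fr] [mi fi]]].
  split; split => //; apply: (L1_le _ fi).
  - exact: measurable_funX.
  - by move=> x _; rewrite ger0_norm ?sqr_ge0// lerDl sqr_ge0.
  - exact: measurable_funX.
  - by move=> x _; rewrite ger0_norm ?sqr_ge0// lerDr sqr_ge0.
by split => //; exact: (L1D fr fi).
Qed.

Lemma L2D f g : L2 l f -> L2 l g -> L2 l (fun x => f x + g x).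
Proof.
move=> /L2P[fr fi] /L2P[gr gi]; apply/L2P; split.
  have -> : re (fun x => f x + g x) = fun x => re f x + re g x.
    by apply/funext => x; rewrite /re raddfD.
  exact: rL2D.
have -> : im (fun x => f x + g x) = fun x => im f x + im g x.
  by apply/funext => x; rewrite /im raddfD.
exact: rL2D.
Qed.

Lemma L2Z (c : R[i]) f : L2 l f -> L2 l (fun x => c * f x).
Proof.
move=> /L2P[fr fi]; apply/L2P; split.
  have -> : re (fun x => c * f x) =
      fun x => complex.Re c * re f x - complex.Im c * im f x.
    by apply/funext => x; rewrite /re /im; case: c (f x) => [? ?] [].
  by apply: rL2B; exact: rL2Z.
have -> : im (fun x => c * f x) =
    fun x => complex.Re c * im f x + complex.Im c * re f x.
  by apply/funext => x; rewrite /re /im; case: c (f x) => [? ?] [] /=.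
by apply: rL2D; exact: rL2Z.
Qed.

Lemma L2_0 : L2 l (fun=> 0).
Proof. by apply/L2P; split; exact: rL2_cst. Qed.

Definition cip f g : R[i] := cintegral l (fun x => f x * conjc (g x)).

Lemma cipE f g : L2 l f -> L2 l g ->
  cip f g = Complex (Int l (fun x => re f x * re g x) + Int l (fun x => im f x * im g x))
    (Int l (fun x => im f x * re g x) - Int l (fun x => re f x * im g x)).
Proof.
move=> /L2P[fr fi] /L2P[gr gi]; rewrite -IntD; [|exact: rL2_mul..].
rewrite -IntB; [|exact: rL2_mul..].
rewrite /cip /cintegral; congr Complex; apply: eq_Int => x _; rewrite /re /im;
  by case: (f x) (g x) => [? ?] [? ?] /=; ring.
Qed.

Lemma cipDl f g h : L2 l f -> L2 l g -> L2 l h ->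
  cip (fun x => f x + g x) h = cip f h + cip g h.
Proof.
move=> f2 g2 h2; rewrite !cipE//; last exact: L2D.
move: f2 g2 h2 => /L2P[fr fi] /L2P[gr gi] /L2P[hr hi].
have E (u v w : R -> R) : rL2 l u -> rL2 l v -> rL2 l w ->
    Int l (fun x => (u x + v x) * w x) =
    Int l (fun x => u x * w x) + Int l (fun x => v x * w x).
  move=> u2 v2 w2; rewrite -IntD; [|exact: rL2_mul..].
  by apply: eq_Int => x _; rewrite mulrDl.
rewrite (_ : re _ = fun x => re f x + re g x); last first.
  by apply/funext => x; rewrite /re raddfD.
rewrite (_ : im _ = fun x => im f x + im g x); last first.
  by apply/funext => x; rewrite /im raddfD.
by rewrite !E//; congr Complex; ring.
Qed.

Lemma cipZl (c : R[i]) f h : L2 l f -> L2 l h ->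
  cip (fun x => c * f x) h = c * cip f h.
Proof.
move=> f2 h2; rewrite !cipE//; last exact: L2Z.
move: f2 h2 => /L2P[fr fi] /L2P[hr hi].
have E (a b : R) (u v w : R -> R) : rL2 l u -> rL2 l v -> rL2 l w ->
    Int l (fun x => (a * u x + b * v x) * w x) =
    a * Int l (fun x => u x * w x) + b * Int l (fun x => v x * w x).
  move=> u2 v2 w2; have uw := rL2_mul u2 w2; have vw := rL2_mul v2 w2.
  rewrite -!IntZ// -IntD; [|exact: L1Z..].
  by apply: eq_Int => x _; ring.
rewrite (_ : re (fun x => c * f x) = fun x =>
    complex.Re c * re f x + (- complex.Im c) * im f x); last first.
  by apply/funext => x; rewrite /re /im; case: c (f x) => [? ?] [? ?] /=; ring.
rewrite (_ : im (fun x => c * f x) = fun x =>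
    complex.Re c * im f x + complex.Im c * re f x); last first.
  by apply/funext => x; rewrite /re /im; case: c (f x) => [? ?] [? ?] /=; ring.
by rewrite !E//; case: c => a b; congr Complex; rewrite /=; ring.
Qed.

Lemma cipC f g : L2 l f -> L2 l g -> cip g f = conjc (cip f g).
Proof.
move=> f2 g2; rewrite !cipE//=.
have E (u v : R -> R) : Int l (fun x => u x * v x) = Int l (fun x => v x * u x).
  by apply: eq_Int => x _; rewrite mulrC.
rewrite (E (re g)) (E (im g) (im f)) (E (im g)) (E (re g)).
by congr Complex; ring.
Qed.

Lemma cip_self f : L2 l f ->
  complex.Re (cip f f) = Int l (fun x => re f x ^+ 2) + Int l (fun x => im f x ^+ 2).
Proof. by move=> f2; rewrite cipE. Qed.

Lemma cip_ge0 f : L2 l f -> 0 <= complex.Re (cip f f).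
Proof. by move=> f2; rewrite cip_self// addr_ge0// Int_sqr_ge0. Qed.

Lemma cip_eq0 f : L2 l f -> complex.Re (cip f f) = 0 ->
  ae_on l (fun x => f x = 0).
Proof.
move=> f2; rewrite cip_self// => /eqP; rewrite paddr_eq0 ?Int_sqr_ge0//.
move=> /andP[/eqP r0 /eqP i0]; have /L2P[[_ fr] [_ fi]] := f2.
have H1 := Int_eq0 fr (fun x _ => sqr_ge0 _) r0.
have H2 := Int_eq0 fi (fun x _ => sqr_ge0 _) i0.
apply: ae_onS (ae_onI H1 H2) => x _; rewrite /re /im.
by case: (f x) => a b /= [/eqP + /eqP]; rewrite !sqrf_eq0 => /eqP-> /eqP->.
Qed.

Lemma ae_cip f f' g : L2 l f -> L2 l f' -> L2 l g ->
  ae_on l (fun x => f x = f' x) -> cip f g = cip f' g.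
Proof.
move=> f2 f2' g2 ff'; rewrite !cipE//.
move: f2 f2' g2 => /L2P[[mfr _] [mfi _]] /L2P[[mfr' _] [mfi' _]] /L2P[[mgr _] [mgi _]].
have Hr : ae_on l (fun x => re f x = re f' x).
  by apply: ae_onS ff' => x _; rewrite /re => ->.
have Hi : ae_on l (fun x => im f x = im f' x).
  by apply: ae_onS ff' => x _; rewrite /im => ->.
have E (u u' v : R -> R) : measurable_fun D u -> measurable_fun D u' ->
    measurable_fun D v -> ae_on l (fun x => u x = u' x) ->
    Int l (fun x => u x * v x) = Int l (fun x => u' x * v x).
  move=> mu mu' mv uu'; apply: ae_Int; [exact: measurable_funM..|].
  by apply: ae_onS uu' => x _ ->.
by rewrite (E (re f) (re f') (re g))// (E (im f) (im f') (im g))//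
  (E (re f) (re f') (im g))// (E (im f) (im f') (re g)).
Qed.

End complex_L2.

Section graph_L2.
Variables (R : realType) (G : mgraph R).

Record L2fun := MkL2 { l2val :> edge G -> R -> R[i]; l2P : gL2 l2val }.

Lemma L2fun_eq (f g : L2fun) : (forall e x, f e x = g e x) -> f = g.
Proof.
case: f g => [f f2] [g g2] /= fg.
have E : f = g by apply/funext => e; apply/funext => x; exact: fg.
by subst g; congr MkL2; exact: Prop_irrelevance.
Qed.

Definition l2add (f g : L2fun) : L2fun :=
  MkL2 (fun e => L2D (l2P f e) (l2P g e)).
Definition l2scale (c : R[i]) (f : L2fun) : L2fun :=
  MkL2 (fun e => L2Z c (l2P f e)).
Definition l2zero : L2fun := @MkL2 (fun _ _ => 0) (fun e => L2_0 (len_gt0 e)).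
Definition l2opp (f : L2fun) : L2fun := l2scale (-1) f.

HB.instance Definition _ := gen_eqMixin L2fun.
HB.instance Definition _ := gen_choiceMixin L2fun.

Lemma l2addA : associative l2add.
Proof. by move=> f g h; apply: L2fun_eq => e x /=; rewrite addrA. Qed.
Lemma l2addC : commutative l2add.
Proof. by move=> f g; apply: L2fun_eq => e x /=; rewrite addrC. Qed.
Lemma l2add0 : left_id l2zero l2add.
Proof. by move=> f; apply: L2fun_eq => e x /=; rewrite add0r. Qed.
Lemma l2addN : left_inverse l2zero l2opp l2add.
Proof. by move=> f; apply: L2fun_eq => e x /=; rewrite mulN1r addNr. Qed.

HB.instance Definition _ :=
  GRing.isZmodule.Build L2fun l2addA l2addC l2add0 l2addN.

Lemma l2scaleA (a b : R[i]) (f : L2fun) :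
  l2scale a (l2scale b f) = l2scale (a * b) f.
Proof. by apply: L2fun_eq => e x /=; rewrite mulrA. Qed.
Lemma l2scale1 : left_id 1 l2scale.
Proof. by move=> f; apply: L2fun_eq => e x /=; rewrite mul1r. Qed.
Lemma l2scaleDr : right_distributive l2scale +%R.
Proof. by move=> a f g; apply: L2fun_eq => e x /=; rewrite mulrDr. Qed.
Lemma l2scaleDl (f : L2fun) : {morph l2scale^~ f : a b / a + b}.
Proof. by move=> a b; apply: L2fun_eq => e x /=; rewrite mulrDl. Qed.

HB.instance Definition _ := GRing.Zmodule_isLmodule.Build R[i] L2fun
  l2scaleA l2scale1 l2scaleDr l2scaleDl.

Lemma l2addE (f g : L2fun) e x : (f + g) e x = f e x + g e x.
Proof. by []. Qed.
Lemma l2oppE (f : L2fun) e x : (- f) e x = - f e x.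
Proof. by rewrite -[LHS]/(-1 * f e x) mulN1r. Qed.

Definition gip (f g : L2fun) : R[i] := ginner (l2val f) (l2val g).

Lemma gipDl (f g h : L2fun) : gip (f + g) h = gip f h + gip g h.
Proof.
rewrite /gip /ginner -big_split; apply: eq_bigr => e _.
by apply: cipDl => //; exact: l2P.
Qed.

Lemma gipZl c (f h : L2fun) : gip (c *: f) h = c * gip f h.
Proof.
rewrite /gip /ginner big_distrr; apply: eq_bigr => e _.
by apply: cipZl => //; exact: l2P.
Qed.

Lemma gipC (f g : L2fun) : gip g f = conjc (gip f g).
Proof.
rewrite /gip /ginner (big_morph _ (@conjcD R) (conjc0 R)); apply: eq_bigr => e _.
by apply: cipC => //; exact: l2P.
Qed.

Lemma gip_ge0 (f : L2fun) : 0 <= complex.Re (gip f f).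
Proof.
rewrite /gip /ginner raddf_sum sumr_ge0// => e _.
by apply: cip_ge0 => //; exact: l2P.
Qed.

Definition gsip : sip L2fun := Sip gipDl gipZl gipC gip_ge0.

Lemma gnullP (f : L2fun) : nsq gsip f = 0 <-> gae_eq (l2val f) (fun _ _ => 0).
Proof.
split=> [|f0].
  rewrite /nsq /rip /= /gip /ginner raddf_sum => /eqP.
  rewrite psumr_eq0 => [/allP H e|e _]; last by apply: cip_ge0; exact: l2P.
  apply: (cip_eq0 (l2P f e)).
  by apply/eqP; have := H e; rewrite mem_index_enum; exact.
rewrite /nsq /rip /= /gip /ginner big1// => e _.
rewrite -/(cip (len e) (f e) (f e)).
rewrite (ae_cip (f' := fun=> 0) (l2P f e) (L2_0 (len_gt0 e)) (l2P f e) (f0 e)).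
rewrite (cipE (L2_0 (len_gt0 e)) (l2P f e)).
have E (u : R -> R) : Int (len e) (fun x => 0 * u x) = 0.
  rewrite (eq_Int (g := fun=> 0)) ?(Int_cst (len_gt0 e)) ?mul0r// => x _.
  by rewrite mul0r.
by rewrite !E addr0 subr0.
Qed.

Lemma geqnullP (f g : L2fun) : eqnull gsip f g <-> gae_eq (l2val f) (l2val g).
Proof.
rewrite /eqnull gnullP; split => H e; apply: ae_onS (H e) => x _.
  by rewrite l2addE l2oppE => /eqP; rewrite subr_eq0 => /eqP.
by rewrite l2addE l2oppE => ->; rewrite subrr.
Qed.

End graph_L2.

(** * Solution operator and kernel functions on an interval *)

Definition dirichlet_deriv (R : realType) (l : R) (p h : R -> R) : R -> R :=
  xget (fun=> 0) [set du | solves_dirichlet l p h du].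

(** Locked, because comparing two instances by conversion would unfold the
    Lebesgue integral. *)
HB.lock Definition dirichlet (R : realType) (l : R) (p h : R -> R) : R -> R :=
  prim l (dirichlet_deriv l p h).

Definition kernel_deriv (R : realType) (l : R) (p : R -> R) (a b : R) : R -> R :=
  fun x => (b - a) / l +
  dirichlet_deriv l p (fun t => - (p t * (a + prim l (fun=> (b - a) / l) t))) x.

HB.lock Definition kernel_fun (R : realType) (l : R) (p : R -> R) (a b : R) :
    R -> R :=
  fun x => a + prim l (kernel_deriv l p a b) x.

Section solution_operator.
Variables (R : realType) (l : R).
Hypothesis l_gt0 : 0 < l.
Variable p : R -> R.
Hypothesis pp : potential l p.
Implicit Types (f g h k u du dv : R -> R) (x y a b d : R).

Let D : set (measurableTypeR R) := `]0, l[.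
Let DE x : D x -> 0 < x < l. Proof. by rewrite /D /= in_itv. Qed.
Let Dc x : D x -> 0 <= x <= l.
Proof. by move=> /DE/andP[x0 xl]; rewrite !ltW. Qed.

Local Notation dsol := (dirichlet_deriv l p).
Local Notation us := (dirichlet l p).
Local Notation kD := (kernel_deriv l p).
Local Notation kf := (kernel_fun l p).

Lemma dirichletE h : us h = prim l (dsol h).
Proof. by rewrite dirichlet.unlock. Qed.

Lemma dirichlet_derivP h : rL2 l h -> solves_dirichlet l p h (dsol h).
Proof.
move=> h2; have [du Hdu] := potential_solvable l_gt0 pp h2.
by rewrite /dirichlet_deriv; case: xgetP => [//|/(_ du)].
Qed.

Lemma dirichlet_rL2 h : rL2 l h -> rL2 l (us h).
Proof.
move=> h2; rewrite dirichletE; apply: prim_rL2 => //.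
exact: dir_rL2 (dirichlet_derivP h2).
Qed.

Lemma dirichletB h g x : rL2 l h -> rL2 l g -> 0 <= x <= l ->
  us (fun t => h t - g t) x = us h x - us g x.
Proof.
move=> h2 g2 xl; have hg2 := rL2B h2 g2.
have Hh := dirichlet_derivP h2; have Hg := dirichlet_derivP g2.
rewrite !dirichletE -primB//; [|exact: dir_rL2 Hh|exact: dir_rL2 Hg].
exact: (dir_unique l_gt0 pp hg2 (dirichlet_derivP hg2) (dir_sub l_gt0 pp h2 g2 Hh Hg) xl).
Qed.

Lemma dirichlet_sym h g : rL2 l h -> rL2 l g ->
  Int l (fun x => us h x * g x) = Int l (fun x => h x * us g x).
Proof.
move=> h2 g2; rewrite !dirichletE.
rewrite (dir_sym l_gt0 pp h2 g2 (dirichlet_derivP h2) (dirichlet_derivP g2)).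
by apply: eq_Int => x _; rewrite mulrC.
Qed.

Lemma dirichlet_energy h : rL2 l h ->
  Int l (fun x => dsol h x ^+ 2) <= Int l (fun x => us h x * h x).
Proof.
move=> h2; rewrite dirichletE.
apply: (le_trans (dir_coercive l_gt0 pp h2 (dirichlet_derivP h2))).
by rewrite (eq_Int (g := fun x => prim l (dsol h) x * h x))// => x _; rewrite mulrC.
Qed.

Lemma dirichlet_bounded h : rL2 l h ->
  Int l (fun x => us h x ^+ 2) <= l ^+ 2 * Int l (fun x => us h x * h x).
Proof.
move=> h2; have Hh := dirichlet_derivP h2; rewrite {1}dirichletE.
apply: (le_trans (Int_prim_sqr_le l_gt0 (dir_rL2 Hh))).
by rewrite ler_wpM2l ?sqr_ge0//; exact: dirichlet_energy.
Qed.

Lemma dirichlet_ge0 h : rL2 l h -> 0 <= Int l (fun x => us h x * h x).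
Proof. by move=> h2; rewrite (le_trans _ (dirichlet_energy h2))// Int_sqr_ge0. Qed.

Lemma dirichlet_sup h x : rL2 l h -> 0 <= x <= l ->
  us h x ^+ 2 <= l ^+ 3 * Int l (fun x => h x ^+ 2).
Proof. by move=> h2; rewrite dirichletE; exact: dir_sup (dirichlet_derivP h2). Qed.

(** [u] is controlled by its values at [N] equidistant points and by its
    modulus of continuity, which the energy bounds. *)
Lemma dirichlet_sample N h : (0 < N)%N -> rL2 l h ->
  Int l (fun x => us h x ^+ 2) <=
    2 * l ^+ 2 / N%:R * Int l (fun x => us h x * h x) +
    2 * l * \sum_(i < N) us h (i%:R * (l / N%:R)) ^+ 2.
Proof.
move=> N0 h2; have du2 := dir_rL2 (dirichlet_derivP h2).
have N0' : 0 < N%:R :> R by rewrite ltr0n.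
set S := \sum_(i < N) _; set E := Int l (fun x => us h x * h x).
have HE := dirichlet_energy h2; rewrite -/E in HE.
have pt x : D x -> us h x ^+ 2 <= 2 * l / N%:R * E + 2 * S.
  move=> /DE/andP[x0 xl].
  pose k := Num.truncn (x / (l / N%:R)).
  have lN : 0 < l / N%:R by rewrite divr_gt0.
  have x0' : 0 <= x / (l / N%:R) by rewrite divr_ge0 ?(ltW x0) ?(ltW lN).
  have kx : k%:R * (l / N%:R) <= x.
    by rewrite -ler_pdivlMr//; have /andP[] := truncn_itv x0'.
  have xk : x < (k.+1)%:R * (l / N%:R).
    by rewrite -ltr_pdivrMr//; have /andP[] := truncn_itv x0'.
  have kN : (k < N)%N.
    rewrite -(ltr_nat R) -(ltr_pM2r lN) (le_lt_trans kx)//.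
    by rewrite mulrC divfK ?gt_eqF.
  have xk2 : us h (k%:R * (l / N%:R)) ^+ 2 <= S.
    rewrite /S (bigD1 (Ordinal kN))//= lerDl sumr_ge0// => i _.
    exact: sqr_ge0.
  have Hd : (us h x - us h (k%:R * (l / N%:R))) ^+ 2 <= l / N%:R * E.
    rewrite !dirichletE; apply: (le_trans (prim_diff l_gt0 _ _ du2)).
    rewrite ger0_norm ?subr_ge0// ler_pM ?subr_ge0 ?Int_sqr_ge0//.
    by rewrite lerBlDr -[X in X + _]mul1r -mulrDl nat1r ltW.
  have -> : 2 * l / N%:R * E = 2 * (l / N%:R * E) by ring.
  move: xk2 Hd; move: (us h x) (us h _) S (_ * E) => a b s e.
  have := sqr_ge0 (a - 2 * b); nra.
apply: (@le_trans _ _ (Int l (fun=> 2 * l / N%:R * E + 2 * S))).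
  apply: le_Int => //; first by case: (dirichlet_rL2 h2).
  exact: L1_cst.
rewrite Int_cst// mulrDl.
by rewrite le_eqVlt; apply/orP; left; apply/eqP; ring.
Qed.

(** A continuous function that vanishes almost everywhere vanishes. *)
Lemma ae0_prim a f : rL2 l f -> ae_on l (fun x => a + prim l f x = 0) ->
  forall x, 0 <= x <= l -> a + prim l f x = 0.
Proof.
move=> f2 [N [mN N0 Nsub]] x /andP[x0 xl]; apply: contrapT => fx.
have fx0 : 0 < `|a + prim l f x| by rewrite normr_gt0; apply/eqP.
have cf : {for x, continuous (fun y => a + prim l f y)}.
  by apply: continuousD; [exact: cst_continuous|exact: prim_continuous].
have /cvgrPdist_lt/(_ _ fx0)[e /= e0 He] := cf.
pose s := Num.max 0 (x - e); pose t := Num.min l (x + e).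
have st : s < t.
  rewrite gt_max !lt_min l_gt0 /=; move: e0 => /= e0.
  by apply/andP; split; [|apply/andP; split]; lra.
have sub : `]s, t[ `<=` N.
  move=> y; rewrite /= in_itv /= gt_max lt_min => /andP[/andP[y0 xey] /andP[yl yxe]].
  apply: Nsub => /= H; have : a + prim l f y = 0 by apply: H; rewrite in_itv /= y0 yl.
  move=> fy; have := He y; rewrite fy subr0 ltxx => H2.
  suff : false by []. apply: H2; rewrite /= ltr_distlC; apply/andP; split; lra.
have : (lebesgue_measure (`]s, t[%classic : set R) <= @lebesgue_measure R N)%E.
  by apply: le_measure; rewrite ?inE//; exact: measurable_itv.
rewrite [X in (_ <= X)%E]N0 lebesgue_measure_itv /= lte_fin st.
by rewrite -EFinB lee_fin subr_le0 leNgt st.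
Qed.

Definition solves_hom a b k := exists d du,
  [/\ solves l p (fun=> 0) a d du, a + Int l du = b &
      forall x, D x -> k x = a + prim l du x].

Lemma eq_solves h h' a d du : (forall x, D x -> h x = h' x) ->
  solves l p h a d du -> solves l p h' a d du.
Proof.
move=> hE [du2 duE]; split => // x Dx; rewrite duE//; congr (_ + _).
by apply: eq_prim => t Dt; rewrite hE.
Qed.

Lemma hom_rL2 a b k : solves_hom a b k -> rL2 l k.
Proof.
move=> [d [du [[du2 _] _ kE]]]; have [mk k2] := rL2_affine l_gt0 a du2.
split.
  by apply: eq_measurable_fun mk => x; rewrite inE => Dx; rewrite kE.
by apply: eq_integrable k2 => // x; rewrite inE => Dx; rewrite kE.
Qed.

Lemma homD a b k a' b' k' : solves_hom a b k -> solves_hom a' b' k' ->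
  solves_hom (a + a') (b + b') (fun x => k x + k' x).
Proof.
move=> [d [du [s1 <- kE]]] [d' [du' [s2 <- kE']]].
have [du2 _] := s1; have [du2' _] := s2.
exists (d + d'), (fun x => du x + du' x); split.
- apply: eq_solves (sol_add l_gt0 pp (rL2_cst l_gt0 0) (rL2_cst l_gt0 0) s1 s2).
  by move=> x _; rewrite addr0.
- by rewrite (IntD (rL2_L1 l_gt0 du2) (rL2_L1 l_gt0 du2')) addrACA.
- by move=> x Dx; rewrite kE// kE'// primD// addrACA.
Qed.

Lemma homZ c a b k : solves_hom a b k -> solves_hom (c * a) (c * b) (fun x => c * k x).
Proof.
move=> [d [du [s1 <- kE]]]; have [du2 _] := s1.
exists (c * d), (fun x => c * du x); split.
- apply: eq_solves (sol_scale l_gt0 c pp (rL2_cst l_gt0 0) s1).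
  by move=> x _; rewrite mulr0.
- by rewrite (IntZ _ (rL2_L1 l_gt0 du2)) mulrDr.
- by move=> x Dx; rewrite kE// primZ// mulrDr.
Qed.

Lemma prim00 x : prim l (fun=> 0) x = 0.
Proof.
rewrite /prim (eq_Int (g := fun=> 0)) ?(Int_cst l_gt0) ?mul0r// => t _.
by rewrite mul0r.
Qed.

Lemma sol0 : solves l p (fun=> 0) 0 0 (fun=> 0).
Proof.
split; first exact: rL2_cst.
move=> x Dx; rewrite (eq_prim (g := fun=> 0)) ?prim00 ?addr0// => t _.
by rewrite prim00 addr0 mulr0 subr0.
Qed.

Lemma hom0 : solves_hom 0 0 (fun=> 0).
Proof.
exists 0, (fun=> 0); split; first exact: sol0.
- by rewrite (Int_cst l_gt0) mul0r addr0.
- by move=> x _; rewrite prim00 addr0.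
Qed.

(** With zero boundary values the solution has zero energy. *)
Lemma hom_unique k x : solves_hom 0 0 k -> D x -> k x = 0.
Proof.
move=> [d [du [s1 I0 kE]]] Dx; rewrite kE// add0r; rewrite add0r in I0.
have H1 : solves_dirichlet l p (fun=> 0) du by split => //; exists d.
have H2 : solves_dirichlet l p (fun=> 0) (fun=> 0).
  by split; [exists 0; exact: sol0|rewrite (Int_cst l_gt0) mul0r].
rewrite (dir_unique l_gt0 pp (rL2_cst l_gt0 0) H1 H2 (Dc Dx)).
by rewrite (prim_cst _ (Dc Dx)) mul0r.
Qed.

Lemma hom_ae0 a b k : solves_hom a b k -> ae_on l (fun x => k x = 0) ->
  a = 0 /\ b = 0.
Proof.
move=> [d [du [[du2 _] <- kE]]] k0.
have H : forall x, 0 <= x <= l -> a + prim l du x = 0.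
  by apply: ae0_prim => //; apply: ae_onS k0 => x Dx; rewrite kE.
have := H 0; rewrite lexx (ltW l_gt0) prim0// addr0 => /(_ isT) ->.
have := H l; rewrite lexx (ltW l_gt0) priml// => /(_ isT).
have := H 0; rewrite lexx (ltW l_gt0) prim0// addr0 => /(_ isT) ->.
by [].
Qed.

(** The affine function with the same boundary values, plus the Dirichlet
    solution that removes the error it makes in the equation. *)
Lemma kernel_fun_hom a b : solves_hom a b (kf a b).
Proof.
set c := (b - a) / l.
pose h t := - (p t * (a + prim l (fun=> c) t)).
have c2 : rL2 l (fun=> c) by exact: rL2_cst.
have h2 : rL2 l h by apply: rL2N; apply: rL2_pot => //; exact: rL2_affine.
have [[d [du2 duE]] du0] := dirichlet_derivP h2.
exists (c + d), (kD a b); split => //; last by rewrite kernel_fun.unlock.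
  split; first exact: rL2D.
  move=> x Dx; rewrite /kernel_deriv -/c -/h duE// addrA; congr (_ + _).
  apply: eq_prim => t _; rewrite add0r subr0 primD// /h; ring.
rewrite /kernel_deriv IntD; [|exact: L1_cst|exact: rL2_L1].
by rewrite Int_cst// du0 addr0 divfK ?gt_eqF// addrC subrK.
Qed.

(** Green's formula for a Dirichlet solution against a kernel function. *)
Lemma dirichlet_kernel h du d a b k : rL2 l h -> solves l p h 0 d du -> Int l du = 0 ->
  solves_hom a b k ->
  Int l (fun x => h x * k x) =
  d * a - (d + Int l (fun t => p t * prim l du t - h t)) * b.
Proof.
move=> h2 s1 du0 [e [dk [s2 <- kE]]].
have [du2 _] := s1; have [dk2 _] := s2.
have /= W1 := sol_weak l_gt0 a pp h2 s1 dk2.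
have /= W2 := sol_weak l_gt0 0 pp (rL2_cst l_gt0 0) s2 du2.
rewrite (eq_Int (g := fun x => h x * (a + prim l dk x))); last first.
  by move=> x Dx; rewrite kE.
rewrite W1.
have -> : Int l (fun t => p t * (0 + prim l du t) - h t) =
    Int l (fun t => p t * prim l du t - h t).
  by apply: eq_Int => t _; rewrite add0r.
have E1 : Int l (fun x => p x * (0 + prim l du x) * (a + prim l dk x)) =
    Int l (fun x => p x * (a + prim l dk x) * (0 + prim l du x)).
  by apply: eq_Int => t _; ring.
have E2 : Int l (fun x => du x * dk x) = Int l (fun x => dk x * du x).
  by apply: eq_Int => t _; ring.
have E3 : Int l (fun x => 0 * (0 + prim l du x)) = 0.
  by rewrite (eq_Int (g := fun=> 0)) ?Int_cst ?mul0r// => t _; rewrite mul0r.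
move: W2; rewrite E3 du0 addr0 !mulr0 !subr0 E1 E2 => <-.
by rewrite add0r opprB.
Qed.

(** A Dirichlet solution that agrees with a solution of the homogeneous equation
    forces the boundary values of the latter to vanish; then both are zero, and
    so are the derivative and the right-hand side. *)
Lemma dirichlet_hom_ae0 h a b k : rL2 l h -> solves_hom a b k ->
  ae_on l (fun x => us h x = k x) -> ae_on l (fun x => h x = 0).
Proof.
move=> h2 Hk ae; have Hh := dirichlet_derivP h2; have du2 := dir_rL2 Hh.
have [e [dk [[dk2 s2] kb kE]]] := Hk.
have H0 : forall x, 0 <= x <= l -> - a + prim l (fun x => dsol h x - dk x) x = 0.
  apply: ae0_prim; first exact: rL2B.
  apply: ae_onS ae => x Dx; rewrite kE// primB// -dirichletE => ->; ring.
have a0 : a = 0.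
  have := H0 0; rewrite lexx (ltW l_gt0) prim0// addr0 => /(_ isT) /eqP.
  by rewrite oppr_eq0 => /eqP.
have b0 : b = 0.
  have := H0 l; rewrite lexx (ltW l_gt0) priml// => /(_ isT).
  rewrite IntB; [|exact: rL2_L1..]; rewrite Hh.2 -kb a0 oppr0 !add0r.
  by move=> /eqP; rewrite oppr_eq0 => /eqP.
have us0 x : 0 <= x <= l -> us h x = 0.
  move=> xl; have := H0 x xl; rewrite a0 oppr0 add0r primB// -dirichletE.
  have [_ Hd] := Hh.
  have : forall x, 0 <= x <= l -> 0 + prim l dk x = 0.
    apply: ae0_prim => //; apply: ae_onT => y Dy.
    have := kE y Dy; rewrite a0 => <-.
    by move: Hk; rewrite a0 b0 => Hk; exact: hom_unique Hk Dy.
  by move=> /(_ x xl); rewrite add0r => ->; rewrite subr0.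
have d0 : ae_on l (fun x => dsol h x = 0).
  by apply: prim_inj => // x /andP[x0 xl]; rewrite -dirichletE us0// !ltW.
have [[d [_ duE]] _] := Hh.
have H1 : forall x, 0 <= x <= l -> d + prim l (fun t => - h t) x = 0.
  apply: ae0_prim; first exact: rL2N.
  apply: ae_onS d0 => x Dx <-; rewrite duE//; congr (_ + _).
  by apply: eq_prim => t Dt; rewrite add0r -dirichletE us0 ?mulr0 ?sub0r//; exact: Dc.
have dz : d = 0.
  by have := H1 0; rewrite lexx (ltW l_gt0) prim0// addr0 => /(_ isT).
have : ae_on l (fun x => - h x = 0).
  apply: prim_inj => //; first exact: rL2N.
  move=> x /andP[x0 xl]; have := H1 x; rewrite dz add0r; apply.
  by rewrite !ltW.
by apply: ae_onS => x _ /eqP; rewrite oppr_eq0 => /eqP.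
Qed.

End solution_operator.

(** * The operator on an edge *)

Section edge_operator.
Variables (R : realType) (l : R).
Hypothesis l_gt0 : 0 < l.
Variables p q : R -> R.
Hypothesis pp : potential l p.
Hypothesis qp : ae_on l (fun x => q x = p x).

Let D : set (measurableTypeR R) := `]0, l[.
Let DE x : D x -> 0 < x < l. Proof. by rewrite /D /= in_itv. Qed.
Let Dc x : D x -> 0 <= x <= l.
Proof. by move=> /DE/andP[x0 xl]; rewrite !ltW. Qed.

Lemma cintegral_prim (f : R -> R[i]) x : 0 <= x <= l ->
  cintegral x f = Complex (prim l (re f) x) (prim l (im f) x).
Proof. by move=> xl; rewrite /cintegral !primE. Qed.

Lemma H1P (f f' : R -> R[i]) (f0 fl : R[i]) :
  H1 l f f' f0 fl <->
  [/\ L2 l f, L2 l f',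
      ae_on l (fun x => f x = f0 + Complex (prim l (re f') x) (prim l (im f') x)) &
      fl = f0 + Complex (Int l (re f')) (Int l (im f'))].
Proof.
have E : cintegral l f' = Complex (Int l (re f')) (Int l (im f')) by [].
by split=> -[f2 f2' ae fE]; split => //; apply: ae_onS ae => x Dx ->;
  rewrite (cintegral_prim _ (Dc Dx)).
Qed.

Lemma ae_sol (U U' U'' h : R -> R) (d : R) :
  rL2 l U -> rL2 l U' -> rL2 l U'' -> rL2 l h ->
  ae_on l (fun x => U x = prim l U' x) -> Int l U' = 0 ->
  ae_on l (fun x => U' x = d + prim l U'' x) ->
  ae_on l (fun x => h x = - U'' x + p x * U x) ->
  ae_on l (fun x => U x = dirichlet l p h x) /\
  forall a b k, solves_hom l p a b k ->
    Int l (fun x => h x * k x) = d * a - (d + Int l U'') * b.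
Proof.
move=> U2 U2' U2'' h2 UE I0 UE' hE.
pose du x := d + prim l U'' x.
have du2 : rL2 l du by exact: rL2_affine.
have mU' := rL2_measurable U2'; have mdu := rL2_measurable du2.
have primU x : prim l U' x = prim l du x by exact: ae_prim.
have Idu : Int l du = 0 by rewrite -I0; apply: esym; exact: ae_Int.
have rhs2 := rL2B (rL2_pot pp (prim_rL2 l_gt0 du2)) h2.
have aeU : ae_on l (fun t => U'' t = p t * prim l du t - h t).
  by apply: ae_onS (ae_onI UE hE) => x _ [-> ->]; rewrite primU; ring.
have s1 : solves l p h 0 d du.
  split => // x Dx; congr (_ + _).
  have -> : prim l (fun t => p t * (0 + prim l du t) - h t) x =
      prim l (fun t => p t * prim l du t - h t) x.
    by apply: eq_prim => t _; rewrite add0r.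
  exact: ae_prim (rL2_measurable U2'') (rL2_measurable rhs2) aeU.
split.
  apply: ae_onS UE => x Dx ->; rewrite primU dirichletE.
  apply: (dir_unique l_gt0 pp h2 _ (dirichlet_derivP l_gt0 pp h2) (Dc Dx)).
  by split => //; exists d.
move=> a b k Hk; rewrite (dirichlet_kernel l_gt0 pp h2 s1 Idu Hk).
congr (_ - (_ + _) * _); apply: esym.
exact: ae_Int (rL2_measurable U2'') (rL2_measurable rhs2) aeU.
Qed.

Lemma sol_ae (U h : R -> R) : rL2 l U -> rL2 l h ->
  ae_on l (fun x => U x = dirichlet l p h x) ->
  exists (U' U'' : R -> R) (d : R),
  [/\ rL2 l U' /\ rL2 l U'',
      ae_on l (fun x => U x = prim l U' x) /\ Int l U' = 0,
      ae_on l (fun x => U' x = d + prim l U'' x) &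
      ae_on l (fun x => h x = - U'' x + p x * U x)].
Proof.
move=> U2 h2 UE; have [[d [du2 duE]] I0] := dirichlet_derivP l_gt0 pp h2.
have u2 := dirichlet_rL2 l_gt0 pp h2.
exists (dirichlet_deriv l p h), (fun t => p t * dirichlet l p h t - h t), d; split => //.
- by split => //; exact: rL2B (rL2_pot pp u2) h2.
- by split => //; apply: ae_onS UE => x _ ->; rewrite dirichletE.
- apply: ae_onT => x Dx; rewrite duE//; congr (_ + _).
  by apply: eq_prim => t _; rewrite add0r dirichletE.
- by apply: ae_onS UE => x _ ->; ring.
Qed.

Definition csol (h : R -> R[i]) : R -> R[i] :=
  fun x => Complex (dirichlet l p (re h) x) (dirichlet l p (im h) x).

Lemma csol_L2 h : L2 l h -> L2 l (csol h).
Proof. by move=> /L2P[hr hi]; apply/L2P; split; exact: dirichlet_rL2. Qed.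

Lemma cip_real h (k : R -> R) : L2 l h -> rL2 l k ->
  cip l h (fun x => Complex (k x) 0) =
  Complex (Int l (fun x => re h x * k x)) (Int l (fun x => im h x * k x)).
Proof.
move=> h2 k2; rewrite cipE//; last by apply/L2P; split => //; exact: rL2_cst.
have E (v : R -> R) : Int l (fun x => v x * im (fun y => Complex (k y) 0) x) = 0.
  rewrite (eq_Int (g := fun=> 0)) ?(Int_cst l_gt0) ?mul0r// => t _.
  by rewrite /im /= mulr0.
by rewrite !E addr0 subr0.
Qed.

(** The conditions that [opS] imposes on one edge when [f] vanishes at both
    ends; [d0] and [dl] are the boundary values of the derivative. *)
Definition edge_eq f h (f' f'' : R -> R[i]) (d0 dl : R[i]) : Prop :=
  [/\ H1 l f f' 0 0, H1 l f' f'' d0 dl &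
      ae_on l (fun x => h x = - f'' x + Complex (q x) 0 * f x)].

Lemma edge_eqP f h (f' f'' : R -> R[i]) (d0 dl : R[i]) : L2 l h ->
  edge_eq f h f' f'' d0 dl ->
  ae_on l (fun x => f x = csol h x) /\
  forall a b k, solves_hom l p a b k ->
    cip l h (fun x => Complex (k x) 0) = d0 * Complex a 0 - dl * Complex b 0.
Proof.
move=> h2 [/H1P[f2 f2' fE I0] /H1P[_ f2'' fE' dE] hE].
have /L2P[hr hi] := h2; have /L2P[fr fi] := f2; have /L2P[fr' fi'] := f2'.
have /L2P[fr'' fi''] := f2''.
move: I0; rewrite add0r => -[I0r I0i].
have [Hr Kr] : ae_on l (fun x => re f x = dirichlet l p (re h) x) /\
    forall a b k, solves_hom l p a b k -> Int l (fun x => re h x * k x) =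
      complex.Re d0 * a - (complex.Re d0 + Int l (re f'')) * b.
  apply: (ae_sol fr fr' fr'' hr).
  - by apply: ae_onS fE => x _; rewrite /re => -> /=; rewrite add0r.
  - by rewrite -I0r.
  - by apply: ae_onS fE' => x _; rewrite /re => ->; case: (d0).
  - apply: ae_onS (ae_onI hE qp) => x _ []; rewrite /re => -> ->.
    by case: (f'' x) (f x) => [? ?] [? ?] /=; ring.
have [Hi Ki] : ae_on l (fun x => im f x = dirichlet l p (im h) x) /\
    forall a b k, solves_hom l p a b k -> Int l (fun x => im h x * k x) =
      complex.Im d0 * a - (complex.Im d0 + Int l (im f'')) * b.
  apply: (ae_sol fi fi' fi'' hi).
  - by apply: ae_onS fE => x _; rewrite /im => -> /=; rewrite add0r.
  - by rewrite -I0i.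
  - by apply: ae_onS fE' => x _; rewrite /im => ->; case: (d0).
  - apply: ae_onS (ae_onI hE qp) => x _ []; rewrite /im => -> ->.
    by case: (f'' x) (f x) => [? ?] [? ?] /=; ring.
split.
  apply: ae_onS (ae_onI Hr Hi) => x _ []; rewrite /csol /re /im => <- <-.
  by case: (f x).
move=> a b k Hk; rewrite cip_real//; last exact: hom_rL2 Hk.
rewrite (Kr _ _ _ Hk) (Ki _ _ _ Hk) dE.
by case: (d0) => x y; congr Complex; rewrite /=; ring.
Qed.

Lemma edge_eq_exists f h : L2 l f -> L2 l h ->
  ae_on l (fun x => f x = csol h x) ->
  exists f' f'' d0 dl, edge_eq f h f' f'' d0 dl.
Proof.
move=> f2 h2 fE; have /L2P[hr hi] := h2; have /L2P[fr fi] := f2.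
have [Ur [Vr [dr [[Ur2 Vr2] [UrE Ir] UrE' hrE]]]] : exists (U' U'' : R -> R) (d : R),
  [/\ rL2 l U' /\ rL2 l U'',
      ae_on l (fun x => re f x = prim l U' x) /\ Int l U' = 0,
      ae_on l (fun x => U' x = d + prim l U'' x) &
      ae_on l (fun x => re h x = - U'' x + p x * re f x)].
  by apply: sol_ae => //; apply: ae_onS fE => x _; rewrite /re => ->.
have [Ui [Vi [di [[Ui2 Vi2] [UiE Ii] UiE' hiE]]]] : exists (U' U'' : R -> R) (d : R),
  [/\ rL2 l U' /\ rL2 l U'',
      ae_on l (fun x => im f x = prim l U' x) /\ Int l U' = 0,
      ae_on l (fun x => U' x = d + prim l U'' x) &
      ae_on l (fun x => im h x = - U'' x + p x * im f x)].
  by apply: sol_ae => //; apply: ae_onS fE => x _; rewrite /im => ->.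
exists (fun x => Complex (Ur x) (Ui x)), (fun x => Complex (Vr x) (Vi x)).
exists (Complex dr di), (Complex (dr + Int l Vr) (di + Int l Vi)).
have U2 : L2 l (fun x => Complex (Ur x) (Ui x)) by apply/L2P.
have V2 : L2 l (fun x => Complex (Vr x) (Vi x)) by apply/L2P.
split.
- apply/H1P; split => //.
    apply: ae_onS (ae_onI UrE UiE) => x _ []; rewrite /re /im add0r => <- <-.
    by case: (f x).
  by rewrite add0r; congr Complex; rewrite /re /im /= ?Ir ?Ii.
- apply/H1P; split => //.
  by apply: ae_onS (ae_onI UrE' UiE') => x _ [-> ->].
- apply: ae_onS (ae_onI (ae_onI hrE hiE) qp) => x _ [[]]; rewrite /re /im.
  by case: (h x) (f x) => [? ?] [? ?] /= -> -> ->; congr Complex; ring.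
Qed.

End edge_operator.

(** * The Krein Laplacian of a graph *)

Section graph_operator.
Variables (R : realType) (G : mgraph R).
Variable p : edge G -> R -> R.
Hypothesis pp : forall e, potential (len e) (p e).

Local Notation V := (L2fun G).
Local Notation B := (gsip G).
Let l0 (e : edge G) := len_gt0 e.

Definition dirichlet_op (f : V) : V :=
  MkL2 (fun e => csol_L2 (l0 e) (pp e) (l2P f e)).

Lemma reP (f : V) e : rL2 (len e) (re (f e)).
Proof. by have /L2P[] := l2P f e. Qed.

Lemma imP (f : V) e : rL2 (len e) (im (f e)).
Proof. by have /L2P[] := l2P f e. Qed.

Lemma ripE (f g : V) : rip B f g =
  \sum_e (Int (len e) (fun x => re (f e) x * re (g e) x) +
          Int (len e) (fun x => im (f e) x * im (g e) x)).
Proof.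
rewrite /rip /= /gip /ginner raddf_sum; apply: eq_bigr => e _.
by rewrite -/(cip (len e) (f e) (g e)) cipE//; exact: l2P.
Qed.

Lemma nsqE (f : V) : nsq B f =
  \sum_e (Int (len e) (fun x => re (f e) x ^+ 2) +
          Int (len e) (fun x => im (f e) x ^+ 2)).
Proof. exact: ripE. Qed.

Lemma re_le_nsq (f : V) e : Int (len e) (fun x => re (f e) x ^+ 2) <= nsq B f.
Proof.
rewrite nsqE (bigD1 e)//= -addrA lerDl addr_ge0 ?Int_sqr_ge0//.
by apply: sumr_ge0 => i _; rewrite addr_ge0 ?Int_sqr_ge0.
Qed.

Lemma im_le_nsq (f : V) e : Int (len e) (fun x => im (f e) x ^+ 2) <= nsq B f.
Proof.
rewrite nsqE (bigD1 e)//= addrAC lerDr addr_ge0 ?Int_sqr_ge0//.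
by apply: sumr_ge0 => i _; rewrite addr_ge0 ?Int_sqr_ge0.
Qed.

Lemma re_dirichlet_op f e : re (dirichlet_op f e) = dirichlet (len e) (p e) (re (f e)).
Proof. by []. Qed.

Lemma im_dirichlet_op f e : im (dirichlet_op f e) = dirichlet (len e) (p e) (im (f e)).
Proof. by []. Qed.

Lemma dirichlet_op_sym f g : B (dirichlet_op f) g = B f (dirichlet_op g).
Proof.
rewrite /= /gip /ginner; apply: eq_bigr => e _.
rewrite -/(cip (len e) (dirichlet_op f e) (g e)) -/(cip (len e) (f e) (dirichlet_op g e)).
rewrite !cipE; [|exact: l2P..].
rewrite (re_dirichlet_op f e) (re_dirichlet_op g e).
rewrite (im_dirichlet_op f e) (im_dirichlet_op g e).
rewrite (dirichlet_sym (l0 e) (pp e) (reP f e) (reP g e)).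
rewrite (dirichlet_sym (l0 e) (pp e) (imP f e) (imP g e)).
rewrite (dirichlet_sym (l0 e) (pp e) (reP f e) (imP g e)).
by rewrite (dirichlet_sym (l0 e) (pp e) (imP f e) (reP g e)).
Qed.

(** One constant for the powers of the edge lengths that occur in the
    estimates. *)
Definition length_bound : R := \sum_(e : edge G) (len e + len e ^+ 2 + len e ^+ 3) + 1.

Lemma length_bound_ge (e : edge G) : [/\ 0 < length_bound, len e <= length_bound,
  len e ^+ 2 <= length_bound & len e ^+ 3 <= length_bound].
Proof.
have pos (i : edge G) : 0 <= len i + len i ^+ 2 + len i ^+ 3.
  by rewrite !addr_ge0 ?exprn_ge0// ltW.
rewrite /length_bound (bigD1 e)//=.
have S0 : 0 <= \sum_(i | i != e) (len i + len i ^+ 2 + len i ^+ 3).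
  by apply: sumr_ge0 => i _.
have l1 := l0 e; have l2 : 0 < len e ^+ 2 by rewrite exprn_gt0.
have l3 : 0 < len e ^+ 3 by rewrite exprn_gt0.
move: S0 l1 l2 l3; move: (\sum_(i | _) _) (len e ^+ 2) (len e ^+ 3) (len e).
by move=> *; split; lra.
Qed.

Lemma length_bound_gt0 : 0 < length_bound.
Proof.
rewrite /length_bound ltr_wpDl// sumr_ge0// => e _.
by rewrite !addr_ge0 ?exprn_ge0// ltW.
Qed.

Lemma dirichlet_op_bd f :
  nsq B (dirichlet_op f) <= length_bound * rip B (dirichlet_op f) f.
Proof.
rewrite nsqE ripE big_distrr /=; apply: ler_sum => e _.
have [_ _ l2 _] := length_bound_ge e.
have Hr := dirichlet_bounded (l0 e) (pp e) (reP f e).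
have Hi := dirichlet_bounded (l0 e) (pp e) (imP f e).
have Pr := dirichlet_ge0 (l0 e) (pp e) (reP f e).
have Pi := dirichlet_ge0 (l0 e) (pp e) (imP f e).
rewrite re_dirichlet_op im_dirichlet_op mulrDr; apply: lerD.
  by apply: (le_trans Hr); rewrite ler_wpM2r.
by apply: (le_trans Hi); rewrite ler_wpM2r.
Qed.

(** The functionals are the real and imaginary parts of the values of [dirichlet_op f]
    at [N] equidistant points of each edge. *)
Lemma dirichlet_op_cpt (eps : R) : 0 < eps ->
  exists (n : nat) (l : 'I_n -> V -> R) (K b : R),
  [/\ 0 < K /\ 0 < b,
      forall i f g, l i (f - g) = l i f - l i g,
      forall i f, l i f ^+ 2 <= b * nsq B f &
      forall f, nsq B (dirichlet_op f) <=
        eps * rip B (dirichlet_op f) f + K * \sum_i (l i f) ^+ 2].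
Proof.
move=> eps0; pose N := (Num.truncn (2 * length_bound / eps)).+1.
have Neps : 2 * length_bound / eps < N%:R by exact: truncnS_gt.
have N0 : 0 < N%:R :> R by rewrite ltr0n.
pose T := (edge G * 'I_N * bool)%type.
pose part (b : bool) (f : V) e := if b then re (f e) else im (f e).
pose pt (e : edge G) (i : nat) : R := i%:R * (len e / N%:R).
have ptI e (i : 'I_N) : 0 <= pt e i <= len e.
  rewrite /pt mulr_ge0 ?divr_ge0 ?(ltW (l0 e))//=.
  rewrite mulrCA ger_pMr ?l0// ler_pdivrMr// mul1r ler_nat.
  exact: ltnW.
have partP b f e : rL2 (len e) (part b f e).
  by case: b; [exact: reP|exact: imP].
pose L (t : T) (f : V) :=
    dirichlet (len t.1.1) (p t.1.1) (part t.2 f t.1.1) (pt t.1.1 t.1.2).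
exists #|{: T}|, (fun k => L (enum_val k)), (2 * length_bound), length_bound.
split; first by rewrite mulr_gt0 ?length_bound_gt0.
- move=> k f g; case: (enum_val k) => -[e i] b; rewrite /L /=.
  rewrite -(dirichletB (l0 e) (pp e))//; congr (dirichlet _ _ _ _).
  by case: b; apply/funext => x; rewrite /part /re /im l2addE l2oppE raddfB.
- move=> k f; case: (enum_val k) => -[e i] b; rewrite /L /=.
  have [T0 _ _ l3] := length_bound_ge e.
  apply: (le_trans (dirichlet_sup (l0 e) (pp e) (partP b f e) (ptI e i))).
  apply: ler_pM => //; [exact: exprn_ge0 (ltW (l0 e))|exact: Int_sqr_ge0|].
  by case: b => /=; [exact: re_le_nsq|exact: im_le_nsq].
move=> f; rewrite nsqE ripE.
have -> : \sum_(k < #|{: T}|) L (enum_val k) f ^+ 2 =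
    \sum_e (\sum_(i < N) dirichlet (len e) (p e) (re (f e)) (pt e i) ^+ 2 +
            \sum_(i < N) dirichlet (len e) (p e) (im (f e)) (pt e i) ^+ 2).
  have -> : \sum_(k < #|{: T}|) L (enum_val k) f ^+ 2 = \sum_(t : T) L t f ^+ 2.
    rewrite [RHS](reindex (fun k : 'I_#|{: T}| => enum_val k)) //=.
    by exists enum_rank => t _; rewrite ?enum_valK ?enum_rankK.
  rewrite -(pair_bigA _ (fun ei b => L (ei, b) f ^+ 2)) /=.
  rewrite -(pair_bigA _ (fun e i => \sum_(b : bool) L (e, i, b) f ^+ 2)) /=.
  apply: eq_bigr => e _; rewrite -big_split; apply: eq_bigr => i _.
  by rewrite big_bool.
rewrite 2!big_distrr -big_split /=; apply: ler_sum => e _.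
have [T0 l1 l2 _] := length_bound_ge e.
have E1 : 2 * len e ^+ 2 / N%:R <= eps.
  rewrite ler_pdivrMr// [leRHS]mulrC -ler_pdivrMr//.
  by apply: (le_trans _ (ltW Neps)); rewrite ler_wpM2r ?invr_ge0 ?(ltW eps0)// ler_wpM2l.
have E2 : 2 * len e <= 2 * length_bound by rewrite ler_wpM2l.
have part_le (h : R -> R) : rL2 (len e) h ->
    Int (len e) (fun x => dirichlet (len e) (p e) h x ^+ 2) <=
    eps * Int (len e) (fun x => dirichlet (len e) (p e) h x * h x) +
    2 * length_bound * \sum_(i < N) dirichlet (len e) (p e) h (pt e i) ^+ 2.
  move=> h2; apply: (le_trans (dirichlet_sample (l0 e) (pp e) (N := N) isT h2)).
  apply: lerD; first by rewrite ler_wpM2r// dirichlet_ge0.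
  by rewrite ler_wpM2r// sumr_ge0// => i _; exact: sqr_ge0.
apply: (le_trans (lerD (part_le _ (reP f e)) (part_le _ (imP f e)))).
by rewrite !mulrDr addrACA.
Qed.

Lemma sqrt_harmonic_cvg (c : R) :
  (fun n => Num.sqrt (c / n.+1%:R)) @ \oo --> (0 : R).
Proof.
have c0 : (fun n => c / n.+1%:R) @ \oo --> (0 : R).
  by rewrite -(mulr0 c); apply: cvgM; [exact: cvg_cst|exact: cvg_harmonic].
rewrite -(@sqrtr0 R).
by apply: cvg_comp; [exact: c0|exact: sqrt_continuous].
Qed.

(** Right-hand sides that are Cauchy in L^2 have solutions that are Cauchy in
    the supremum norm. *)
Lemma dirichlet_cvg e (h : nat -> R -> R) (c : R) :
  (forall n, rL2 (len e) (h n)) ->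
  (forall n m, (n <= m)%N ->
    Int (len e) (fun x => (h m x - h n x) ^+ 2) <= c / n.+1%:R) ->
  exists v, rL2 (len e) v /\ forall n,
    Int (len e) (fun x => (dirichlet (len e) (p e) (h n) x - v x) ^+ 2) <=
      len e * (len e ^+ 3 * c) / n.+1%:R.
Proof.
move=> h2 hc; have l1 := l0 e.
pose D : set (measurableTypeR R) := `]0, (len e)[%classic.
have Dc x : D x -> 0 <= x <= len e.
  by rewrite /D /= in_itv /= => /andP[x0 xl]; rewrite !ltW.
have c0 : 0 <= c.
  by have := hc 0 0 isT; rewrite divr1; apply: le_trans; exact: Int_sqr_ge0.
have C0 n : 0 <= len e ^+ 3 * c / n.+1%:R.
  by rewrite divr_ge0// mulr_ge0// exprn_ge0// ltW.
have [||v [mv Hv]] := @uniform_limit _ (len e)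
    (fun n => dirichlet (len e) (p e) (h n)) _ (sqrt_harmonic_cvg (len e ^+ 3 * c)).
- by move=> n; apply: rL2_measurable; exact: dirichlet_rL2.
- move=> n m x Dx nm; rewrite -(ler_pXn2r (n := 2)) ?nnegrE ?sqrtr_ge0//.
  rewrite real_normK ?num_real// sqr_sqrtr//.
  rewrite -(dirichletB l1 (pp e))// ?Dc//.
  apply: (le_trans (dirichlet_sup l1 (pp e) (rL2B (h2 m) (h2 n)) (Dc x Dx))).
  by rewrite -mulrA ler_wpM2l ?hc ?exprn_ge0 ?(ltW l1).
have v2 : rL2 (len e) v.
  have := dirichlet_rL2 l1 (pp e) (h2 0).
  have v0 : rL2 (len e) (fun x => v x - dirichlet (len e) (p e) (h 0) x).
    apply: (rL2_bounded l1 (M := Num.sqrt (len e ^+ 3 * c / 1%:R))) => [|x Dx].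
      by apply: measurable_funB => //; apply: rL2_measurable; exact: dirichlet_rL2.
    exact: Hv.
  move=> /(rL2D v0); congr (rL2 _ _).
  by apply/funext => x; rewrite subrK.
exists v; split => // n.
have d2 := rL2B (dirichlet_rL2 l1 (pp e) (h2 n)) v2.
rewrite -mulrA -[leRHS]mulrC -(Int_cst l1); apply: le_Int => //.
- by case: d2.
- exact: L1_cst.
- move=> x Dx; rewrite -real_normK ?num_real// distrC.
  rewrite -[leRHS]sqr_sqrtr// ler_pXn2r ?nnegrE ?sqrtr_ge0//; exact: Hv.
Qed.

Lemma dirichlet_op_cvg (f : nat -> V) (c : R) :
  (forall n m, (n <= m)%N -> nsq B (f m - f n) <= c / n.+1%:R) ->
  exists (g : V) (c' : R), forall n, nsq B (dirichlet_op (f n) - g) <= c' / n.+1%:R.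
Proof.
move=> fc.
have reB (f1 f2 : V) e x : re ((f1 - f2) e) x = re (f1 e) x - re (f2 e) x.
  by rewrite /re l2addE l2oppE raddfB.
have imB (f1 f2 : V) e x : im ((f1 - f2) e) x = im (f1 e) x - im (f2 e) x.
  by rewrite /im l2addE l2oppE raddfB.
have /choice[vr Hr] : forall e, exists v, rL2 (len e) v /\ forall n,
    Int (len e) (fun x => (dirichlet (len e) (p e) (re (f n e)) x - v x) ^+ 2) <=
      len e * (len e ^+ 3 * c) / n.+1%:R.
  move=> e; apply: dirichlet_cvg => [n|n m nm]; first exact: reP.
  apply: (le_trans _ (fc n m nm)); apply: (le_trans _ (re_le_nsq _ e)).
  by rewrite le_eqVlt; apply/orP; left; apply/eqP; apply: eq_Int => x _; rewrite reB.
have /choice[vi Hi] : forall e, exists v, rL2 (len e) v /\ forall n,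
    Int (len e) (fun x => (dirichlet (len e) (p e) (im (f n e)) x - v x) ^+ 2) <=
      len e * (len e ^+ 3 * c) / n.+1%:R.
  move=> e; apply: dirichlet_cvg => [n|n m nm]; first exact: imP.
  apply: (le_trans _ (fc n m nm)); apply: (le_trans _ (im_le_nsq _ e)).
  by rewrite le_eqVlt; apply/orP; left; apply/eqP; apply: eq_Int => x _; rewrite imB.
have g2 : gL2 (fun (e : edge G) x => Complex (vr e x) (vi e x)).
  by move=> e; apply/L2P; split; [exact: (Hr e).1|exact: (Hi e).1].
exists (MkL2 g2), (\sum_(e : edge G) 2 * (len e * (len e ^+ 3 * c))) => n.
rewrite nsqE mulr_suml; apply: ler_sum => e _.
have := (Hr e).2 n; have := (Hi e).2 n.
have -> : Int (len e) (fun x => re ((dirichlet_op (f n) - MkL2 g2) e) x ^+ 2) =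
    Int (len e) (fun x => (dirichlet (len e) (p e) (re (f n e)) x - vr e x) ^+ 2).
  by apply: eq_Int => x _; rewrite reB.
have -> : Int (len e) (fun x => im ((dirichlet_op (f n) - MkL2 g2) e) x ^+ 2) =
    Int (len e) (fun x => (dirichlet (len e) (p e) (im (f n e)) x - vi e x) ^+ 2).
  by apply: eq_Int => x _; rewrite imB.
by move=> H1 H2; rewrite (le_trans (lerD H2 H1))// -(mulrA 2) mulr_natl mulr2n.
Qed.

Lemma dirichlet_op_compact : compact_op B dirichlet_op.
Proof.
split.
- exact: dirichlet_op_sym.
- by exists length_bound; [exact: length_bound_gt0|exact: dirichlet_op_bd].
- exact: dirichlet_op_cpt.
- exact: dirichlet_op_cvg.
Qed.

End graph_operator.

Section krein_graph.
Variables (R : realType) (G : mgraph R).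
Variables p q : edge G -> R -> R.
Hypothesis pp : forall e, potential (len e) (p e).
Hypothesis qp : forall e, ae_on (len e) (fun x => q e x = p e x).

Local Notation V := (L2fun G).
Local Notation B := (gsip G).
Local Notation A := (dirichlet_op pp).
Let l0 (e : edge G) := len_gt0 e.

Definition vertex_kernel (v : vert G) (e : edge G) : R -> R :=
  kernel_fun (len e) (p e) (src e == v)%:R (tgt e == v)%:R.

Lemma vertex_kernel_hom v e :
  solves_hom (len e) (p e) (src e == v)%:R (tgt e == v)%:R (vertex_kernel v e).
Proof. exact: kernel_fun_hom. Qed.

Lemma graph_kernel_L2 v : gL2 (fun e x => Complex (vertex_kernel v e x) 0).
Proof.
move=> e; apply/L2P; split; last exact: rL2_cst.
by have := hom_rL2 (l0 e) (vertex_kernel_hom v e); exact.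
Qed.

Definition graph_kernel (v : vert G) : V := MkL2 (graph_kernel_L2 v).

Lemma l2sumE (I : finType) (c : I -> R[i]) (F : I -> V) e x :
  (lc c F) e x = \sum_i c i * F i e x.
Proof.
rewrite /lc; apply: (big_morph (fun f : V => f e x)) => [f g|//].
exact: l2addE.
Qed.

Lemma graph_kernel_lcE (c : vert G -> R[i]) e x : (lc c graph_kernel) e x =
  Complex (\sum_v complex.Re (c v) * vertex_kernel v e x)
          (\sum_v complex.Im (c v) * vertex_kernel v e x).
Proof.
rewrite l2sumE; apply/eqP; rewrite eq_complex /= !raddf_sum /=.
apply/andP; split; apply/eqP; apply: eq_bigr => v _;
  by case: (c v) => a b /=; ring.
Qed.

Lemma vertex_kernel_lc (c : vert G -> R) e :
  solves_hom (len e) (p e) (c (src e)) (c (tgt e))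
    (fun x => \sum_v c v * vertex_kernel v e x).
Proof.
have pick w : c w = \sum_v c v * (w == v)%:R.
  rewrite (bigD1 w)//= eqxx mulr1 big1 ?addr0// => v /negbTE.
  by rewrite eq_sym => ->; rewrite mulr0.
rewrite (pick (src e)) (pick (tgt e)).
have -> : (fun x => \sum_v c v * vertex_kernel v e x) =
    \sum_v (fun x => c v * vertex_kernel v e x).
  by apply/funext => x; rewrite fct_sumE.
elim/big_rec3: _ => [|v k b a _ IH]; first exact: hom0.
exact: homD (homZ _ _ _ (vertex_kernel_hom v e)) IH.
Qed.

(** On each edge this is [dirichlet_hom_ae0], applied to the real and the
    imaginary part. *)
Lemma dirichlet_op_free g : inspan B graph_kernel (A g) -> nsq B g = 0.
Proof.
move=> [c /geqnullP Ag]; apply/gnullP => e.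
have Hr : ae_on (len e) (fun x => re (g e) x = 0).
  apply: (dirichlet_hom_ae0 (l0 e) (pp e) (reP g e)
    (vertex_kernel_lc (fun v => complex.Re (c v)) e)).
  by apply: ae_onS (Ag e) => x _; rewrite graph_kernel_lcE => -[].
have Hi : ae_on (len e) (fun x => im (g e) x = 0).
  apply: (dirichlet_hom_ae0 (l0 e) (pp e) (imP g e)
    (vertex_kernel_lc (fun v => complex.Im (c v)) e)).
  by apply: ae_onS (Ag e) => x _; rewrite graph_kernel_lcE => -[].
apply: ae_onS (ae_onI Hr Hi) => x _; rewrite /re /im.
by case: (g e x) => a b /= [-> ->].
Qed.

(** A combination of kernels takes the value [c v] at [v], which is seen by an
    edge incident with [v]. *)
Lemma graph_kernel_free : (forall v : vert G, exists e, src e = v \/ tgt e = v) ->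
  free_fam B graph_kernel.
Proof.
move=> noiso c /geqnullP Hc v; have [e ve] := noiso v.
have [r1 r2] : complex.Re (c (src e)) = 0 /\ complex.Re (c (tgt e)) = 0.
  apply: (hom_ae0 (l0 e) (vertex_kernel_lc (fun v => complex.Re (c v)) e)).
  by apply: ae_onS (Hc e) => x _; rewrite graph_kernel_lcE => -[].
have [i1 i2] : complex.Im (c (src e)) = 0 /\ complex.Im (c (tgt e)) = 0.
  apply: (hom_ae0 (l0 e) (vertex_kernel_lc (fun v => complex.Im (c v)) e)).
  by apply: ae_onS (Hc e) => x _; rewrite graph_kernel_lcE => -[].
apply/eqP; rewrite eq_complex /=; case: ve => <-;
  by rewrite ?r1 ?r2 ?i1 ?i2 !eqxx.
Qed.

(** Green's formula on all edges: the kernel of [v] selects the boundary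
    derivatives at the endpoints located at [v]. *)
Lemma normal_derivative_graph_kernel (h : V) (d0 dl : edge G -> R[i]) v :
  (forall e, cip (len e) (h e) (fun x => Complex (vertex_kernel v e x) 0) =
    d0 e * Complex (src e == v)%:R 0 - dl e * Complex (tgt e == v)%:R 0) ->
  B h (graph_kernel v) = - normal_derivative d0 dl v.
Proof.
move=> H; rewrite /= /gip /ginner /normal_derivative opprB.
rewrite [X in X - _]big_mkcond [X in _ - X]big_mkcond -sumrB.
apply: eq_bigr => e _; rewrite -/(cip (len e) (h e) (graph_kernel v e)) H.
have E (z : R[i]) (b : bool) : z * Complex b%:R 0 = if b then z else 0.
  by case: b; [exact: mulr1|exact: mulr0].
by rewrite !E.
Qed.

(** A Dirichlet solution [u] with right-hand side [h] belongs to the domain of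
    [S] when its normal derivatives vanish, that is, when [h] is orthogonal to
    the vertex kernels. *)
Lemma opSP (u h : V) :
  opS q (l2val u) (l2val h) <-> eqnull B u (A h) /\ orth B graph_kernel h.
Proof.
split=> [[f' [f'' [f0 [fl [d0 [dl [fv [H1u H1u' cont fv0 [h2 hE]]]]]]]]]|[uA oh]].
  have Hedge e : edge_eq (len e) (q e) (u e) (h e) (f' e) (f'' e) (d0 e) (dl e).
    have [c0 cl] := cont e; split; [|exact: H1u'|exact: hE].
    by have := H1u e; rewrite c0 cl (fv0 (src e)).1 (fv0 (tgt e)).1.
  split.
    by apply/geqnullP => e; have [] := edge_eqP (l0 e) (pp e) (qp e) (h2 e) (Hedge e).
  move=> v; rewrite (normal_derivative_graph_kernel (d0 := d0) (dl := dl)).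
    by rewrite (fv0 v).2 oppr0.
  move=> e; have [_ He] := edge_eqP (l0 e) (pp e) (qp e) (h2 e) (Hedge e).
  exact: He (vertex_kernel_hom v e).
have /choice[f' Hf'] : forall e, exists f', exists f'' d0 dl,
    edge_eq (len e) (q e) (u e) (h e) f' f'' d0 dl.
  move=> e; apply: edge_eq_exists (pp e) (qp e) _ _ _ _ _;
    [exact: l0|exact: l2P|exact: l2P|by move/geqnullP: uA => /(_ e)].
have /choice[f'' Hf''] := Hf'; have /choice[d0 Hd0] := Hf''.
have /choice[dl Hdl] := Hd0.
exists f', f'', (fun=> 0), (fun=> 0), d0, dl, (fun=> 0); split => //.
- by move=> e; have [] := Hdl e.
- by move=> e; have [] := Hdl e.
- move=> v; split => //; apply/eqP; rewrite -oppr_eq0; apply/eqP.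
  rewrite -(oh v); apply/esym; apply: normal_derivative_graph_kernel => e.
  have [_ He] := edge_eqP (l0 e) (pp e) (qp e) (l2P h e) (Hdl e).
  exact: He (vertex_kernel_hom v e).
- by split; [exact: l2P|move=> e; have [] := Hdl e].
Qed.

Lemma opS_L2 (u w : gfun G) : opS q u w ->
  exists u' w' : V, l2val u' = u /\ l2val w' = w.
Proof.
move=> [f' [f'' [f0 [fl [d0 [dl [fv [H1u _ _ _ [w2 _]]]]]]]]].
have u2 : gL2 u by move=> e; have [] := H1u e.
by exists (MkL2 u2), (MkL2 w2).
Qed.

(** [f - A h] is orthogonal to every [w] in the range of [S], the complement of
    the finitely many vertex kernels, hence lies in their span. *)
Lemma adjointP (f h : V) :
  adjoint (opS q) (l2val f) (l2val h) <-> inspan B graph_kernel (f - A h).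
Proof.
split=> [[_ _ H]|H].
  apply: orth_orth => g og; rewrite ipBr -(dirichlet_op_sym pp).
  apply/eqP; rewrite subr_eq0; apply/eqP; apply: H.
  by apply/opSP; split => //; exact: eqnull_refl.
split; [exact: l2P|exact: l2P|] => u w uw.
have [u' [w' [uE wE]]] := opS_L2 uw; move: uw; rewrite -{}uE -{}wE.
move=> /opSP[uA ow]; rewrite -[LHS]/(B w' f) -[RHS]/(B u' h).
rewrite (eqnull_ipl _ uA) (dirichlet_op_sym pp).
have := orth_inspan ow H; rewrite ipBr => /eqP; rewrite subr_eq0 => /eqP.
by [].
Qed.

Lemma eigenfunctionP mu (f : gfun G) :
  eigenfunction (krein_laplacian q) mu f <->
  exists F : V, l2val F = f /\ krein_eigen B A graph_kernel mu F.
Proof.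
have zero_span (k : V) :
    adjoint (opS q) (l2val k) (fun _ _ => 0) <-> inspan B graph_kernel k.
  have A0 : eqnull B (k - A 0) k.
    rewrite -[X in eqnull _ _ X]subr0; apply: eqnullB; first exact: eqnull_refl.
    by apply: orth_eqnull => g; rewrite (dirichlet_op_sym pp) !ip0l.
  rewrite -[fun _ _ => 0]/(l2val (0 : V)) adjointP.
  by split; apply: inspan_eqnull => //; exact: eqnull_sym.
split=> [[Hadj [u [w [k [uw Hk fE]]]]]|[F [<- [Hspan [w [k [ow Hk FE]]]]]]].
  have [f2 _ _] := Hadj; pose F : V := MkL2 f2; exists F; split => //.
  have [u' [w' [uE wE]]] := opS_L2 uw; move: uw; rewrite -uE -wE => /opSP[uA ow].
  have [k2 _ _] := Hk; pose k' : V := MkL2 k2.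
  split; first exact: (adjointP F (Complex mu 0 *: F)).1 Hadj.
  exists w', k'; split => //; first exact: (zero_span k').1 Hk.
  apply: (@eqnull_trans _ _ _ (u' + k')).
    by apply/geqnullP => e; apply: ae_onS (fE e) => x _; rewrite l2addE -uE.
  by apply: eqnullD => //; exact: eqnull_refl.
split; first exact: (adjointP F (Complex mu 0 *: F)).2 Hspan.
exists (l2val (A w)), (l2val w), (l2val k); split.
- by apply/opSP; split => //; exact: eqnull_refl.
- exact: (zero_span k).2 Hk.
- by move/geqnullP: FE.
Qed.

Lemma krein_listing P lam : eigenvalue_listing (krein_laplacian q) P lam ->
  listing B (krein_eigen B A graph_kernel) P lam.
Proof.
move=> [mon Plam Hmu]; split => // mu Pmu.
have [n [phi [Ephi free_phi span_phi]] Hc] := Hmu mu Pmu; exists n => //.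
have /choice[Phi HPhi] : forall i, exists F : V,
    l2val F = phi i /\ krein_eigen B A graph_kernel mu F.
  by move=> i; apply/eigenfunctionP; exact: Ephi.
have lcE (c : 'I_n -> R[i]) e x : lincomb c phi e x = (lc c Phi) e x.
  by rewrite l2sumE; apply: eq_bigr => i _; rewrite -(HPhi i).1.
exists Phi; split => [i|c /geqnullP Hc0|F HF]; first by have [] := HPhi i.
  by apply: free_phi => e; apply: ae_onS (Hc0 e) => x _ H; rewrite lcE H.
have [|c fc] := span_phi (l2val F); first by apply/eigenfunctionP; exists F.
by exists c; apply/geqnullP => e; apply: ae_onS (fc e) => x _; rewrite lcE.
Qed.

End krein_graph.

(** * Attaching a graph *)

(** Truncate a Borel representative to the interval between 0 and the bound. *)
Lemma potential_ok_nice (R : realType) (G : mgraph R) (q : edge G -> R -> R) :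
  potential_ok q -> exists p : edge G -> R -> R,
    (forall e, potential (len e) (p e)) /\
    forall e, ae_on (len e) (fun x => q e x = p e x).
Proof.
move=> [mq [M qM] q0].
have /choice[q' Hq'] : forall e, exists q' : R -> R,
    measurable_fun `]0, len e[ q' /\ ae_on (len e) (fun x => q e x = q' x).
  by move=> e; have [q' m1 m2] := mq e; exists q'.
exists (fun e x => Num.min (Num.max (q' e x) 0) (Num.max M 0)); split=> e.
  split.
    apply: measurable_minr; last exact: measurable_cst.
    by apply: measurable_maxr; [exact: (Hq' e).1|exact: measurable_cst].
  exists (Num.max M 0) => x _; apply/andP; split; last by rewrite ge_min lexx orbT.
  by rewrite le_min !le_max lexx !orbT.
apply: ae_onS (ae_onI (Hq' e).2 (q0 e)) => x; rewrite /= in_itv /= => xl [qE q00].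
have := qM e x xl; rewrite ger0_norm// => qm.
by rewrite -qE (max_idPl q00) (min_idPl _)// le_max qm.
Qed.

Lemma connected_no_isolated (R : realType) (G : mgraph R) :
  graph_connected G -> forall v : vert G, exists e : edge G, src e = v \/ tgt e = v.
Proof.
move=> Gc v; have /card_gt0P[e _] := edge_nonempty G.
have [<-|vn] := eqVneq (src e) v; first by exists e; left.
have /connectP[[|w s] /=] := Gc v (src e).
  by move=> _ E; rewrite E eqxx in vn.
move=> /andP[/existsP[f /orP[]/andP[/eqP E1 /eqP E2]] _] _; exists f;
  by [left|right].
Qed.

Section attaching.
Variables (R : realType) (G G0 : mgraph R) (m : nat).
Variables (a : 'I_m -> vert G) (b : 'I_m -> vert G0).
Local Notation Gt := (attach a b).

Lemma card_attach : injective b -> #|vert Gt| = (#|vert G| + #|vert G0| - m)%N.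
Proof.
move=> b_inj; rewrite -[LHS]/#|{: vert G + {w : vert G0 | w \notin codom b}}|.
rewrite card_sum card_sig.
have -> : #|[pred w : vert G0 | w \notin codom b]| = (#|vert G0| - m)%N.
  have := cardC (mem (codom b)); rewrite card_codom// card_ord => <-.
  by rewrite addKn; apply: eq_card => w; rewrite !inE.
rewrite addnBA//.
by have := leq_card b b_inj; rewrite card_ord.
Qed.

Lemma attach_no_isolated :
  (forall v : vert G, exists e : edge G, src e = v \/ tgt e = v) ->
  (forall v : vert G0, exists e : edge G0, src e = v \/ tgt e = v) ->
  forall v : vert Gt, exists e : edge Gt, src e = v \/ tgt e = v.
Proof.
move=> H H0 [v|[w wb]].
  by have [e []<-] := H v; exists (inl e); [left|right].
have glue : attach_glue a b w = inr (exist _ w wb).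
  rewrite /attach_glue; case: {-}_ / boolP => [wb'|wb'].
    by exfalso; move/negP: wb; exact.
  by congr (inr (exist _ _ _)); exact: bool_irrelevance.
by have [e [] E] := H0 w; exists (inr e); [left|right]; rewrite /= E glue.
Qed.

Lemma sum_attach (M : nmodType) (F : edge Gt -> M) :
  \sum_e F e = \sum_(e : edge G) F (inl e) + \sum_(e : edge G0) F (inr e).
Proof. exact: big_sumType. Qed.

Definition extend (f : edge G -> R -> R[i]) : edge Gt -> R -> R[i] :=
  fun e => match e with inl e1 => f e1 | inr _ => fun=> 0 end.

Lemma extend_L2 (f : L2fun G) : gL2 (extend (l2val f)).
Proof. by case=> e; [exact: (l2P f e)|exact: (L2_0 (len_gt0 e))]. Qed.

Definition iota_attach (f : L2fun G) : L2fun Gt := MkL2 (extend_L2 f).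

Lemma cip_0r (l : R) (f : R -> R[i]) : 0 < l -> L2 l f -> cip l f (fun=> 0) = 0.
Proof.
move=> l0 f2; rewrite (cipC (L2_0 l0) f2) (_ : (fun=> 0) = (fun x => 0 * f x)).
  by rewrite cipZl// mul0r conjc0.
by apply/funext => x; rewrite mul0r.
Qed.

Lemma cip_0l (l : R) (f : R -> R[i]) : 0 < l -> L2 l f -> cip l (fun=> 0) f = 0.
Proof. by move=> l0 f2; rewrite (cipC f2 (L2_0 l0)) cip_0r// conjc0. Qed.

Lemma iota_isometry (f g : L2fun G) :
  gsip Gt (iota_attach f) (iota_attach g) = gsip G f g.
Proof.
rewrite /= /gip /ginner sum_attach [X in _ + X]big1 ?addr0// => e _.
exact: (cip_0r (len_gt0 e) (L2_0 (len_gt0 e))).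
Qed.

Lemma iota_lc n (c : 'I_n -> R[i]) (L : 'I_n -> L2fun G) :
  iota_attach (lc c L) = lc c (fun i => iota_attach (L i)).
Proof.
apply: L2fun_eq => -[e|e] x; rewrite l2sumE /=; first by rewrite l2sumE.
by rewrite big1// => i _; rewrite mulr0.
Qed.

Variables (p : edge G -> R -> R) (p0 : edge G0 -> R -> R).
Hypothesis pp : forall e, potential (len e) (p e).
Hypothesis pp0 : forall e, potential (len e) (p0 e).
Let pt : edge Gt -> R -> R := attach_potential p p0.

Lemma attach_potential_nice (e : edge Gt) : potential (len e) (pt e).
Proof. by case: e => e; [exact: pp|exact: pp0]. Qed.

Local Notation ppt := attach_potential_nice.

Lemma iota_dirichlet_op (f g : L2fun G) :
  gsip Gt (dirichlet_op ppt (iota_attach f)) (iota_attach g) =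
  gsip G (dirichlet_op pp f) g.
Proof.
rewrite /= /gip /ginner sum_attach [X in _ + X]big1 ?addr0// => e _.
exact: (cip_0r (len_gt0 e) (l2P (dirichlet_op ppt (iota_attach f)) (inr e))).
Qed.

(** The restriction to [G] of the kernel of a vertex of the attached graph is
    the kernel of the same vertex of [G], or zero for a new vertex. *)
Lemma iota_orth (f : L2fun G) : orth (gsip G) (graph_kernel pp) f ->
  orth (gsip Gt) (graph_kernel ppt) (iota_attach f).
Proof.
move=> of_ v; rewrite /= /gip /ginner sum_attach [X in _ + X]big1 ?addr0; last first.
  by move=> e _; exact: (cip_0l (len_gt0 e) (l2P (graph_kernel ppt v) (inr e))).
case: v => [v|w]; first exact: (of_ v).
apply: big1 => e _.
have k0 x : `]0, len e[%classic x ->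
    vertex_kernel pt (inr w : vert Gt) (inl e : edge Gt) x = 0.
  apply: (hom_unique (len_gt0 e) (pp e)).
  exact: (vertex_kernel_hom ppt (inr w : vert Gt) (inl e : edge Gt)).
rewrite -/(cip (len e) (f e) (graph_kernel ppt (inr w : vert Gt) (inl e : edge Gt))).
rewrite cip_real; [|exact: len_gt0|exact: l2P|].
  have E (u : R -> R) : Int (len e) (fun x => u x *
      vertex_kernel pt (inr w : vert Gt) (inl e : edge Gt) x) = 0.
    rewrite (eq_Int (g := fun=> 0)) ?(Int_cst (len_gt0 e)) ?mul0r// => x Dx.
    by rewrite k0// mulr0.
  by rewrite !E.
exact: (hom_rL2 (len_gt0 e)
  (vertex_kernel_hom ppt (inr w : vert Gt) (inl e : edge Gt))).
Qed.

End attaching.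

Theorem theorem4p13 (R : realType) (G G0 : mgraph R)
    (q : edge G -> R -> R) (q0 : edge G0 -> R -> R)
    (m : nat) (a : 'I_m -> vert G) (b : 'I_m -> vert G0)
    (G_connected : graph_connected G) (G0_connected : graph_connected G0)
    (q_ok : potential_ok q) (q0_ok : potential_ok q0)
    (m_gt0 : (0 < m)%N) (a_inj : injective a) (b_inj : injective b) :
  let K := krein_laplacian q in
  let Kt := krein_laplacian (attach_potential (a := a) (b := b) q q0) in
  (forall lamp lamtp : nat -> R,
     eigenvalue_listing K [set mu | 0 < mu] lamp ->
     eigenvalue_listing Kt [set mu | 0 < mu] lamtp ->
     forall j : nat, lamtp j <= lamp j) /\
  (forall lam lamt : nat -> R,
     eigenvalue_listing K setT lam ->
     eigenvalue_listing Kt setT lamt ->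
     forall j : nat, lamt (j + #|vert G0| - m)%N <= lam j).
Proof.
have [p [pp qp]] := potential_ok_nice q_ok.
have [p0 [pp0 qp0]] := potential_ok_nice q0_ok.
pose ppt := @attach_potential_nice _ _ _ _ a b _ _ pp pp0.
have qpt (e : edge (attach a b)) : ae_on (len e)
    (fun x => attach_potential (a := a) (b := b) q q0 e x =
              attach_potential (a := a) (b := b) p p0 e x).
  by case: e => e; [exact: qp|exact: qp0].
have compare lam lam' :
    listing (gsip G)
      (krein_eigen (gsip G) (dirichlet_op pp) (graph_kernel pp)) [set mu | 0 < mu] lam ->
    listing (gsip (attach a b))
      (krein_eigen (gsip _) (dirichlet_op ppt) (graph_kernel ppt))
      [set mu | 0 < mu] lam' ->
    forall j, lam' j <= lam j.
  apply: (krein_comparison (dirichlet_op_compact pp) (dirichlet_op_free (pp := pp))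
    (dirichlet_op_compact ppt) (dirichlet_op_free (pp := ppt))
    (iota := @iota_attach _ _ _ _ a b)).
  - exact: iota_isometry.
  - exact: iota_dirichlet_op.
  - exact: iota_orth.
  - exact: iota_lc.
split=> [lam lamt Hlam Hlamt|lam lamt Hlam Hlamt j].
  by apply: compare; [exact: krein_listing Hlam|exact: krein_listing Hlamt].
have noiso := connected_no_isolated G_connected.
have noisot := attach_no_isolated noiso (connected_no_isolated G0_connected).
have [z lam_ge0 Hpos]
  := krein_listing_shift (dirichlet_op_compact pp) (dirichlet_op_free (pp := pp))
  (graph_kernel_free noiso) (krein_listing pp qp Hlam).
have [zt lamt_ge0 Hpost]
  := krein_listing_shift (dirichlet_op_compact ppt) (dirichlet_op_free (pp := ppt))
  (graph_kernel_free (noisot _ a b)) (krein_listing ppt qpt Hlamt).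
have mV0 : (m <= #|vert G0|)%N.
  by have := leq_card b b_inj; rewrite card_ord.
have [jV|Vj] := ltnP j #|vert G|.
  have : lamt (j + #|vert G0| - m)%N == 0.
    rewrite zt card_attach//; lia.
  by move=> /eqP->; exact: lam_ge0.
have := compare _ _ Hpos Hpost (j - #|vert G|)%N.
rewrite card_attach// subnKC//.
by have -> : (#|vert G| + #|vert G0| - m + (j - #|vert G|) = j + #|vert G0| - m)%N by lia.
Qed.
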